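(* Let $x\in(0,1)$ be non-dyadic and let $G_{\Omega_x}(s,t)=\lim_{m\to\infty}G^m_{\Omega_x}(s,t)$ (uniform limit). Then $G_{\Omega_x}$ is the Green's function for $\Omega_x$, namely, for any continuous $F$, $$u(s)=\int_{\Omega_x}G_{\Omega_x}(s,t)F(t)\,dt$$ solves the Dirichlet problem $-\Delta u=F$ on $\Omega_x$ with $u|_{\partial\Omega_x}=0$.
   Context: Let $q_0,q_1,q_2$ be the vertices of an equilateral triangle of height $1$ in the plane, $q_0$ on top and $q_1q_2$ horizontal; $F_i(p)=(p+q_i)/2$; $\mathcal{SG}$ is the Sierpinski gasket, i.e. the attractor of $F_0,F_1,F_2$. Products and powers of the $F_i$ are compositions. $V_0=\{q_0,q_1,q_2\}$, $V_k=\bigcup_iF_iV_{k-1}$. A $k$-cell is a set $F_{i_1}\cdots F_{i_k}(\mathcal{SG})$; its vertices are the images of $V_0$; two points of $V_k$ are $k$-neighbors if they are distinct vertices of a common $k$-cell. Let $x\in(0,1)$ be not a dyadic rational, written uniquely as $x=\sum_{k\ge1}2^{-n_k}$ with integers $0<n_1<n_2<\cdots$ (infinite sequence); $n_0=0$. Let $L_x$ be the horizontal line at distance $x$ below $q_0$, $\Omega_x$ the set of points of $\mathcal{SG}$ strictly above $L_x$, $S(x)=\mathcal{SG}\cap L_x$, $\partial\Omega_x=\{q_0\}\cup S(x)$. $F$ continuous means continuous on $\Omega_x\cup S(x)$. Put $Rx=x-2^{-n_1}$ and $y_m=2^{n_m}R^mx$ (so $y_0=x$). The function $m_0$ satisfies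 $m_0(x)=\dfrac{1}{1+2(5/3)^{n_2-n_1}(1-m_0(Rx))}$ and is defined as $m_0(x)=\lim_k m_0^{(k)}(x)$, where $m_0^{(k)}(x)=t_1$ with $t_k=0$ and $t_j=\left(1+2(5/3)^{n_{j+1}-n_j}(1-t_{j+1})\right)^{-1}$ for $1\le j<k$. Energy: $\mathcal{E}_{\Omega_x}(u)=\lim_{m\to\infty}\left(\frac53\right)^{n_m}\sum_C\sum_{\{p,q\}}(u(p)-u(q))^2$, $C$ over the $n_m$-cells contained in $\Omega_x$ and $\{p,q\}$ over pairs of distinct vertices of $C$; $\mathcal{E}_{\Omega_x}(u,v)$ is the polarized bilinear form; $\mathrm{dom}_0\mathcal{E}_{\Omega_x}$ is the space of continuous functions on $\Omega_x\cup S(x)$ of finite energy vanishing on $\partial\Omega_x$. $dt$ is the standard self-similar probability measure on $\mathcal{SG}$ (each $k$-cell has measure $3^{-k}$), $\Delta$ the standard Kigami Laplacian: $-\Delta u=F$ on $\Omega_x$ with $u|_{\partial\Omega_x}=0$ means $u\in\mathrm{dom}_0\mathcal{E}_{\Omega_x}$ and $\mathcal{E}_{\Omega_x}(u,v)=\int_{\Omega_x}Fv\,dt$ for all $v\in\mathrm{dom}_0\mathcal{E}_{\Omega_x}$. For a word $\omega=(\omega_1,\dots,\omega_m)$, $\omega_j\in\{1,2\}$, put $\tilde F_\omega=F_0^{n_1-1}F_{\omega_1}F_0^{n_2-n_1-1}F_{\omega_2}\cdots F_0^{n_m-n_{m-1}-1}F_{\omega_m}$. For $l\ge1$ let $T_x^l=\{\tilde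 F_\omega(q_0):|\omega|=l\}\subset (V_{n_l}\setminus V_{n_l-1})\cap\Omega_x$. Splines: for $z\in(V_k\setminus V_{k-1})\cap\Omega_x$, $k\ge1$, not of the form $z\in T_x^l$ with $k=n_l$, $\phi_z^k$ is the (restriction to $\Omega_x\cup S(x)$ of the) function on $\mathcal{SG}$ with $\phi_z^k(t)=\delta_{zt}$ for $t\in V_k$, extended harmonically on each $k$-cell. For $z\in T_x^l$, $k=n_l$, $\phi_z^{n_l}$ is the continuous function on $\Omega_x\cup S(x)$ with value $1$ at $z$, $0$ at the other points of $V_{n_l}\cap\Omega_x$ and on $S(x)$, and harmonic ($\Delta\phi=0$) on the rest of $\Omega_x$. For $m\ge1$, $$G_{\Omega_x}^m(s,t)=\sum_{k=1}^{n_m}\ \sum_{z,z'\in(V_k\setminus V_{k-1})\cap\Omega_x}g_x(z,z')\phi_z^k(s)\phi_{z'}^k(t),$$ where $g_x(z,z')$ is: - $\dfrac{m_0(y_{l-1})+m_0(y_{l-1})^2}{2m_0(y_{l-1})+1}\left(\frac35\right)^{n_l}$ if $z=z'\in T_x^l$, $l\le m$; - $\dfrac{m_0(y_{l-1})^2}{2m_0(y_{l-1})+1}\left(\frac35\right)^{n_l}$ if $z\ne z'\in T_x^l$ are $n_l$-neighbors, $l\le m$; - if $z,z'\in V_k\setminus V_{k-1}$ lie in a common $(k-1)$-cell contained in $\Omega_x$: $\frac{3}{10}\left(\frac35\right)^k$ when $z=z'$ and $\frac1{10}\left(\frac35\right)^k$ when $z\neq z'$; - $0$ otherwise. *)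

(* Defs.v *)
From HB Require Import structures.
From mathcomp Require Import all_boot all_order all_algebra.
From mathcomp Require Import all_classical all_reals all_analysis.

Set Implicit Arguments.
Unset Strict Implicit.
Unset Printing Implicit Defensive.

Import Order.TTheory GRing.Theory Num.Theory.
Import numFieldNormedType.Exports.

Local Open Scope classical_set_scope.
Local Open Scope ring_scope.

Section Gasket.
Context {R : realType}.

(* The plane is R * R; the equilateral triangle of height 1 has side
   2 / sqrt 3 and its base is placed on the line p.2 = 0. *)
Definition q (i : 'I_3) : R * R :=
  if val i is 0%N then (0, 1)
  else if val i is 1%N then (- (Num.sqrt 3)^-1, 0)
  else ((Num.sqrt 3)^-1, 0).

Definition Fmap (i : 'I_3) (p : R * R) : R * R :=
  ((p.1 + (q i).1) / 2, (p.2 + (q i).2) / 2).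

(* Fword [:: i_1; ...; i_k] is F_(i_1) o ... o F_(i_k). *)
Definition Fword (w : seq 'I_3) (p : R * R) : R * R := foldr Fmap p w.

Definition is_attractor (K : set (R * R)) : Prop :=
  [/\ K !=set0, compact K & K = \bigcup_(i in [set: 'I_3]) (Fmap i @` K)].

(* By Hutchinson's theorem there is exactly one such set. *)
Definition SG : set (R * R) := xget set0 is_attractor.

Fixpoint V (k : nat) : set (R * R) :=
  if k is k'.+1 then \bigcup_(i in [set: 'I_3]) (Fmap i @` V k') else range q.

Definition cell (w : seq 'I_3) : set (R * R) := Fword w @` SG.

Definition neighbors (k : nat) (p p' : R * R) : Prop :=
  exists w : seq 'I_3, exists i j : 'I_3,
    [/\ size w = k, i != j, p = Fword w (q i) & p' = Fword w (q j)].

Definition self_similar (mu : probability (R * R)%type R) : Prop :=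
  forall w : seq 'I_3, mu (cell w) = ((3^-1) ^+ size w)%:E.

(* Distinct words of length n give distinct n-cells, so summing over words is
   summing over cells. *)
Definition graph_energy (D : set (R * R)) (n : nat) (u : R * R -> R) : R :=
  (5 / 3) ^+ n *
  \sum_(w : n.-tuple 'I_3 | `[< cell w `<=` D >])
    \sum_(i : 'I_3) \sum_(j : 'I_3 | (i < j)%N)
      (u (Fword w (q i)) - u (Fword w (q j))) ^+ 2.

(* [lv] is the sequence of levels along which the limit is taken. *)
Definition finite_energy (D : set (R * R)) (lv : nat -> nat)
    (u : R * R -> R) : Prop :=
  cvgn (fun m => graph_energy D (lv m) u).

Definition energy (D : set (R * R)) (lv : nat -> nat) (u : R * R -> R) : R :=
  limn (fun m => graph_energy D (lv m) u).

Definition energy_form (D : set (R * R)) (lv : nat -> nat)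
    (u v : R * R -> R) : R :=
  (energy D lv (u \+ v) - energy D lv (u \- v)) / 4.

(* Functions on a subset Y of the plane are represented by total functions;
   their values outside Y are irrelevant. *)
Definition edom (D : set (R * R)) (lv : nat -> nat) (Y : set (R * R))
    (u : R * R -> R) : Prop :=
  {within Y, continuous u} /\ finite_energy D lv u.

Definition edom0 (D : set (R * R)) (lv : nat -> nat) (Y B : set (R * R))
    (u : R * R -> R) : Prop :=
  edom D lv Y u /\ (forall p, B p -> u p = 0).

(* Weak form of "Laplacian of u is 0 on Y \ B". *)
Definition harmonic_off (D : set (R * R)) (lv : nat -> nat)
    (Y B : set (R * R)) (u : R * R -> R) : Prop :=
  edom D lv Y u /\
  (forall v, edom0 D lv Y B v -> energy_form D lv u v = 0).

Definition harmonic_on_cell (w : seq 'I_3) (u : R * R -> R) : Prop :=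
  harmonic_off (cell w) id (cell w) (Fword w @` V 0) u.

Definition dyadic (x : R) : Prop :=
  exists a b : nat, x = a%:R / 2 ^+ b.

Definition is_binary_exponents (x : R) (n : nat -> nat) : Prop :=
  [/\ n 0%N = 0%N, (forall k, (n k < n k.+1)%N) &
      series (fun k => (2 ^+ n k.+1)^-1 : R) @ \oo --> x].

Definition nexp (x : R) : nat -> nat :=
  xget (fun=> 0%N) (is_binary_exponents x).

Definition Omega (x : R) : set (R * R) := [set p | SG p /\ 1 - x < p.2].

Definition Sline (x : R) : set (R * R) := [set p | SG p /\ p.2 = 1 - x].

Definition Omega_bar (x : R) : set (R * R) := Omega x `|` Sline x.

Definition bdOmega (x : R) : set (R * R) := [set q ord0] `|` Sline x.

Definition strip (x : R) : R := x - (2 ^+ nexp x 1)^-1.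

Definition y (x : R) (m : nat) : R := 2 ^+ nexp x m * iter m strip x.

(* m0_tail n d j is t_j when the recursion is started from t_(j + d) = 0. *)
Fixpoint m0_tail (n : nat -> nat) (d j : nat) : R :=
  if d is d'.+1 then
    (1 + 2 * (5 / 3) ^+ (n j.+1 - n j)%N * (1 - m0_tail n d' j.+1))^-1
  else 0.

Definition m0_trunc (k : nat) (x : R) : R := m0_tail (nexp x) k.-1 1.

Definition m0 (x : R) : R := limn (fun k => m0_trunc k x).

Definition dom0 (x : R) : (R * R -> R) -> Prop :=
  edom0 (Omega x) (nexp x) (Omega_bar x) (bdOmega x).

Definition energyOmega (x : R) : (R * R -> R) -> (R * R -> R) -> R :=
  energy_form (Omega x) (nexp x).

Definition solves_dirichlet (mu : probability (R * R)%type R) (x : R)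
    (F u : R * R -> R) : Prop :=
  dom0 x u /\
  (forall v, dom0 x v ->
     energyOmega x u v = \int[mu]_(t in Omega x) (F t * v t)).

(* The word of F~_omega: each letter omega_(j+1) is preceded by
   n_(j+1) - n_j - 1 zeros. *)
Definition tword (x : R) (w : seq 'I_3) : seq 'I_3 :=
  flatten [seq rcons (nseq (nexp x j.+1 - nexp x j - 1)%N ord0) (nth ord0 w j)
          | j <- iota 0 (size w)].

Definition T (x : R) (l : nat) : set (R * R) :=
  [set z | exists w : seq 'I_3,
     [/\ size w = l, all (fun i => i != ord0) w &
         z = Fword (tword x w) (q ord0)]].

Definition newV (x : R) (k : nat) : set (R * R) :=
  (V k `\` V k.-1) `&` Omega x.

Definition is_T_level (x : R) (k : nat) (z : R * R) : Prop :=
  exists l : nat, [/\ (1 <= l)%N, k = nexp x l & T x l z].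

Definition is_gasket_spline (k : nat) (z : R * R) (phi : R * R -> R) : Prop :=
  [/\ {within SG, continuous phi},
      (forall t, V k t -> phi t = (t == z)%:R) &
      (forall w : seq 'I_3, size w = k -> harmonic_on_cell w phi)].

Definition is_boundary_spline (x : R) (k : nat) (z : R * R)
    (phi : R * R -> R) : Prop :=
  [/\ phi z = 1,
      (forall t, (V k `&` Omega x) t -> t <> z -> phi t = 0),
      (forall t, Sline x t -> phi t = 0) &
      harmonic_off (Omega x) (nexp x) (Omega_bar x)
        (bdOmega x `|` (V k `&` Omega x)) phi].

Definition is_spline (x : R) (k : nat) (z : R * R) (phi : R * R -> R) : Prop :=
  (is_T_level x k z -> is_boundary_spline x k z phi) /\
  (~ is_T_level x k z -> is_gasket_spline k z phi).

(* These properties determine the spline on Omega_bar x. *)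
Definition spline (x : R) (k : nat) (z : R * R) : R * R -> R :=
  xget (fun=> 0) (is_spline x k z).

Definition common_cell (x : R) (k : nat) (z z' : R * R) : Prop :=
  exists w : seq 'I_3,
    [/\ size w = k, cell w `<=` Omega x, cell w z & cell w z'].

(* The index l with z, z' in T_x^l is unique, since T_x^l lies in
   V (nexp x l) `\` V (nexp x l).-1; hence the choice made by [pick] is
   immaterial. *)
Definition gcoef (x : R) (m k : nat) (z z' : R * R) : R :=
  if [pick l : 'I_m.+1 | `[< [/\ (1 <= l)%N, T x l z, T x l z' &
                              z = z' \/ neighbors (nexp x l) z z'] >]] is Some l
  then
    let a := m0 (y x l.-1) in
    if z == z' then (a + a ^+ 2) / (2 * a + 1) * (3 / 5) ^+ nexp x l
    else a ^+ 2 / (2 * a + 1) * (3 / 5) ^+ nexp x l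
  else if `[< common_cell x k.-1 z z' >] then
    if z == z' then 3 / 10 * (3 / 5) ^+ k else 1 / 10 * (3 / 5) ^+ k
  else 0.

Definition Gm (x : R) (m : nat) (s t : R * R) : R :=
  \sum_(1 <= k < (nexp x m).+1)
    \sum_(z \in newV x k) \sum_(z' \in newV x k)
      gcoef x m k z z' * spline x k z s * spline x k z' t.

Definition Green (x : R) (s t : R * R) : R := limn (fun m => Gm x m s t).

End Gasket.

(* Main.v *)
(* At a dyadic level n the line crosses the cells whose top vertex has depth
   floor (2^n x) / 2^n; replacing each of them by one conductor from its top
   vertex to the line (of conductance [gam n], given by the continued fraction
   defining m_0) gives a finite network with form [Eh n].  The splines are
   orthogonal for these forms, except within a cell or a pair of points of
   T_x^l, where [g_x] is the inverse of the 3x3 or 2x2 Gram matrix.  Hence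
   Eh n u v is the integral of F against the interpolant of v at level n,
   where u is the Green potential of F.  The interpolants converge uniformly to
   v, and the energy of the conductors tends to 0 for every v in the Dirichlet
   domain, by comparison of v with its interpolants; so the energy of u and v is
   the integral of F v. *)
Require Import Defs.
From mathcomp Require Import all_boot all_order all_algebra.
From mathcomp Require Import all_classical all_reals all_analysis.
From mathcomp Require Import zify ring lra.
Set Implicit Arguments.
Unset Strict Implicit.
Unset Printing Implicit Defensive.
Import Order.TTheory GRing.Theory Num.Theory.
Import numFieldNormedType.Exports.
Local Open Scope classical_set_scope.
Local Open Scope ring_scope.

(** * The gasket and its cells *)

Section Ord3.

(** [SG], [nexp] and [spline] are picked by [xget]. For [SG] only the attractor equation and
    compactness are used; [nexp] and [spline] need existence and uniqueness. The splines are
    therefore built by subdivision and then recognised: two candidates differ by a function of zero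
    energy with enough zeros to vanish. The shape of a crossing cell is ruled by the next binary
    digit of [x]. At a digit 0 only its top child still reaches above the line. At a digit 1 the top
    child lies above the line and the other two children cross it; by symmetry the two midpoints
    where they hang carry the same fraction of the top potential, and Kirchhoff's law there is the
    recursion for [m0]. Two difficulties come from the line. At a digit 0 the value at the top of a
    crossing cell does not shrink, so moduli of continuity are measured by [lev n], the number of
    digits 1 met so far, and not by [n]. And the graph energy ignores the crossing cells: the
    missing term [Bd] is controlled by a conserved flux when one argument is eventually harmonic,
    and by minimality of the interpolant in general. *)

Definition o1 : 'I_3 := Ordinal (isT : (1 < 3)%N).
Definition o2 : 'I_3 := Ordinal (isT : (2 < 3)%N).

Lemma ord3P (P : 'I_3 -> Prop) : P ord0 -> P o1 -> P o2 -> forall i, P i.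
Proof.
move=> P0 P1 P2 [[|[|[|//]]] h]; [move: P0|move: P1|move: P2];
  by congr P; exact: val_inj.
Qed.

Lemma big_ord3 (V : nmodType) (F : 'I_3 -> V) :
  \sum_(i < 3) F i = F ord0 + F o1 + F o2.
Proof.
rewrite !big_ord_recl big_ord0 addr0 addrA.
by congr (_ + F _ + F _); exact: val_inj.
Qed.

(* The third index when [i != j]; a junk value when [i = j]. *)
Definition opp (i j : 'I_3) : 'I_3 := inord (3 - i - j).

Lemma oppC i j : opp i j = opp j i.
Proof. by rewrite /opp subnAC. Qed.

Lemma opp01 : opp ord0 o1 = o2. Proof. by apply: val_inj; rewrite /= inordK. Qed.
Lemma opp02 : opp ord0 o2 = o1. Proof. by apply: val_inj; rewrite /= inordK. Qed.
Lemma opp12 : opp o1 o2 = ord0. Proof. by apply: val_inj; rewrite /= inordK. Qed.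
Lemma opp10 : opp o1 ord0 = o2. Proof. by rewrite oppC opp01. Qed.
Lemma opp20 : opp o2 ord0 = o1. Proof. by rewrite oppC opp02. Qed.
Lemma opp21 : opp o2 o1 = ord0. Proof. by rewrite oppC opp12. Qed.
Definition oppE := (opp01, opp02, opp12, opp10, opp20, opp21).

End Ord3.

Section GasketGeometry.
Context {R : realType}.
Implicit Types (p : R * R) (i j : 'I_3) (w : seq 'I_3).

Let sqrt3_neq0 : Num.sqrt 3 != 0 :> R.
Proof. by rewrite gt_eqF // sqrtr_gt0 ltr0n. Qed.

(** Barycentric coordinates with respect to the [q i]; coordinate [ord0] is the height. Each
    [Fmap i] acts on them by a halving and a shift, so the geometry of the cells becomes linear
    arithmetic. *)
Definition bary j p : R :=
  match val j with
  | 0%N => p.2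
  | 1%N => (1 - p.2 - Num.sqrt 3 * p.1) / 2
  | _ => (1 - p.2 + Num.sqrt 3 * p.1) / 2
  end.

Lemma bary_q j i : bary j (q i) = (i == j)%:R.
Proof.
elim/ord3P: j; elim/ord3P: i; rewrite /bary /q /= ?mulr0 ?mulr1 ?mulrN ?divff //;
  lra.
Qed.

Lemma bary_F j i p : bary j (Fmap i p) = (bary j p + (i == j)%:R) / 2.
Proof.
rewrite -(bary_q j i); elim/ord3P: j; rewrite /bary /Fmap /=; lra.
Qed.

Lemma bary_sum p : bary ord0 p + bary o1 p + bary o2 p = 1.
Proof. by rewrite /bary /=; lra. Qed.

Lemma bary_inj p p' : (forall j, bary j p = bary j p') -> p = p'.
Proof.
case: p p' => [a b] [a' b'] h.
have := h ord0; have := h o1; rewrite /bary /= => h1 h0.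
by congr pair => //; apply: (mulfI sqrt3_neq0); lra.
Qed.

Lemma bary_continuous j : continuous (bary j).
Proof.
elim/ord3P: j => p; rewrite /bary /=.
- exact: cvg_snd.
- apply: cvgM; last exact: cvg_cst.
  apply: cvgB; first by apply: cvgB; [exact: cvg_cst|exact: cvg_snd].
  by apply: cvgM; [exact: cvg_cst|exact: cvg_fst].
- apply: cvgM; last exact: cvg_cst.
  apply: cvgD; first by apply: cvgB; [exact: cvg_cst|exact: cvg_snd].
  by apply: cvgM; [exact: cvg_cst|exact: cvg_fst].
Qed.

Lemma Fmap_inj i : injective (Fmap i : R * R -> R * R).
Proof.
move=> p p' e; apply: bary_inj => j.
by have := congr1 (bary j) e; rewrite !bary_F; lra.
Qed.

Lemma Fmap_continuous i : continuous (Fmap i : R * R -> R * R).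
Proof.
have -> : Fmap i = (fun p : R * R => 2^-1 *: (p + q i)).
  by apply/funext => p; congr pair; rewrite /= mulrC.
move=> p; apply: cvgZ; first exact: cvg_cst.
by apply: cvgD; [exact: cvg_id|exact: cvg_cst].
Qed.

Lemma Fmap_q i : Fmap i (q i) = q i :> R * R.
Proof. by rewrite /Fmap; case: (q i) => a b /=; congr pair; lra. Qed.

Definition triangle : set (R * R) := [set p | forall j, 0 <= bary j p].

Lemma triangle_compact : compact triangle.
Proof.
have -> : triangle = \bigcap_(j in [set: 'I_3]) (bary j @^-1` [set t | 0 <= t]).
  by apply/seteqP; split => [p h j _|p h j]; [exact: (h j)|exact: (h j I)].
have cl : closed (\bigcap_(j in [set: 'I_3]) (bary j @^-1` [set t | 0 <= t])).
  apply: closed_bigI => j _; apply: preimage_closed; last exact: closed_ge.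
  by move=> p _; exact: bary_continuous.
apply: (@subclosed_compact _ _
  ([set` `[- (Num.sqrt 3)^-1, (Num.sqrt 3)^-1]] `*` [set` `[0, 1 : R]]) cl).
  by apply: compact_setX; exact: segment_compact.
move=> p h; have h0 := h ord0 I; have h1 := h o1 I; have h2 := h o2 I.
rewrite /= /bary /= in h0 h1 h2.
have s0 : 0 < Num.sqrt 3 :> R by rewrite sqrtr_gt0 ltr0n.
split; rewrite /= in_itv /=; last by apply/andP; split; lra.
rewrite -[X in - X]mul1r -mulNr -[X in _ && (_ <= X)]mul1r.
by rewrite ler_pdivrMr // ler_pdivlMr //; apply/andP; split; lra.
Qed.

Fixpoint pre_gasket n : set (R * R) :=
  if n is n'.+1 then \bigcup_(i in [set: 'I_3]) (Fmap i @` pre_gasket n')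
  else triangle.

Lemma pre_gasket_compact n : compact (pre_gasket n).
Proof.
elim: n => [|n ih] /=; first exact: triangle_compact.
have -> : \bigcup_(i in [set: 'I_3]) (Fmap i @` pre_gasket n) =
    Fmap ord0 @` pre_gasket n `|` (Fmap o1 @` pre_gasket n) `|`
    (Fmap o2 @` pre_gasket n).
  apply/seteqP; split => [p [i _]|p [[]|]].
  - by elim/ord3P: i => h; [left; left|left; right|right].
  - by exists ord0.
  - by exists o1.
  - by exists o2.
have cF i : compact (Fmap i @` pre_gasket n).
  by apply: continuous_compact => //; apply: continuous_subspaceT;
    exact: Fmap_continuous.
by do !apply: compactU.
Qed.

Lemma pre_gasketS n : pre_gasket n.+1 `<=` pre_gasket n.
Proof.
elim: n => [|n ih] p [i _ [p' h <-]] /=.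
  by move=> j; rewrite bary_F; have := h j; case: (i == j) => /=; lra.
by exists i => //; exists p' => //; exact: ih.
Qed.

Lemma pre_gasket_mono m n : (m <= n)%N -> pre_gasket n `<=` pre_gasket m.
Proof.
move=> /subnK <-; elim: (n - m)%N => [//|k ih] p.
by rewrite addSn => /pre_gasketS /ih.
Qed.

Lemma attractor_exists : exists K : set (R * R), is_attractor K.
Proof.
exists (\bigcap_n pre_gasket n); split.
- exists (q ord0) => n _; elim: n => [j|n ih] /=; first by rewrite bary_q.
  by exists ord0 => //; exists (q ord0) => //; exact: Fmap_q.
- apply: (@subclosed_compact _ _ triangle _ triangle_compact); last first.
    by move=> p /(_ 0%N I).
  apply: closed_bigI => n _; apply: compact_closed (@pre_gasket_compact n).
  exact: norm_hausdorff.
apply/seteqP; split => [p h|p [i _ [p' h <-]] [|n] _]; last first.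
- by exists i => //; exists p' => //; exact: h.
- by apply: (@pre_gasketS 0); exists i => //; exists p' => //; exact: (h 0%N).
(* One index has to serve all levels: if each of the three failed at some level, all would fail at
   the largest of these levels, the [pre_gasket n] being decreasing. *)
have [i hi] : exists i, forall n, (Fmap i @` pre_gasket n) p.
  apply: contrapT => /forallNP hn.
  have /choice[N hN] : forall i, exists n, ~ (Fmap i @` pre_gasket n) p.
    by move=> i; apply/existsNP.
  have [i _ [p' h' e]] := h (\max_(i < 3) N i).+1 I.
  apply: (hN i); exists p' => //; apply: pre_gasket_mono h'.
  exact: leq_bigmax.
have [p' h0 e] := hi 0%N; exists i => //; exists p' => // n _.
by have [p2 h2 e2] := hi n; rewrite -(@Fmap_inj i _ _ (etrans e2 (esym e))).
Qed.

Lemma SG_attractor : is_attractor (@SG R).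
Proof. exact: xgetPex attractor_exists. Qed.

Lemma SG_compact : compact (@SG R).
Proof. by case: SG_attractor. Qed.

Lemma SG_closed : closed (@SG R).
Proof. exact: compact_closed (@norm_hausdorff _ _) SG_compact. Qed.

Lemma SG_F i p : SG p -> SG (Fmap i p).
Proof. by have [_ _ {2}->] := SG_attractor; exists i => //; exists p. Qed.

Lemma SG_inv p : SG p -> exists i p', SG p' /\ p = Fmap i p'.
Proof.
by have [_ _ {1}->] := SG_attractor => -[i _ [p' h <-]]; exists i, p'.
Qed.

(** At a point where the coordinate is minimal, written as an image of a point of [SG], it is at
    least half of the minimum; so the minimum is not negative. *)
Lemma SG_bary j p : SG p -> 0 <= bary j p.
Proof.
have [ne _ _] := SG_attractor.
have cb : {within SG, continuous (bary j)}.
  by apply: continuous_subspaceT; exact: bary_continuous.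
have [c /set_mem hc cmin] := compact_EVT_min ne SG_compact cb.
move=> hp; apply: le_trans (cmin _ (mem_set hp)).
have [i [c' [hc' e]]] := SG_inv hc; have := cmin _ (mem_set hc').
by rewrite e bary_F; case: (i == j) => /=; lra.
Qed.

Lemma bary_le1 j p : SG p -> bary j p <= 1.
Proof.
move=> h; have := bary_sum p; have := SG_bary ord0 h; have := SG_bary o1 h.
by have := SG_bary o2 h; elim/ord3P: j; lra.
Qed.

Lemma bary_eq1 j p : SG p -> bary j p = 1 -> p = q j.
Proof.
move=> h; have := bary_sum p; have := SG_bary ord0 h; have := SG_bary o1 h.
have := SG_bary o2 h => h2 h1 h0 hs hj.
by apply: bary_inj; apply: ord3P; rewrite bary_q; elim/ord3P: j hj => /=; lra.
Qed.

(** If M is the maximum of coordinate [i], applying [Fmap i] to a maximizer gives (M + 1) / 2 <= M,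
    so M = 1, a value that only [q i] attains. *)
Lemma SG_q i : SG (q i : R * R).
Proof.
have [ne _ _] := SG_attractor.
have cb : {within SG, continuous (bary i)}.
  by apply: continuous_subspaceT; exact: bary_continuous.
have [c /set_mem hc cmax] := compact_EVT_max ne SG_compact cb.
have := cmax _ (mem_set (SG_F i hc)); rewrite bary_F eqxx /= => h.
by rewrite -(bary_eq1 hc) //; have := bary_le1 i hc; lra.
Qed.

(** Coordinate [i] is at least 1/2 on one image and at most 1/2 on the other, and conversely for
    [i']; equality forces both arguments to be corners. *)
Lemma F_meet i i' p p' : SG p -> SG p' -> i != i' ->
  Fmap i p = Fmap i' p' -> p = q i' /\ p' = q i.
Proof.
move=> h h' ne e; have e1 := congr1 (bary i) e; have e2 := congr1 (bary i') e.
move: e1 e2; rewrite !bary_F !eqxx (negbTE ne) eq_sym (negbTE ne) /= => e1 e2.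
have := bary_le1 i h'; have := SG_bary i h.
have := bary_le1 i' h; have := SG_bary i' h' => *.
by split; apply: bary_eq1 => //; lra.
Qed.

Lemma Fword_cat w v p : Fword (w ++ v) p = Fword w (Fword v p).
Proof. by rewrite /Fword foldr_cat. Qed.

Lemma Fword_rcons w i p : Fword (rcons w i) p = Fword w (Fmap i p).
Proof. by rewrite -cats1 Fword_cat. Qed.

Lemma Fword_inj w : injective (Fword w : R * R -> R * R).
Proof. by elim: w => [//|i w ih] p p' /= /Fmap_inj /ih. Qed.

Lemma SG_Fword w p : SG p -> SG (Fword w p).
Proof. by move=> h; elim: w => [//|i w ih] /=; exact: SG_F. Qed.

Lemma Fword_q w i : Fword (w ++ [:: i]) (q i) = Fword w (q i) :> R * R.
Proof. by rewrite Fword_cat /= Fmap_q. Qed.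

Lemma Fword_nseq w n i : Fword (w ++ nseq n i) (q i) = Fword w (q i) :> R * R.
Proof.
by rewrite Fword_cat; congr Fword; elim: n => [//|n ih] /=; rewrite ih Fmap_q.
Qed.

Lemma Fword_continuous w : continuous (Fword w : R * R -> R * R).
Proof.
elim: w => [|i w ih] p; first exact: cvg_id.
exact: (@continuous_comp _ _ _ (Fword w) (Fmap i) p (ih p) (@Fmap_continuous _ _)).
Qed.

Lemma FwordB w p p' : Fword w p - Fword w p' = (2^-1) ^+ size w *: (p - p').
Proof.
elim: w => [|i w ih] /=; first by rewrite expr0 scale1r.
rewrite exprS -scalerA -ih; apply/eqP; rewrite xpair_eqE /=.
by rewrite /Fmap /= /GRing.scale /=; apply/andP; split; apply/eqP; lra.
Qed.

Lemma cell_SG w : cell w `<=` @SG R.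
Proof. by move=> _ [p h <-]; exact: SG_Fword. Qed.

Lemma cell_q w i : cell w (Fword w (q i) : R * R).
Proof. by exists (q i) => //; exact: SG_q. Qed.

Lemma cell_compact w : compact (cell w : set (R * R)).
Proof.
apply: continuous_compact SG_compact; apply: continuous_subspaceT.
exact: Fword_continuous.
Qed.

Lemma cell_closed w : closed (cell w : set (R * R)).
Proof. exact: compact_closed (@norm_hausdorff _ _) (@cell_compact w). Qed.

Lemma cell_catS w v : cell (w ++ v) `<=` (cell w : set (R * R)).
Proof.
by move=> _ [p h <-]; rewrite Fword_cat; exists (Fword v p) => //; exact: SG_Fword.
Qed.

Lemma cell_take n w : cell w `<=` (cell (take n w) : set (R * R)).
Proof. by rewrite -{1}(cat_take_drop n w); exact: cell_catS. Qed.

Lemma cell_refine w p n : cell w p -> exists v, size v = n /\ cell (w ++ v) p.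
Proof.
move=> [p' h <-]; elim: n w p' h => [|n ih] w p' h.
  by exists [::]; split => //; exists p'; rewrite ?cats0.
have [i [p2 [h2 ->]]] := SG_inv h.
have [v [hv hc]] := ih (rcons w i) _ h2; exists (i :: v); split; first by rewrite /= hv.
by rewrite -cat_rcons -Fword_rcons.
Qed.

Lemma SG_cell p n : SG p -> exists w, size w = n /\ cell w p.
Proof. by move=> h; apply: (@cell_refine [::]); exists p. Qed.

Lemma Fword_eq_q w p j : SG p -> Fword w p = q j -> w = nseq (size w) j /\ p = q j.
Proof.
move=> h; elim: w => [//|i w ih] /= e.
have e1 := congr1 (bary j) e; rewrite bary_F bary_q eqxx in e1.
have := bary_le1 j (SG_Fword w h); move: e1.
case: eqVneq => [eij|_] /= e1 hle; last by exfalso; clear e ih; lra.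
have e2 : bary j (Fword w p) = 1 by clear e ih; lra.
by have [{1}-> ->] := ih (bary_eq1 (SG_Fword w h) e2); rewrite eij.
Qed.

Lemma cell_meet w w' p : size w = size w' -> w != w' -> cell w p -> cell w' p ->
  exists i j, p = Fword w (q i) /\ p = Fword w' (q j).
Proof.
move=> hs ne [p1 h1 e1] [p2 h2 e2]; subst p.
elim: w w' hs ne e2 => [|i w ih] [|i' w'] //= [hs] ne.
have [eii'|nii'] := eqVneq i i'.
  subst i'; have {}ne : w != w' by apply: contraNneq ne => ->.
  by move=> /Fmap_inj /(ih _ hs ne) [k [l [e e']]]; exists k, l; rewrite -e -e'.
rewrite eq_sym in nii' => e.
have [e' e1] := F_meet (SG_Fword w' h2) (SG_Fword w h1) nii' e.
have [_ ep2] := Fword_eq_q h2 e'; have [_ ep1] := Fword_eq_q h1 e1.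
by exists i', i; split; [rewrite -ep1|rewrite -ep2 e].
Qed.

Lemma cell_meet1 w w' p p' : size w = size w' -> w != w' ->
  cell w p -> cell w' p -> cell w p' -> cell w' p' -> p = p'.
Proof.
move=> hs ne [p1 h1 <-] [p2 h2 e2] [p3 h3 <-] [p4 h4 e4].
elim: w w' hs ne e2 e4 => [|i w ih] [|i' w'] //= [hs] ne.
have [eii'|nii'] := eqVneq i i'.
  subst i'; have {}ne : w != w' by apply: contraNneq ne => ->.
  by move=> /Fmap_inj e2 /Fmap_inj e4; rewrite (ih _ hs ne e2 e4).
rewrite eq_sym in nii' => e e'.
have [_ ->] := F_meet (SG_Fword w' h2) (SG_Fword w h1) nii' e.
by have [_ ->] := F_meet (SG_Fword w' h4) (SG_Fword w h3) nii' e'.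
Qed.

Lemma q_inj : injective (q : 'I_3 -> R * R).
Proof.
move=> i j e; have := bary_q j i; rewrite e bary_q eqxx => /eqP.
by rewrite eqr_nat; case: (eqVneq i j).
Qed.

(** Otherwise two distinct corners of the cell [v] would lie in two different cells of size
    [size w], which share at most one point. *)
Lemma cell_sub_prefix w v : (size w <= size v)%N ->
  cell v `<=` (cell w : set (R * R)) -> take (size w) v = w.
Proof.
move=> hs hsub; apply/eqP/negP => /negP ne.
have hst : size (take (size w) v) = size w by rewrite size_takel.
have e := cell_meet1 hst ne (@cell_take _ _ _ (cell_q v ord0)) (hsub _ (cell_q v ord0))
  (@cell_take _ _ _ (cell_q v o1)) (hsub _ (cell_q v o1)).
by have /q_inj := Fword_inj e.
Qed.

Lemma cell_norm w p p' : cell w p -> cell w p' -> `|p - p'| <= 4 * (2^-1) ^+ size w.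
Proof.
move=> [p1 h1 <-] [p2 h2 <-]; rewrite FwordB normrZ normrX ger0_norm; last by lra.
rewrite [X in X <= _]mulrC; apply: ler_wpM2r; first by apply: exprn_ge0; lra.
have s3 : 1 <= Num.sqrt 3 :> R by rewrite -{1}(@sqrtr1 R) ler_sqrt; lra.
have bnd (a : R * R) : SG a -> `|a.1| <= 1 /\ `|a.2| <= 1.
  move=> h; have := SG_bary ord0 h; have := SG_bary o1 h; have := SG_bary o2 h.
  rewrite /bary /= => *; split; last by rewrite ler_norml; lra.
  have : Num.sqrt 3 * `|a.1| <= 1.
    rewrite -[X in X * _]ger0_norm -?normrM ?ler_norml; lra.
  by have := normr_ge0 a.1; nra.
have [a1 a2] := bnd _ h1; have [a3 a4] := bnd _ h2.
rewrite prod_normE /= ge_max; apply/andP; split;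
  by apply: le_trans (ler_normB _ _) _; lra.
Qed.

Lemma half_pow_lt (e : R) : 0 < e -> exists N, forall n, (N <= n)%N ->
  4 * (2^-1) ^+ n < e.
Proof.
move=> e0; have : (fun n => 4 * (2^-1 : R) ^+ n) @ \oo --> (4 * 0 : R).
  by apply: cvgM; [exact: cvg_cst|apply: cvg_expr; rewrite ger0_norm; lra].
rewrite mulr0 => /cvgrPdist_lt /(_ e e0) [N _ hN]; exists N => n /hN /=.
by rewrite sub0r normrN; apply: le_lt_trans; exact: ler_norm.
Qed.

End GasketGeometry.

(** * Functions on the gasket defined by subdivision *)

Section ContinuityWithin.
Context {R : realType}.
Implicit Types (A : set (R * R)) (f : R * R -> R) (p : R * R).

Lemma within_eps A f p (e : R) : {within A, continuous f} -> A p -> 0 < e ->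
  exists2 d, 0 < d & forall p', A p' -> `|p - p'| < d -> `|f p - f p'| < e.
Proof.
move=> /subspace_continuousP h Ap e0.
have /cvgrPdist_lt /(_ e e0) := h p Ap.
rewrite near_withinE => /nbhs_normP [d d0 hd].
by exists d => // p' Ap' hp; apply: hd.
Qed.

Lemma eps_within A f :
  (forall p, A p -> forall e : R, 0 < e -> exists2 d, 0 < d &
    forall p', A p' -> `|p - p'| < d -> `|f p - f p'| < e) ->
  {within A, continuous f}.
Proof.
move=> h; apply/subspace_continuousP => p Ap; apply/cvgrPdist_lt => e e0.
have [d d0 hd] := h p Ap e e0; rewrite near_withinE.
apply: (@filterS _ (nbhs p) _ (ball p d)); last exact: nbhsx_ballx.
by move=> p'; rewrite -ball_normE /= => hp Ap'; apply: hd.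
Qed.

Lemma within_unif A f (e : R) : compact A -> {within A, continuous f} -> 0 < e ->
  exists2 d, 0 < d &
    forall p p', A p -> A p' -> `|p - p'| < d -> `|f p - f p'| < e.
Proof.
move=> /compact_near_coveringP cA cf e0.
pose P d p := forall p', A p -> A p' -> `|p - p'| < d -> `|f p - f p'| < e.
have [p Ap|d /= d0 hd] := cA R (0 : R)^'+ P _; last first.
  exists (d / 2) => [|p p' Ap Ap' hpp]; first by apply: divr_gt0.
  apply: (hd (d / 2)) => //=; first by rewrite sub0r normrN gtr0_norm; lra.
  by lra.
have [d d0 hd] := within_eps cf Ap (ltac:(lra) : 0 < e / 2).
have d2 : 0 < d / 2 by lra.
exists (ball p (d / 2), [set r | r < d / 2]) => /=.
  split; first exact: nbhsx_ballx.
  exact: nbhs_right_lt.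
move=> [p1 r] /= [hp1 hr] p' Ap1 Ap' hp'.
rewrite -ball_normE /= in hp1.
rewrite -(subrKA (f p)); apply: le_lt_trans (ler_normD _ _) _.
have dp : d / 2 < d by lra.
have b1 := hd _ Ap1 (lt_trans hp1 dp).
have : `|f p - f p'| < e / 2.
  apply: hd => //; rewrite -(subrKA p1).
  by apply: le_lt_trans (ler_normD _ _) _; lra.
by move=> b2; rewrite distrC; lra.
Qed.

(** Compactness makes the vanishing on the zero set of [g] uniform nearby; [g] will be the height
    above the line. *)
Lemma near_zero_set A (B : set (R * R)) f (e : R) (g : R * R -> R) :
  compact A -> {within A, continuous f} -> continuous g ->
  (forall p, A p -> 0 <= g p) ->
  (forall p, A p -> g p = 0 -> B p) -> (forall p, B p -> f p = 0) -> 0 < e ->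
  exists2 d, 0 < d & forall p, A p -> g p < d -> `|f p| < e.
Proof.
move=> /compact_near_coveringP cA cf cg g0 gB fB e0.
pose P d p := A p -> g p < d -> `|f p| < e.
have [p Ap|d /= d0 hd] := cA R (0 : R)^'+ P _; last first.
  exists (d / 2) => [|p Ap hp]; first by apply: divr_gt0.
  by apply: (hd (d / 2)) => //=; rewrite ?sub0r ?normrN ?gtr0_norm; lra.
have [gp0|gp0] := eqVneq (g p) 0.
  have [d d0 hd] := within_eps cf Ap e0.
  exists (ball p d, setT) => /=; first by split; [exact: nbhsx_ballx|exact: filterT].
  move=> [p1 r] /= [hp1 _] Ap1 _; rewrite -ball_normE /= in hp1.
  by have := hd _ Ap1 hp1; rewrite (fB _ (gB _ Ap gp0)) sub0r normrN.
have {}gp0 : 0 < g p / 2 by rewrite divr_gt0 // lt_def gp0 g0.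
exists ([set p' | g p / 2 < g p'], [set r | r < g p / 2]) => /=.
  split; last first.
    exact: nbhs_right_lt.
  have /cvgrPdist_lt /(_ _ gp0) := cg p; apply: filterS => p' /=.
  by rewrite ltr_norml => /andP[_]; lra.
by move=> [p1 r] /= [hp1 hr] Ap1 hg; exfalso; lra.
Qed.

(** The corners of the subcells are dense in the cell. With [lo = hi = 0] this reduces vanishing on
    a cell to vanishing at vertices. *)
Lemma cell_hull A f w lo hi p : {within A, continuous f} -> cell w `<=` A ->
  (forall v i, lo <= f (Fword (w ++ v) (q i)) <= hi) -> cell w p ->
  lo <= f p <= hi.
Proof.
move=> cf wA h wp.
have key e : 0 < e -> lo - e <= f p <= hi + e.
  move=> e0; have [d d0 hd] := within_eps cf (wA _ wp) e0.
  have [N hN] := half_pow_lt d0.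
  have [v [sv hv]] := cell_refine N wp.
  have /andP[h1 h2] := h v ord0.
  have hvv : cell w (Fword (w ++ v) (q ord0) : R * R).
    by apply: cell_catS; exact: cell_q.
  have /hd : A (Fword (w ++ v) (q ord0) : R * R) by exact: wA.
  have /[swap] /[apply] : `|p - Fword (w ++ v) (q ord0)| < d.
    apply: le_lt_trans (cell_norm hv (cell_q _ _)) (hN _ _).
    by rewrite size_cat sv leq_addl.
  by rewrite ltr_norml => /andP[]; lra.
apply/andP; split; apply/ler_addgt0Pr => e /key /andP[]; lra.
Qed.

End ContinuityWithin.

Lemma cvgn_of_close {R : realType} (s d : nat -> R) :
  d @ \oo --> 0 -> (forall N n, (N <= n)%N -> `|s n - s N| <= d N) ->
  cvgn s /\ forall N, `|limn s - s N| <= d N.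
Proof.
move=> d0 h; have cs : cvgn s.
  apply/cauchy_cvgP/cauchy_exP => e e0.
  move/cvgrPdist_lt: d0 => /(_ e e0) [N _ hN]; exists (s N); exists N => // n /= Nn.
  rewrite -ball_normE /= distrC; apply: le_lt_trans (h _ _ Nn) _.
  by have := hN N (leqnn N); rewrite /= sub0r normrN; apply: le_lt_trans; exact: ler_norm.
split => // N; rewrite ler_distl; apply/andP; split.
  apply: limr_ge => //; exists N => // n /= /(h N); rewrite ler_distl => /andP[]; lra.
apply: limr_le => //; exists N => // n /= /(h N); rewrite ler_distl => /andP[]; lra.
Qed.

Section Subdivision.
Context {R : realType}.
Implicit Types (M : seq 'I_3 -> ('I_3 -> R) -> 'I_3 -> R) (a : 'I_3 -> R).
Implicit Types (w v : seq 'I_3) (i j : 'I_3).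

(* [m k] is the value at the midpoint of the side opposite to the vertex [k]. *)
Definition child (m a : 'I_3 -> R) i j := if j == i then a i else m (opp i j).

(* The values at the vertices of the cells of a function given by [a] on the
   outer triangle, where [M w] computes the values at the midpoints of the
   cell [w] from those at its vertices. *)
Fixpoint sval M a w : 'I_3 -> R :=
  if w is i :: w' then sval (fun v => M (i :: v)) (child (M [::] a) a i) w'
  else a.

Lemma sval_cat M a w v :
  sval M a (w ++ v) = sval (fun u => M (w ++ u)) (sval M a w) v.
Proof. by elim: w M a => [|i w ih] M a //=; rewrite ih. Qed.

Lemma sval_rcons M a w i :
  sval M a (rcons w i) = child (M w (sval M a w)) (sval M a w) i.
Proof. by rewrite -cats1 sval_cat /= cats0. Qed.

Lemma sval_corner M a w i j : Fword w (q i) = q j :> R * R -> sval M a w i = a j.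
Proof.
move=> /(Fword_eq_q (SG_q i)) [-> /q_inj ->].
by elim: (size w) M a => [//|n ih] M a /=; rewrite ih /child eqxx.
Qed.

(** Well-definedness of subdivision: a corner shared by several cells gets one value. Two sibling
    cells share only a midpoint, which both index by the symmetric [opp]. *)
Lemma sval_vertex M a w w' i j : size w = size w' ->
  Fword w (q i) = Fword w' (q j) :> R * R -> sval M a w i = sval M a w' j.
Proof.
elim: w w' M a => [|k w ih] [|k' w'] M a //=; first by move=> _ /q_inj ->.
move=> [hs]; have [<-|nk] := eqVneq k k'; first by move=> /Fmap_inj /ih ->.
move=> /(F_meet (SG_Fword _ (SG_q _)) (SG_Fword _ (SG_q _)) nk) [e e'].
rewrite (sval_corner _ _ e) (sval_corner _ _ e') /child.
by rewrite (negbTE nk) eq_sym (negbTE nk) oppC.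
Qed.

Definition addr (p : R * R) n : seq 'I_3 :=
  xget [::] [set w | size w = n /\ cell w p].

Lemma addrP p n : SG p -> size (addr p n) = n /\ cell (addr p n) p.
Proof.
by move=> /(SG_cell n) h; apply: (@xgetPex _ [::] [set w | size w = n /\ cell w p]).
Qed.

Definition subdiv_fun M a (p : R * R) : R :=
  limn (fun n => sval M a (addr p n) ord0).

Section Convergent.
Variables (M : seq 'I_3 -> ('I_3 -> R) -> 'I_3 -> R) (a : 'I_3 -> R).
Variable dlt : nat -> R.
Hypothesis dlt0 : dlt @ \oo --> 0.
Hypothesis osc :
  forall w v i j, `|sval M a (w ++ v) i - sval M a w j| <= dlt (size w).

(** The factor 2 pays for the case where [w] is not a prefix of [w2]: the cells at the level of [w]
    then share a corner, and the estimate passes through it. *)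
Lemma sval_close w w2 (p : R * R) i j : (size w <= size w2)%N -> cell w p -> cell w2 p ->
  `|sval M a w2 i - sval M a w j| <= 2 * dlt (size w).
Proof.
move=> hs hw hw2; have d0 := le_trans (normr_ge0 _) (osc w [::] j j).
have hst : size (take (size w) w2) = size w by rewrite size_takel.
rewrite -(cat_take_drop (size w) w2).
have [->|ne] := eqVneq (take (size w) w2) w.
  by apply: le_trans (osc _ _ _ _) _; lra.
have [i' [j' [e1 e2]]] := cell_meet hst ne (@cell_take _ _ _ _ hw2) hw.
have e : sval M a (take (size w) w2) i' = sval M a w j'.
  by apply: sval_vertex => //; rewrite -e1 -e2.
rewrite -(subrKA (sval M a w j')); apply: le_trans (ler_normD _ _) _.
rewrite -{1}e mulr2n mulrDl mul1r; apply: lerD.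
  by have := osc (take (size w) w2) (drop (size w) w2) i i'; rewrite hst.
by have := osc w [::] j' j; rewrite cats0.
Qed.

Lemma cvg_2dlt : (fun n => 2 * dlt n) @ \oo --> (0 : R).
Proof. by rewrite -[X in _ --> X](mulr0 2); apply: cvgM => //; exact: cvg_cst. Qed.

Lemma subdiv_fun_close w (p : R * R) j : cell w p ->
  `|subdiv_fun M a p - sval M a w j| <= 2 * dlt (size w).
Proof.
move=> hw; have hp := cell_SG hw.
have [|cs _] := @cvgn_of_close R (fun n => sval M a (addr p n) ord0) _ cvg_2dlt.
  move=> N n Nn; have [h1 h2] := addrP n hp; have [h3 h4] := addrP N hp.
  rewrite -[X in dlt X]h3; apply: (sval_close _ _ _ h4 h2).
  by rewrite h1 h3.
have h n : (size w <= n)%N ->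
    `|sval M a (addr p n) ord0 - sval M a w j| <= 2 * dlt (size w).
  move=> wn; have [h1 h2] := addrP n hp.
  by apply: (sval_close _ _ _ hw h2); rewrite h1.
rewrite ler_distl; apply/andP; split.
  apply: limr_ge => //; exists (size w) => // n /= /h.
  by rewrite ler_distl => /andP[]; lra.
apply: limr_le => //; exists (size w) => // n /= /h.
by rewrite ler_distl => /andP[]; lra.
Qed.

Lemma subdiv_fun_vertex w j : subdiv_fun M a (Fword w (q j)) = sval M a w j.
Proof.
apply/eqP; rewrite -subr_eq0 -normr_le0; apply/ler_addgt0Pr => e e0; rewrite add0r.
move/cvgrPdist_le: cvg_2dlt => /(_ e e0) [N _ hN].
(* The point is also the corner [j] of these arbitrarily small cells, on which the closeness bound
   tends to 0. *)
have wN : cell (w ++ nseq N j) (Fword w (q j) : R * R).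
  by rewrite -(Fword_nseq w N j); exact: cell_q.
have := subdiv_fun_close j wN.
rewrite sval_cat (@sval_corner _ _ (nseq N j) j j) ?(Fword_nseq [::]) //.
move=> /le_trans; apply; have := hN (size (w ++ nseq N j)).
rewrite /= sub0r normrN size_cat size_nseq leq_addl => /(_ isT).
by apply: le_trans; exact: ler_norm.
Qed.

Lemma subdiv_fun_continuous : {within SG, continuous (subdiv_fun M a)}.
Proof.
apply: eps_within => p hp e e0.
have e4 : 0 < e / 4 by lra.
move/cvgrPdist_lt: cvg_2dlt => /(_ _ e4) [N _ /(_ N (leqnn N))].
rewrite /= sub0r normrN => /(le_lt_trans (ler_norm _)) hN.
(* The cells of size [N] are finitely many and closed, so near [p] one meets only those that contain
   [p]. *)
have : forall w : N.-tuple 'I_3, \forall p' \near p, cell w p' -> cell w p.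
  move=> w; have [hw|hw] := pselect (cell w p); first by near=> x.
  have : nbhs p (~` cell w).
    by apply: open_nbhs_nbhs; split => //; rewrite openC; exact: cell_closed.
  by apply: filterS => p' ? ?.
move=> /filter_forall /nbhs_normP [d d0 hd]; exists d => // p' hp' hpp.
have [w [sw wp']] := SG_cell N hp'.
have wp : cell w p.
  exact: (hd p' hpp (Tuple (introT eqP sw)) wp').
have := subdiv_fun_close ord0 wp; have := subdiv_fun_close ord0 wp'.
by rewrite sw !ler_distl ltr_norml => /andP[h1 h2] /andP[h3 h4]; apply/andP; lra.
Unshelve. all: by end_near. Qed.

End Convergent.
End Subdivision.

(** * Binary digits and the function m_0 *)

Section BinaryExponents.
Context {R : realType}.
Implicit Types (x r : R) (n : nat -> nat) (k l m : nat).

Local Notation h2 k := ((2 ^+ k)^-1 : R).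

Let h2_gt0 k : 0 < h2 k. Proof. by rewrite invr_gt0 exprn_gt0. Qed.

Let h2S k : h2 k = h2 k.+1 + h2 k.+1.
Proof. by rewrite exprS invfM -mulrDl; rewrite (_ : 2^-1 + 2^-1 = 1) ?mul1r //; lra. Qed.

Let h2_lt k l : (h2 k < h2 l) = (l < k)%N.
Proof. by rewrite ltf_pV2 ?posrE ?exprn_gt0 // ltr_eXn2l //; lra. Qed.

Let h2_le k l : (h2 k <= h2 l) = (l <= k)%N.
Proof. by rewrite lef_pV2 ?posrE ?exprn_gt0 // ler_eXn2l //; lra. Qed.

Let h2_le1 k : h2 k <= 1.
Proof. by rewrite invf_le1 ?exprn_gt0 // exprn_ege1 //; lra. Qed.

(** The interval is closed above and open below, so that the greedy choice of exponents always
    leaves a positive remainder and yields the infinite expansion. *)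
Lemma half_floor_exists r : 0 < r -> r <= 1 ->
  exists k, h2 k.+1 < r /\ r <= h2 k.
Proof.
move=> r0 r1; have [N hN] := half_pow_lt r0.
have ex : exists k, h2 k < r.
  by exists N; have := hN N (leqnn N); rewrite exprVn; have := h2_gt0 N; lra.
case: (ex_minnP ex) => -[|k]; first by rewrite expr0 invr1 ltNge r1.
move=> hk hmin; exists k; split => //; rewrite leNgt; apply/negP => /hmin.
by rewrite ltnn.
Qed.

Lemma half_floor_uniq r k l : h2 k.+1 < r -> r <= h2 k ->
  h2 l.+1 < r -> r <= h2 l -> k = l.
Proof.
move=> h1 h3 h4 h5; apply/eqP; rewrite eqn_leq -ltnS -[(l <= k)%N]ltnS -!h2_lt.
by rewrite (lt_le_trans h1 h5) (lt_le_trans h4 h3).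
Qed.

Let nx r : nat := xget 0%N [set k | h2 k.+1 < r /\ r <= h2 k].

Let nxP r : 0 < r -> r <= 1 -> h2 (nx r).+1 < r /\ r <= h2 (nx r).
Proof.
move=> r0 r1; exact: (@xgetPex _ 0%N [set k | h2 k.+1 < r /\ r <= h2 k]
  (half_floor_exists r0 r1)).
Qed.

Lemma binary_exponents_exist x : 0 < x -> x <= 1 ->
  exists n, is_binary_exponents x n.
Proof.
move=> x0 x1; pose rr := fix rr l := if l is l'.+1 then rr l' - h2 (nx (rr l')).+1 else x.
pose n l := if l is l'.+1 then (nx (rr l')).+1 else 0%N.
have rrP l : 0 < rr l /\ rr l <= h2 (n l).
  elim: l => [|l [ih0 ih1]] /=; first by rewrite expr0 invr1.
  have l1 : rr l <= 1 by apply: (le_trans ih1).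
  by have [h1] := nxP ih0 l1; rewrite subr_gt0 lerBlDr -h2S.
have rr1 l : rr l <= 1.
  by have [_ h] := rrP l; apply: (le_trans h).
exists n; split => // [k|].
  by rewrite -h2_lt; have [h0 h1] := rrP k; have [h _] := nxP h0 (rr1 k);
    apply: lt_le_trans h h1.
have nk k : (k <= n k)%N.
  elim: k => // k ih; apply: (leq_ltn_trans ih); rewrite -h2_lt.
  by have [h0 h1] := rrP k; have [h _] := nxP h0 (rr1 k); apply: lt_le_trans h h1.
have e k : series (fun k => h2 (n k.+1)) k = x - rr k.
  elim: k => [|k ih]; first by rewrite /series /= big_geq // subrr.
  by rewrite /series /= in ih *; rewrite big_nat_recr //= ih opprB addrA addrAC.
apply/cvgrPdist_lt => d d0; have [N hN] := half_pow_lt d0.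
exists N => // k /= /hN; rewrite e opprB addrCA subrr addr0.
have [h0 h1] := rrP k; rewrite gtr0_norm // exprVn => h.
apply: (le_lt_trans h1); apply: le_lt_trans h.
apply: (@le_trans _ _ (h2 k)); first by rewrite h2_le.
by rewrite ler_peMl ?ltW // ltr1n.
Qed.

Lemma nexpP x : 0 < x -> x <= 1 -> is_binary_exponents x (nexp x).
Proof. move=> x0 x1; exact: xgetPex (binary_exponents_exist x0 x1). Qed.

Definition tail_of x n l : R := x - \sum_(0 <= k < l) h2 (n k.+1).

Lemma tail_of0 x n : tail_of x n 0 = x.
Proof. by rewrite /tail_of big_geq // subr0. Qed.

Lemma tail_ofS x n l : tail_of x n l.+1 = tail_of x n l - h2 (n l.+1).
Proof. by rewrite /tail_of big_nat_recr //=; lra. Qed.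

Lemma tail_of_bounds x n l : is_binary_exponents x n ->
  0 < tail_of x n l /\ tail_of x n l <= h2 (n l).
Proof.
move=> [n0 nS cx].
have inc : nondecreasing_seq (series (fun k => h2 (n k.+1))).
  by apply/nondecreasing_seqP => k; rewrite /series /= big_nat_recr //= lerDl ltW.
have ge k : series (fun k => h2 (n k.+1)) k <= x.
  rewrite -(cvg_lim _ cx) //; apply: nondecreasing_cvgn_le => //.
  by apply/cvg_ex; exists x.
rewrite /tail_of subr_gt0 lerBlDl; split.
  by apply: lt_le_trans (ge l.+1); rewrite /series /= big_nat_recr //= ltrDl.
have key d : series (fun k => h2 (n k.+1)) (d + l) <=
    series (fun k => h2 (n k.+1)) l + h2 (n l) - h2 (n (d + l)%N).
  elim: d => [|d ih]; first by rewrite add0n; lra.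
  rewrite addSn /series /= big_nat_recr //= -/(series _ (d + l)%N).
  have : h2 (n (d + l).+1) + h2 (n (d + l).+1) <= h2 (n (d + l)%N).
    by rewrite (h2S (n (d + l)%N)) lerD // h2_le nS.
  by rewrite /series /= in ih *; lra.
have cx' : limn (series (fun k => h2 (n k.+1))) = x by exact: cvg_lim.
rewrite -cx'; apply: limr_le; first by apply/cvg_ex; exists x.
exists l => // k /= /subnK <-; apply: (le_trans (key _)).
by have := h2_gt0 (n (k - l + l)%N); rewrite /series /=; lra.
Qed.

(** The exponent [n l.+1] is thereby read off from the remainder alone, which gives uniqueness of
    the expansion by induction. *)
Lemma binary_exponents_floor x n l : is_binary_exponents x n ->
  h2 (n l.+1) < tail_of x n l /\ tail_of x n l <= h2 (n l.+1).-1.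
Proof.
move=> hn; have [h1 h3] := tail_of_bounds l.+1 hn.
have [_ nS _] := hn; have : (0 < n l.+1)%N by apply: leq_ltn_trans (nS l).
case e : (n l.+1) h1 h3 => [//|k] h1 h3 _; rewrite tail_ofS in h1 h3.
by rewrite e in h1 h3 *; split; rewrite /= ?(h2S k); lra.
Qed.

Lemma binary_exponents_uniq x n n' :
  is_binary_exponents x n -> is_binary_exponents x n' -> n = n'.
Proof.
move=> hn hn'; suff h l : n l = n' l /\ tail_of x n l = tail_of x n' l.
  by apply/funext => l; have [] := h l.
elim: l => [|l [ih1 ih2]].
  have [-> _ _] := hn; have [-> _ _] := hn'; split => //.
  by rewrite /tail_of !big_geq.
suff e : n l.+1 = n' l.+1 by split => //; rewrite !tail_ofS ih2 e.
have [h1 h3] := binary_exponents_floor l hn.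
have [h4 h5] := binary_exponents_floor l hn'.
have [_ nS _] := hn; have p1 : (0 < n l.+1)%N by apply: leq_ltn_trans (nS l).
have [_ nS' _] := hn'; have p2 : (0 < n' l.+1)%N by apply: leq_ltn_trans (nS' l).
rewrite -(prednK p1) -(prednK p2); congr S.
by rewrite ih2 in h1 h3; apply: (@half_floor_uniq (tail_of x n' l));
  rewrite ?prednK.
Qed.

Lemma binary_exponents_shift x n m : is_binary_exponents x n ->
  is_binary_exponents (2 ^+ n m * tail_of x n m) (fun k => (n (k + m) - n m)%N).
Proof.
move=> [n0 nS cx]; have nmono k : (n m <= n (k + m))%N.
  by elim: k => // k ih; apply: leq_trans ih (ltnW (nS _)).
split => [|k|]; first by rewrite subnn.
  by rewrite addSn ltn_sub2r // (leq_ltn_trans (nmono k)).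
have -> : series (fun k => h2 (n (k.+1 + m) - n m)%N) =
    fun k => 2 ^+ n m * (series (fun k => h2 (n k.+1)) (k + m)%N -
      \sum_(0 <= k < m) h2 (n k.+1)).
  apply/funext; elim=> [|k ih].
    by rewrite /series /= add0n big_geq // subrr mulr0.
  rewrite /series /= in ih *; rewrite big_nat_recr //= ih addSn.
  rewrite [in RHS]big_nat_recr //= [in RHS]addrAC [in RHS]mulrDr; congr (_ + _).
  have e := nmono k.+1; rewrite addSn in e.
  by rewrite -[in RHS](subnK e) exprD invfM mulrCA divff ?mulr1 // expf_neq0.
apply: cvgM; first exact: cvg_cst.
apply: cvgB; last exact: cvg_cst.
by rewrite (cvg_shiftn m (series _)).
Qed.

End BinaryExponents.

(** * Digits of [x], values of [m0] along the remainders, and conductances *)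

Section Digits.
Context {R : realType}.
Variable x : R.
Hypotheses (x_gt0 : 0 < x) (x_lt1 : x < 1) (x_nd : ~ dyadic x).
Implicit Types (k l m n : nat).

Local Notation h2 k := ((2 ^+ k)^-1 : R).
Local Notation nx := (nexp x).
Local Notation r l := (tail_of x (nexp x) l).

Lemma nexp_x : is_binary_exponents x nx.
Proof. by apply: nexpP => //; exact: ltW. Qed.

Lemma nexp0 : nx 0 = 0%N. Proof. by case: nexp_x. Qed.

Lemma nexpS k : (nx k < nx k.+1)%N. Proof. by case: nexp_x. Qed.

Lemma nexp_lt k l : (nx k < nx l)%N = (k < l)%N.
Proof. by apply: leqW_mono; apply: leq_mono; apply: (homo_ltn ltn_trans) => // *; exact: nexpS. Qed.

Lemma nexp_le k l : (nx k <= nx l)%N = (k <= l)%N.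
Proof. by rewrite leqNgt nexp_lt -leqNgt. Qed.

(** [strip] recomputes the leading exponent of the current remainder; that exponent is determined by
    the size of the remainder, so it is the next exponent of [x]. *)
Lemma iter_strip m : iter m strip x = r m.
Proof.
elim: m => [|m ih]; first by rewrite /tail_of big_geq // subr0.
rewrite iterS ih tail_ofS /strip; congr (_ - (2 ^+ _)^-1).
have [r0 r1] := tail_of_bounds m nexp_x.
have r1' : r m <= 1.
  apply: (le_trans r1); rewrite invf_le1 ?exprn_gt0 // exprn_ege1 //; lra.
have hr := nexpP r0 r1'.
have [h1 h3] := binary_exponents_floor m nexp_x.
have [h4 h5] := binary_exponents_floor 0 hr.
rewrite tail_of0 in h4 h5.
have p1 : (0 < nx m.+1)%N by apply: leq_ltn_trans (nexpS m).
have p2 : (0 < nexp (r m) 1)%N by have [_ nS _] := hr; apply: leq_ltn_trans (nS 0%N).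
rewrite -(prednK p1) -(prednK p2); congr S.
by apply: (@half_floor_uniq _ (r m)); rewrite ?prednK.
Qed.

Lemma nexp_y m : nexp (y x m) = (fun k => (nx (k + m) - nx m)%N).
Proof.
rewrite /y iter_strip; have hs := binary_exponents_shift m nexp_x.
apply: binary_exponents_uniq hs; apply: nexpP.
  by have [h _] := tail_of_bounds m nexp_x; rewrite mulr_gt0 // exprn_gt0.
have [_ h] := tail_of_bounds m nexp_x.
by rewrite mulrC -ler_pdivlMr ?exprn_gt0 // div1r.
Qed.

Lemma m0_tail_shift m d j :
  m0_tail (fun k => (nx (k + m) - nx m)%N) d j = m0_tail nx d (j + m) :> R.
Proof.
elim: d j => [//|d ih] j /=; rewrite ih addSn; congr (_ + _ * _ ^+ _ * _)^-1.
have := nexp_le m (j + m); rewrite leq_addl => h; have := nexpS (j + m); lia.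
Qed.

Lemma conductance_ge j : 10 / 3 <= 2 * (5 / 3) ^+ (nx j.+1 - nx j)%N :> R.
Proof.
have -> : (nx j.+1 - nx j)%N = (nx j.+1 - nx j).-1.+1 by have := nexpS j; lia.
have : 1 <= (5 / 3) ^+ (nx j.+1 - nx j).-1 :> R by apply: exprn_ege1; lra.
by rewrite exprS; move: (_ ^+ _) => E; lra.
Qed.

(** The bound 3/10 is a fixed point of [t -> 1 / (1 + 10/3 (1 - t))], the recursion for the smallest
    exponent gap 1; larger gaps only decrease the value. *)
Lemma m0_tail_bounds d j : 0 <= m0_tail nx d j :> R /\ m0_tail nx d j <= 3 / 10 :> R.
Proof.
elim: d j => [|d ih] j /=; first by split; lra.
have [h1 h3] := ih j.+1; have c := conductance_ge j.
move: c h1 h3; move: (2 * _) (m0_tail _ _ _) => C t c h1 h3.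
have h : 10 / 3 <= 1 + C * (1 - t) by nra.
split; first by rewrite invr_ge0; lra.
by rewrite (_ : 3 / 10 = (10 / 3)^-1) ?lef_pV2 ?posrE //; lra.
Qed.

(** Each step of the recursion is increasing in its argument, and it is started from 0, the least
    possible value. *)
Lemma m0_tail_nondecreasing j : nondecreasing_seq (fun d => m0_tail nx d j : R).
Proof.
apply/nondecreasing_seqP => d; elim: d j => [|d ih] j.
  by have [] := m0_tail_bounds 1 j.
have [h1 h3] := m0_tail_bounds d j.+1; have [h4 h5] := m0_tail_bounds d.+1 j.+1.
have := ih j.+1; have c := conductance_ge j.
rewrite [m0_tail _ d.+2 j]/= -/(m0_tail nx d.+1 j.+1) [m0_tail _ d.+1 j]/=.
set C := 2 * _ in c *; set t := m0_tail nx d j.+1 in h1 h3 *.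
rewrite -/(m0_tail nx d.+1 j.+1); set t' := m0_tail nx d.+1 _ in h4 h5 *.
by move=> tt; rewrite lef_pV2 ?posrE; nra.
Qed.

Lemma m0_tail_cvg j : cvgn (fun d => m0_tail nx d j : R).
Proof.
apply: nondecreasing_is_cvgn; first exact: m0_tail_nondecreasing.
by exists (3 / 10) => _ [d _ <-]; have [] := m0_tail_bounds d j.
Qed.

Lemma m0_yE m : m0 (y x m) = limn (fun d => m0_tail nx d m.+1 : R).
Proof.
rewrite /m0 /m0_trunc nexp_y; apply: cvg_lim => //.
rewrite (_ : (fun _ => _) = fun d => m0_tail nx d.-1 m.+1 : R); last first.
  by apply/funext => d; rewrite m0_tail_shift add1n.
rewrite -(cvg_shiftS (fun d => m0_tail nx d.-1 m.+1 : R)) /=.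
exact: m0_tail_cvg.
Qed.

Lemma m0_y_bounds m : 0 <= m0 (y x m) /\ m0 (y x m) <= 3 / 10.
Proof.
rewrite m0_yE; split.
  apply: limr_ge; first exact: m0_tail_cvg.
  by exists 0%N => // d _; have [] := m0_tail_bounds d m.+1.
apply: limr_le; first exact: m0_tail_cvg.
by exists 0%N => // d _; have [] := m0_tail_bounds d m.+1.
Qed.

Lemma m0_y_rec m : m0 (y x m) =
  (1 + 2 * (5 / 3) ^+ (nx m.+2 - nx m.+1)%N * (1 - m0 (y x m.+1)))^-1.
Proof.
rewrite [LHS]m0_yE; apply: cvg_lim => //.
rewrite -(cvg_shiftS (fun d => m0_tail nx d m.+1 : R)) /=.
have c := conductance_ge m.+1; have [h0 h1] := m0_y_bounds m.+1.
apply: cvgV; first by apply: lt0r_neq0; nra.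
apply: cvgD; first exact: cvg_cst.
apply: cvgM; first exact: cvg_cst.
apply: cvgB; first exact: cvg_cst.
by rewrite m0_yE; exact: m0_tail_cvg.
Qed.

(* [lev n] is the number of indices [l >= 1] with [nexp x l <= n], and
   [digit n] is the binary digit of [x] of weight [2 ^- n.+1]. *)
Fixpoint lev n : nat :=
  if n is n'.+1 then lev n' + (n'.+1 == nx (lev n').+1) else 0%N.

Definition digit n : bool := n.+1 == nx (lev n).+1.

(** The integer part of [2 ^+ n * x], built from its binary digits. *)
Fixpoint flo n : nat := if n is n'.+1 then ((flo n').*2 + digit n')%N else 0%N.

Definition rho n : R := m0 (y x (lev n)).

(* The conductance between the top vertex of an n-cell crossed by the line
   and the line, within the part of that cell above the line. *)
Definition gam n : R := 2 * (5 / 3) ^+ nx (lev n).+1 * (1 - rho n).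

Lemma levS n : lev n.+1 = (lev n + digit n)%N. Proof. by []. Qed.

Lemma lev_bounds n : (nx (lev n) <= n < nx (lev n).+1)%N.
Proof.
elim: n => [|n ih]; first by rewrite /= nexp0 /= -[X in (X < _)%N]nexp0 nexpS.
rewrite levS /digit; case: eqP => [e|ne] /=.
  by rewrite addn1 -e leqnn /= e nexpS.
by rewrite addn0; move/andP: ih => [h1 h3]; apply/andP; lia.
Qed.

Lemma lev_uniq n l : (nx l <= n < nx l.+1)%N -> lev n = l.
Proof.
move=> /andP[h1 h3]; have /andP[h4 h5] := lev_bounds n.
have := leq_ltn_trans h1 h5; have := leq_ltn_trans h4 h3.
rewrite !nexp_lt; lia.
Qed.

Lemma lev_nexp l : lev (nx l) = l.
Proof. by apply: lev_uniq; rewrite leqnn nexpS. Qed.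

Lemma digit_nexp l : digit (nx l.+1).-1.
Proof.
have h := nexpS l; have p : (0 < nx l.+1)%N by lia.
rewrite /digit prednK // (@lev_uniq _ l) ?eqxx //; apply/andP; lia.
Qed.

Lemma lev_leq m n : (m <= n)%N -> (lev m <= lev n)%N.
Proof.
move=> /subnK <-; elim: (n - m)%N => // d ih.
by rewrite addSn levS; apply: leq_trans ih (leq_addr _ _).
Qed.

Lemma flo_eq n : 2 ^+ n * x = (flo n)%:R + 2 ^+ n * r (lev n).
Proof.
elim: n => [|n ih]; first by rewrite !expr0 !mul1r /tail_of big_geq //= add0r subr0.
rewrite exprS -mulrA ih [flo n.+1]/= levS natrD -mul2n natrM.
case e : (digit n); last by rewrite /= addn0; ring.
rewrite /= addn1 tail_ofS -(eqP e) exprS; field.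
by rewrite expf_neq0.
Qed.

(** The lower bound is strict because remainders are positive, the upper one because [x] is not
    dyadic: no vertex of a cell lies on the line. *)
Lemma flo_lt n : (flo n)%:R < 2 ^+ n * x /\ 2 ^+ n * x < (flo n).+1%:R.
Proof.
have [r0 r1] := tail_of_bounds (lev n) nexp_x.
have p : 0 < 2 ^+ n :> R by rewrite exprn_gt0.
have e := flo_eq n; split; first by rewrite e ltrDl mulr_gt0.
rewrite lt_def; apply/andP; split.
  apply/eqP => h; apply: x_nd; exists (flo n).+1, n.
  by rewrite h mulrAC divff ?mul1r // gt_eqF.
have [_ h] := binary_exponents_floor (lev n) nexp_x.
rewrite e -[(flo n).+1]addn1 natrD lerD2l.
have : r (lev n) <= h2 n.
  apply: (le_trans h); rewrite lef_pV2 ?posrE ?exprn_gt0 // ler_eXn2l; last by lra.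
  by have /andP[_] := lev_bounds n; lia.
by rewrite mulrC -ler_pdivlMr // div1r.
Qed.

Lemma rho_bounds n : 0 <= rho n /\ rho n <= 3 / 10.
Proof. exact: m0_y_bounds. Qed.

Lemma gam_ge0 n : 0 <= gam n.
Proof.
have [h1 h3] := rho_bounds n; rewrite /gam !mulr_ge0 ?exprn_ge0 //; lra.
Qed.

Lemma gam_digit0 n : ~~ digit n -> gam n.+1 = gam n.
Proof. by move=> d; rewrite /gam /rho levS (negbTE d) addn0. Qed.

Lemma gam_digit1 n : digit n -> gam n = 2 * (5 / 3) ^+ n.+1 * (1 - rho n).
Proof. by move=> /eqP e; rewrite /gam -e. Qed.

(** Kirchhoff's law at each of the two midpoints at the foot of the top child: with potential 1 at
    the top and [rho n] at both midpoints, the current arriving along one edge leaves through the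
    conductor [gam n.+1]. It is the recursion for [m0] with the denominator cleared. *)
Lemma gam_digit1S n : digit n -> gam n.+1 * rho n = (5 / 3) ^+ n.+1 * (1 - rho n).
Proof.
move=> d; have [h1 h3] := rho_bounds n.+1; have [h4 h5] := rho_bounds n.
rewrite /gam /rho levS d addn1 in h1 h3 *; rewrite (eqP d).
have := m0_y_rec (lev n); have c := conductance_ge (lev n).+1.
have -> : (5 / 3) ^+ nx (lev n).+2 = (5 / 3) ^+ nx (lev n).+1 *
    (5 / 3) ^+ (nx (lev n).+2 - nx (lev n).+1)%N :> R.
  by rewrite -exprD subnKC // ltnW // nexpS.
set C := (5 / 3) ^+ (_ - _)%N in c *; set a := m0 _; set b := m0 _ in h1 h3 *.
move=> e; have : a * (1 + 2 * C * (1 - b)) = 1.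
  by rewrite e mulVf //; apply: lt0r_neq0; nra.
clear e h4 h5; set P := (5 / 3) ^+ _; clearbody P C a b => e1.
have -> : 1 - a = a * (2 * C * (1 - b)) by lra.
by ring.
Qed.

Lemma lev_geom : (fun n => (3 / 5) ^+ lev n : R) @ \oo --> (0 : R).
Proof.
have h : (fun n => (3 / 5) ^+ n : R) @ \oo --> (0 : R).
  by apply: cvg_expr; rewrite ger0_norm; lra.
apply/cvgrPdist_lt => e e0; move/cvgrPdist_lt: h => /(_ e e0) [N _ hN].
exists (nx N) => // n /= hn; apply: hN => /=.
by rewrite -(lev_nexp N); exact: lev_leq.
Qed.

End Digits.

(** * Local energy forms *)

Section Words.
Implicit Types (w v : seq 'I_3) (i j k : 'I_3).

Fixpoint words n : seq (seq 'I_3) :=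
  if n is n'.+1 then [seq rcons w i | w <- words n', i <- enum 'I_3]
  else [:: [::]].

Lemma big_wordsS (V : nmodType) n (F : seq 'I_3 -> V) :
  \sum_(w <- words n.+1) F w = \sum_(w <- words n) \sum_(i < 3) F (rcons w i).
Proof.
rewrite /= big_allpairs_dep; apply: eq_bigr => w _; exact: big_enum.
Qed.

Lemma mem_words n w : (w \in words n) = (size w == n).
Proof.
apply/idP/eqP => [|<-].
  elim: n w => [|n ih] w /=; first by rewrite inE => /eqP ->.
  by move=> /allpairsP[[v i] /= [/ih hv _ ->]]; rewrite size_rcons hv.
elim/last_ind: w => [|w i ih]; first by rewrite inE.
by rewrite size_rcons; apply/allpairsP; exists (w, i); rewrite mem_enum.
Qed.

Lemma words_uniq n : uniq (words n).
Proof.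
elim: n => //= n ih; apply: allpairs_uniq; rewrite ?enum_uniq //.
by move=> [w i] [v j] _ _ /= /rcons_inj [-> ->].
Qed.

Definition row w : nat := foldl (fun N i => (N.*2 + (i != ord0))%N) 0%N w.

Lemma row_rcons w i : row (rcons w i) = ((row w).*2 + (i != ord0))%N.
Proof. by rewrite /row foldl_rcons. Qed.

End Words.

Section MidpointGeometry.
Context {R : realType}.
Implicit Types (w : seq 'I_3) (i j k : 'I_3).

(* The midpoint of the side opposite to the vertex [k]. *)
Definition mpt k : R * R :=
  match val k with
  | 0%N => Fmap o1 (q o2)
  | 1%N => Fmap o2 (q ord0)
  | _ => Fmap o1 (q ord0)
  end.

Definition mid w k : R * R := Fword w (mpt k).

Lemma Fmap_qC i j : Fmap i (q j) = Fmap j (q i) :> R * R.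
Proof. by rewrite /Fmap addrC; congr pair; rewrite addrC. Qed.

Lemma Fmap_mpt i j : i != j -> Fmap i (q j) = mpt (opp i j).
Proof.
by elim/ord3P: i; elim/ord3P: j => // _; rewrite ?oppE // Fmap_qC.
Qed.

Lemma mid_Fword w i j : i != j -> Fword (rcons w i) (q j) = mid w (opp i j).
Proof. by move=> ne; rewrite Fword_rcons Fmap_mpt. Qed.

Definition vx (u : R * R -> R) w i : R := u (Fword w (q i)).

Lemma vx_rcons u w i : vx u (rcons w i) = child (fun k => u (mid w k)) (vx u w) i.
Proof.
apply/funext => j; rewrite /vx /child; case: eqVneq => [->|ne].
  by rewrite Fword_rcons Fmap_q.
by rewrite eq_sym in ne; rewrite mid_Fword.
Qed.

Lemma cell_mid w k : cell w (mid w k).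
Proof.
exists (mpt k) => //; elim/ord3P: k; rewrite /mpt /=; apply: SG_F; exact: SG_q.
Qed.

End MidpointGeometry.

Section LocalForms.
Context {R : realType}.
Implicit Types (a b m d : 'I_3 -> R) (i j k : 'I_3).

Definition tri a b : R :=
  (a ord0 - a o1) * (b ord0 - b o1) + (a ord0 - a o2) * (b ord0 - b o2) +
  (a o1 - a o2) * (b o1 - b o2).

(** The harmonic extension rule of the gasket: weight 2/5 for each end of the side, 1/5 for the
    vertex [k] opposite to it. *)
Definition harm a k : R := (2 * (a ord0 + a o1 + a o2) - a k) / 5.

(** The sum of [tri] over the three children, for data that vanish at the corners of the parent. *)
Definition tri_mid d d' : R :=
  2 * (d ord0 * d' ord0 + d o1 * d' o1 + d o2 * d' o2) + tri d d'.

(* The harmonic extension to the midpoints minimizes the energy. *)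
Lemma tri_children a b m m' :
  5 / 3 * \sum_(i < 3) tri (child m a i) (child m' b i) =
  tri a b + 5 / 3 * tri_mid (fun k => m k - harm a k) (fun k => m' k - harm b k).
Proof. by rewrite big_ord3 /tri_mid /tri /child /= !oppE /harm; field. Qed.

Lemma tri_ge0 a : 0 <= tri a a.
Proof. by rewrite /tri -!expr2 !addr_ge0 ?sqr_ge0. Qed.

Lemma tri_mid_ge0 d : 0 <= tri_mid d d.
Proof.
by rewrite /tri_mid addr_ge0 ?tri_ge0 // -!expr2 mulr_ge0 // !addr_ge0 ?sqr_ge0.
Qed.

Lemma harm_hull a lo hi k : (forall i, lo <= a i <= hi) -> lo <= harm a k <= hi.
Proof.
move=> h; have /andP[h1 h2] := h ord0; have /andP[h3 h4] := h o1.
have /andP[h5 h6] := h o2; rewrite /harm.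
by elim/ord3P: k; apply/andP; split; lra.
Qed.

Lemma harm_osc a (B : R) i j l : (forall i j, `|a i - a j| <= B) ->
  `|child (harm a) a i j - child (harm a) a i l| <= 3 / 5 * B.
Proof.
move=> h; have := h ord0 o1; have := h ord0 o2; have := h o1 o2.
rewrite !ler_norml => /andP[h1 h2] /andP[h3 h4] /andP[h5 h6].
rewrite /child /harm; elim/ord3P: i; elim/ord3P: j; elim/ord3P: l;
  rewrite /= ?oppE; apply/andP; split; lra.
Qed.

End LocalForms.

(** * Cell energies relative to the line, and their Gram matrices *)

Section LineForms.
Context {R : realType}.
Variable x : R.
Implicit Types (w v : seq 'I_3) (a b m d : 'I_3 -> R) (i j k l : 'I_3).

(* [row w] is the depth of the top vertex of the cell [w] below [q ord0], in
   units of [2 ^- size w]: an [inside] cell lies above the line, a [crossing]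
   one has its top vertex above the line and the opposite side below it. *)
Definition inside w : bool := (row w < flo x (size w))%N.
Definition crossing w : bool := row w == flo x (size w).

Lemma crossing_inside w : crossing w -> inside w = false.
Proof. by rewrite /crossing /inside => /eqP ->; rewrite ltnn. Qed.

Lemma inside_rcons w i : inside w -> inside (rcons w i).
Proof.
rewrite /inside row_rcons size_rcons /=.
by case: (i != ord0); case: (digit _ _); lia.
Qed.

Lemma inside_cat w v : inside w -> inside (w ++ v).
Proof.
elim: v w => [|i v ih] w h; first by rewrite cats0.
by rewrite -cat_rcons; apply: ih; exact: inside_rcons.
Qed.

Lemma inside_not_crossing w : inside w -> crossing w = false.
Proof. by move=> h; apply/negP => /crossing_inside; rewrite h. Qed.

Lemma crossing_rcons0 w : crossing (rcons w ord0) = crossing w && ~~ digit x (size w).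
Proof.
rewrite /crossing row_rcons size_rcons /=; case: (digit _ _) => /=; rewrite ?andbF ?andbT; lia.
Qed.

Lemma crossing_rcons w i : i != ord0 ->
  crossing (rcons w i) = crossing w && digit x (size w).
Proof.
rewrite /crossing row_rcons size_rcons /= => ->; case: (digit _ _) => /=; rewrite ?andbF ?andbT; lia.
Qed.

Lemma inside_rcons0 w : crossing w -> inside (rcons w ord0) = digit x (size w).
Proof.
rewrite /crossing /inside row_rcons size_rcons /=; case: (digit _ _) => /=; lia.
Qed.

Lemma inside_rconsN w i : i != ord0 -> inside (rcons w i) = inside w.
Proof.
rewrite /inside row_rcons size_rcons /= => ->; case: (digit _ _) => /=; lia.
Qed.

Lemma inside_rcons0N w : ~~ crossing w -> inside (rcons w ord0) = inside w.
Proof.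
rewrite /crossing /inside row_rcons size_rcons /=; case: (digit _ _) => /=; lia.
Qed.

Lemma crossing_prefix w v : crossing (w ++ v) -> crossing w.
Proof.
elim/last_ind: v => [|v i ih]; first by rewrite cats0.
rewrite -rcons_cat; have [->|ne] := eqVneq i ord0.
  by rewrite crossing_rcons0 => /andP[/ih].
by rewrite crossing_rcons // => /andP[/ih].
Qed.

(* The rule giving the values at the midpoints of [w] of the function that has
   the values [a] at the vertices of [w], vanishes on the line and is harmonic
   above it. *)
Definition Mx w a k : R :=
  if crossing w then
    if digit x (size w) && (k != ord0) then rho x (size w) * a ord0 else 0
  else harm a k.

Hypotheses (x_gt0 : 0 < x) (x_lt1 : x < 1).

(** Maximum principle: in a crossing cell the factor [rho] lies in [0, 1], so the rule mixes the top
    value with the value 0 on the line. *)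
Lemma Mx_hull w a lo hi k : (forall i, lo <= a i <= hi) ->
  (crossing w -> lo <= 0 <= hi) -> lo <= Mx w a k <= hi.
Proof.
move=> h h0; rewrite /Mx; case: ifP => [/h0 /andP[l0 h0']|_]; last exact: harm_hull.
case: ifP => _; last by rewrite l0.
have /andP[h1 h2] := h ord0; have [r0 r1] := rho_bounds x_gt0 x_lt1 (size w).
by apply/andP; split; nra.
Qed.

Lemma child_hull w a lo hi i j : (forall i, lo <= a i <= hi) ->
  (crossing w -> lo <= 0 <= hi) -> lo <= child (Mx w a) a i j <= hi.
Proof. by move=> h h0; rewrite /child; case: ifP => // _; exact: Mx_hull. Qed.

Definition eh w a b : R :=
  if inside w then (5 / 3) ^+ size w * tri a b
  else if crossing w then gam x (size w) * (a ord0 * b ord0) else 0.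

Definition Qf w d d' : R :=
  if inside w then (5 / 3) ^+ (size w).+1 * tri_mid d d'
  else if crossing w && digit x (size w) then
    (5 / 3) ^+ (size w).+1 *
      (d o1 * d' o1 + d o2 * d' o2 + (d o1 - d o2) * (d' o1 - d' o2)) +
    gam x (size w).+1 * (d o1 * d' o1 + d o2 * d' o2)
  else 0.

(** [Mx] makes the energy of the children stationary, so deviations from it enter without cross
    terms. For an inside cell this is [tri_children]; for a crossing cell with digit 1 the cross
    terms cancel by Kirchhoff's law. *)
Lemma eh_children w a b m m' :
  \sum_(i < 3) eh (rcons w i) (child m a i) (child m' b i) =
  eh w a b + Qf w (fun k => m k - Mx w a k) (fun k => m' k - Mx w b k).
Proof.
rewrite /eh /Qf /Mx; have [iw|niw] := boolP (inside w).
  rewrite inside_not_crossing //.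
  under eq_bigr do rewrite inside_rcons // size_rcons.
  rewrite -mulr_sumr exprSr -[X in X = _]mulrA tri_children; ring.
have [cw|ncw] := boolP (crossing w); last first.
  rewrite /= addr0 big1 // => i _; have [->|ne] := eqVneq i ord0.
    by rewrite inside_rcons0N // (negbTE niw) crossing_rcons0 (negbTE ncw).
  by rewrite inside_rconsN // (negbTE niw) crossing_rcons // (negbTE ncw).
rewrite big_ord3 inside_rcons0 // !inside_rconsN // (negbTE niw).
rewrite crossing_rcons0 !crossing_rcons // cw /= !size_rcons.
have [dw|ndw] := boolP (digit x (size w)) => /=; last first.
  by rewrite /child /= gam_digit0 //; ring.
rewrite /tri /child /= !oppE.
have e := gam_digit1 dw; have e' := gam_digit1S x_gt0 x_lt1 dw.
rewrite {}e; move: e'; move: (gam _ _) (rho _ _) (_ ^+ _) => G r P e.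
(* The two sides of the goal differ by exactly this multiple of Kirchhoff's relation. *)
have := congr1 (fun z => z * (2 * r * a ord0 * b ord0 - (m o1 + m o2) * b ord0 -
  a ord0 * (m' o1 + m' o2))) e.
move: (a _) (b _) (m o1) (m o2) (m' o1) (m' o2) => A B m1 m2 n1 n2 /= e2; lra.
Qed.

Definition valid w k : bool :=
  inside w || [&& crossing w, digit x (size w) & k != ord0].

(* The inverse of the matrix of the form [Qf w] on the valid indices. *)
Definition gco w k l : R :=
  if inside w then
    (if k == l then 3 / 10 else 1 / 10) * (3 / 5) ^+ (size w).+1
  else if valid w k && valid w l then
    let a := rho x (size w) in
    (if k == l then a + a ^+ 2 else a ^+ 2) / (2 * a + 1) * (3 / 5) ^+ (size w).+1
  else 0.

Lemma gcoC w k l : gco w k l = gco w l k.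
Proof. by rewrite /gco eq_sym andbC. Qed.

Lemma gco_valid w k l : gco w k l != 0 -> valid w k /\ valid w l.
Proof.
rewrite /gco; case: ifP => [i _|_]; first by rewrite /valid i.
by case: ifP => [/andP[]|_ /eqP].
Qed.

Lemma gco_bound w k l : `|gco w k l| <= (3 / 5) ^+ (size w).
Proof.
have p : 0 <= (3 / 5 : R) ^+ size w by apply: exprn_ge0; lra.
have [r0 r1] := rho_bounds x_gt0 x_lt1 (size w).
have bnd (z : R) : 0 <= z <= 1 -> `|z * (3 / 5) ^+ (size w).+1| <= (3 / 5) ^+ size w.
  move=> /andP[z0 z1]; rewrite exprS ger0_norm; last by rewrite !mulr_ge0 //; lra.
  by move: p; move: (_ ^+ _) => P p; nra.
rewrite /gco; case: ifP => _; first by apply: bnd; case: ifP => _; lra.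
case: ifP => _; last by rewrite normr0.
apply: bnd; move: (rho _ _) r0 r1 => a r0 r1.
have h : 0 < 2 * a + 1 by lra.
have /andP[h1 h2] : 0 <= (if k == l then a + a ^+ 2 else a ^+ 2) <= 2 * a + 1.
  by case: ifP => _; apply/andP; split; nra.
by rewrite ler_pdivrMr // mul1r h2 divr_ge0 // ltW.
Qed.

(** Up to the factor P / r the matrix has 1 + r on the diagonal and -r off it, with determinant 2 r
    + 1. Both coefficients carry a factor [r], so [G] is eliminated through [G * r] without dividing
    by [r]. *)
Let inverse2 (G r P Q d1 d2 : R) : G * r = P * (1 - r) -> P * Q = 1 ->
  2 * r + 1 != 0 ->
  (r + r ^+ 2) / (2 * r + 1) * Q * (P * (d1 + (d1 - d2)) + G * d1) +
  r ^+ 2 / (2 * r + 1) * Q * (P * (d2 + (d2 - d1)) + G * d2) = d1.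
Proof.
move=> e p r0.
have s1 : r * (P * (d1 + (d1 - d2)) + G * d1) = P * ((1 + r) * d1 - r * d2).
  by have := congr1 (fun z => z * d1) e => /=; lra.
have s2 : r * (P * (d2 + (d2 - d1)) + G * d2) = P * ((1 + r) * d2 - r * d1).
  by have := congr1 (fun z => z * d2) e => /=; lra.
transitivity ((1 + r) * (r * (P * (d1 + (d1 - d2)) + G * d1)) * (Q / (2 * r + 1)) +
  r * (r * (P * (d2 + (d2 - d1)) + G * d2)) * (Q / (2 * r + 1))).
  by field.
rewrite s1 s2; transitivity (P * Q * d1); last by rewrite p mul1r.
by field.
Qed.

(** The matrix of [tri_mid] is 5 I - J, with J the all-ones matrix; its inverse (I + J / 2) / 5 has
    the entries 3/10 and 1/10. The crossing case is [inverse2]. *)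
Lemma gco_inv w k d :
  \sum_(l < 3) gco w k l * Qf w (fun j => (j == l)%:R) d = (valid w k)%:R * d k.
Proof.
have p : (5 / 3) ^+ (size w).+1 * (3 / 5) ^+ (size w).+1 = 1 :> R.
  by rewrite -exprMn (_ : 5 / 3 * (3 / 5) = 1) ?expr1n //; lra.
rewrite /gco /Qf /valid; case: (inside w) => /=.
  rewrite big_ord3 /tri_mid /tri; move: (_ ^+ _) (_ ^+ _) p => P Q p.
  elim/ord3P: k => /=;
  [have := congr1 (fun z => z * d ord0) p
  |have := congr1 (fun z => z * d o1) p|have := congr1 (fun z => z * d o2) p];
  move: (d ord0) (d o1) (d o2) => d0 d1 d2 /= e; lra.
case: (crossing w) => /=; last by rewrite big1 ?mul0r // => l _; rewrite mul0r.
have [dw|ndw] := boolP (digit x (size w)) => /=; last first.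
  by rewrite big1 ?mul0r // => l _; rewrite mul0r.
have e := gam_digit1S x_gt0 x_lt1 dw; have [r0 r1] := rho_bounds x_gt0 x_lt1 (size w).
rewrite big_ord3 /= !mul0r add0r.
have r21 : 2 * rho x (size w) + 1 != 0 by apply: lt0r_neq0; lra.
elim/ord3P: k => /=; first by rewrite !mul0r !addr0.
  rewrite mul0r add0r [RHS]mul1r -[RHS](inverse2 (d o1) (d o2) e p r21).
  by congr (_ * (_ * _ + _ * _) + _ * (_ * _ + _ * _)); ring.
rewrite mul0r add0r [RHS]mul1r -[RHS](inverse2 (d o2) (d o1) e p r21) addrC.
by congr (_ * (_ * _ + _ * _) + _ * (_ * _ + _ * _)); ring.
Qed.

End LineForms.

(** * The splines *)

Section Splines.
Context {R : realType}.
Variable x : R.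
Hypotheses (x_gt0 : 0 < x) (x_lt1 : x < 1).
Implicit Types (w v : seq 'I_3) (a b m d : 'I_3 -> R) (i j k l : 'I_3).

(** The harmonic rule, overridden in the single cell [w0], where one midpoint is set to 1 and the
    other two to 0. *)
Definition Msp w0 k0 w a k : R := if w == w0 then (k == k0)%:R else Mx x w a k.

(* The spline written [phi_z^k], for [z = mid w0 k0] and [k = (size w0).+1]. *)
Definition sp w0 k0 : R * R -> R := subdiv_fun (Msp w0 k0) (fun=> 0).

Lemma Mx0 w k : Mx x w (fun=> 0) k = 0.
Proof. by rewrite /Mx /harm mulr0; do 2?case: ifP => _ //; lra. Qed.

Lemma opp_neq i j : i != ord0 -> j != ord0 -> i != j -> opp i j = ord0.
Proof. by elim/ord3P: i; elim/ord3P: j => //; rewrite oppE. Qed.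

Lemma opp0_neq i : i != ord0 -> opp i ord0 != ord0 /\ opp ord0 i != ord0.
Proof. by elim/ord3P: i => //; rewrite !oppE. Qed.

Section One.
Variables (w0 : seq 'I_3) (k0 : 'I_3).
Hypothesis vwk : valid x w0 k0.

Local Notation s := (sval (Msp w0 k0) (fun=> 0)).

Lemma sv_rcons w i : s (rcons w i) = child (Msp w0 k0 w (s w)) (s w) i.
Proof. exact: sval_rcons. Qed.

Lemma sv_zero w : (size w <= size w0)%N || (take (size w0) w != w0) ->
  s w = fun=> 0.
Proof.
elim/last_ind: w => [//|w i ih]; rewrite size_rcons => h.
have ne : w != w0.
  apply: contraTneq h => ->; rewrite ltnn negbK /= -cats1 take_size_cat //.
rewrite sv_rcons ih.
  by apply/funext => j; rewrite /child /Msp (negbTE ne) Mx0; case: ifP.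
move: h; case: (leqP (size w) (size w0)) => //= hs.
by rewrite ltnNge (ltnW hs) /= -cats1 takel_cat // ltnW.
Qed.

Lemma sv_bounds w i : 0 <= s w i <= 1.
Proof.
elim/last_ind: w i => [|w j ih] i; first by rewrite /= lexx ler01.
rewrite sv_rcons /child; case: ifP => // _; rewrite /Msp; case: ifP => _.
  by case: (_ == _) => /=; rewrite ?lexx ler01.
by apply: Mx_hull => // _; rewrite lexx ler01.
Qed.

(** A contraction by 3/5 is guaranteed only at digits 1, hence the exponent [lev x n]. The constant
    keeps the bound at least 5/3 up to level [(size w0).+1], so that values in [0, 1] satisfy even
    the sharper estimate, with the factor 3/5, in [sv_osc]. *)
Definition osc_bound n : R := (5 / 3) ^+ (lev x (size w0)).+2 * (3 / 5) ^+ lev x n.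
Local Notation B := osc_bound.

Let geom_id n : (5 / 3) ^+ n * (3 / 5) ^+ n = 1 :> R.
Proof. by rewrite -exprMn (_ : 5 / 3 * (3 / 5) = 1) ?expr1n //; lra. Qed.

Lemma osc_bound_ge0 n : 0 <= B n.
Proof. by rewrite mulr_ge0 // exprn_ge0 //; lra. Qed.

Lemma osc_boundS n : B n.+1 = if digit x n then 3 / 5 * B n else B n.
Proof.
rewrite /osc_bound levS; case: digit; rewrite ?addn0 // addn1.
by rewrite [X in _ * X = _]exprS mulrCA.
Qed.

Lemma osc_bound_ge n : (n <= (size w0).+1)%N -> 5 / 3 <= B n.
Proof.
move=> /(lev_leq x); rewrite levS => h.
have {}h : (lev x n <= (lev x (size w0)).+1)%N.
  by apply: (leq_trans h); case: digit; rewrite ?addn1 ?addn0.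
rewrite /osc_bound -[X in (5 / 3) ^+ X](subnK (leq_trans h (leqnSn _))).
rewrite exprD -mulrA geom_id mulr1 -{1}[5 / 3]expr1 ler_eXn2l; [lia|lra].
Qed.

Lemma osc_bound_cvg : B @ \oo --> (0 : R).
Proof.
rewrite -[X in _ --> X](mulr0 ((5 / 3) ^+ (lev x (size w0)).+2)).
by apply: cvgM; [exact: cvg_cst|exact: lev_geom].
Qed.

(** The top of a crossing cell is kept below 3/5 of the bound: this reserve is spent at a digit 1,
    when the top child becomes an inside cell while the bound itself drops by 3/5. The crossing
    children recover it because [rho] is at most 3/10. *)
Lemma sv_osc w :
  [/\ crossing x w -> (forall i, i != ord0 -> s w i = 0) /\
        `|s w ord0| <= 3 / 5 * B (size w),
      ~~ crossing x w -> forall i j, `|s w i - s w j| <= B (size w) &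
      ~~ crossing x w -> ~~ inside x w -> s w = fun=> 0].
Proof.
elim/last_ind: w => [|w i [ih1 ih2 ih3]].
  by rewrite /= normr0; split => // _; split => //; rewrite mulr_ge0 ?osc_bound_ge0 //; lra.
rewrite sv_rcons size_rcons.
have B0 := osc_bound_ge0 (size w); have B0' := osc_bound_ge0 (size w).+1.
have [ew|nw] := eqVneq w w0.
  subst w; have b53 := osc_bound_ge (leqnn (size w0).+1).
  have bnd j : 0 <= child (Msp w0 k0 w0 (s w0)) (s w0) i j <= 1.
    by rewrite -sv_rcons; exact: sv_bounds.
  have vc : crossing x w0 -> digit x (size w0) /\ k0 != ord0.
    move=> c; move: vwk; rewrite /valid crossing_inside // c /=.
    by move=> /andP[].
  split.
  - have [->|i0] := eqVneq i ord0.
      by rewrite crossing_rcons0 => /andP[/vc[-> _]].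
    rewrite crossing_rcons // => /andP[/vc[_ k00] dg]; split.
      move=> j j0; rewrite /child (sv_zero _) ?leqnn //; case: (eqVneq j i) => // ne.
      by rewrite eq_sym in ne; rewrite opp_neq // /Msp eqxx eq_sym (negbTE k00).
    by rewrite ler_norml; have := bnd ord0; move=> /andP[? ?]; apply/andP; lra.
  - move=> _ j l; have := bnd j; have := bnd l => /andP[? ?] /andP[? ?].
    by rewrite ler_norml; apply/andP; lra.
  - move=> nc ni; exfalso; move: vwk => /orP[iw|/and3P[cw dw _]].
      by rewrite inside_rcons in ni.
    have [i0|i0] := eqVneq i ord0.
      by move: ni; rewrite i0 inside_rcons0 // dw.
    by move: nc; rewrite crossing_rcons // cw dw.
have -> : Msp w0 k0 w (s w) = Mx x w (s w).
  by apply/funext => k; rewrite /Msp (negbTE nw).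
rewrite osc_boundS; have [cw|ncw] := boolP (crossing x w).
  have [bot top] := ih1 cw; have [r0 r1] := rho_bounds x_gt0 x_lt1 (size w).
  have [dw|ndw] := boolP (digit x (size w)).
    have MxN k : k != ord0 -> Mx x w (s w) k = rho x (size w) * s w ord0.
      by rewrite /Mx cw dw /= => ->.
    have [->|i0] := eqVneq i ord0.
      rewrite crossing_rcons0 cw dw /= inside_rcons0 // dw; split => // _ j l.
      apply: le_trans top; rewrite /child.
      have h z : `|z - rho x (size w) * z| <= `|z|.
        rewrite -{1}[z]mul1r -mulrBl normrM ler_piMl // ger0_norm; lra.
      case: (eqVneq j ord0) => [_|jn]; case: (eqVneq l ord0) => [_|ln].
      - by rewrite subrr normr0.
      - by rewrite MxN ?(opp0_neq ln).2.
      - by rewrite MxN ?(opp0_neq jn).2 // distrC.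
      - by rewrite !MxN ?(opp0_neq ln).2 ?(opp0_neq jn).2 // subrr normr0.
    rewrite crossing_rcons // cw dw /=; split => // _; split.
      move=> j j0; rewrite /child; case: (eqVneq j i) => [_|ne]; first exact: bot.
      by rewrite eq_sym in ne; rewrite opp_neq // /Mx cw andbF.
    rewrite /child eq_sym (negbTE i0) MxN ?(opp0_neq i0).1 //.
    by rewrite normrM ger0_norm //; move: (normr_ge0 (s w ord0)); nra.
  have Mxz k : Mx x w (s w) k = 0 by rewrite /Mx cw (negbTE ndw).
  have [->|i0] := eqVneq i ord0.
    rewrite crossing_rcons0 cw ndw; split => // _; split.
      by move=> j j0; rewrite /child (negbTE j0) Mxz.
    by rewrite /child eqxx.
  have z : child (Mx x w (s w)) (s w) i = fun=> 0.
    by apply/funext => j; rewrite /child Mxz; case: ifP => // _; exact: bot.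
  rewrite crossing_rcons // cw (negbTE ndw) z; split => // _ j l.
  by rewrite subrr normr0.
have e : Mx x w (s w) = harm (s w).
  by apply/funext => k; rewrite /Mx (negbTE ncw).
have nci : crossing x (rcons w i) = false.
  by apply: contraNF ncw; rewrite -cats1; exact: crossing_prefix.
rewrite nci e; split => //.
  move=> _ j l; have := harm_osc i j l (ih2 ncw); case: digit => //.
  by move=> /le_trans; apply; lra.
move=> _ ni; have nw' : ~~ inside x w by apply: contraNN ni; exact: inside_rcons.
rewrite (ih3 ncw nw'); apply/funext => j; rewrite /child -(Mx0 w (opp i j)).
by rewrite /Mx (negbTE ncw); case: ifP => // _; rewrite /harm; lra.
Qed.

Lemma sv_hull w v lo hi i : (size w0 < size w)%N ->
  (forall i, lo <= s w i <= hi) -> (crossing x w -> lo <= 0 <= hi) ->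
  lo <= s (w ++ v) i <= hi.
Proof.
move=> hs h h0; elim/last_ind: v i => [|v j ih] i; first by rewrite cats0.
rewrite -rcons_cat sv_rcons; have -> : Msp w0 k0 (w ++ v) (s (w ++ v)) =
    Mx x (w ++ v) (s (w ++ v)).
  apply/funext => k; rewrite /Msp; case: eqP => // e.
  by move: hs; rewrite -e size_cat; lia.
apply: (child_hull x_gt0 x_lt1) => // c; apply: h0.
exact: crossing_prefix c.
Qed.

Lemma sv_osc_cat w v i j : `|s (w ++ v) i - s w j| <= B (size w).
Proof.
have [h|h] := leqP (size w) (size w0).
  have := osc_bound_ge (leq_trans h (leqnSn _)).
  have := sv_bounds w j; have := sv_bounds (w ++ v) i => /andP[? ?] /andP[? ?] ?.
  by rewrite ler_norml; apply/andP; lra.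
have B0 := osc_bound_ge0 (size w).
have [h1 h2 _] := sv_osc w; have [cw|ncw] := boolP (crossing x w).
  have [bot top] := h1 cw; have t0 := sv_bounds w ord0.
  have hw l : 0 <= s w l <= s w ord0.
    have [->|l0] := eqVneq l ord0; first by rewrite lexx; case/andP: t0 => ->.
    by rewrite bot // lexx; case/andP: t0 => ->.
  have := @sv_hull w v 0 (s w ord0) i h hw _; rewrite lexx (andP t0).1 => /(_ (fun=> isT)).
  rewrite ger0_norm ?(andP t0).1 // in top.
  by have := hw j => /andP[? ?] /andP[? ?]; rewrite ler_norml; apply/andP; lra.
have hw l : s w j - B (size w) <= s w l <= s w j + B (size w).
  by have := h2 ncw l j; rewrite ler_norml => /andP[? ?]; apply/andP; lra.
have /andP[? ?] := sv_hull v i h hw (fun c => False_ind _ (negP ncw c)).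
by rewrite ler_norml; apply/andP; lra.
Qed.

Lemma sp_continuous : {within SG, continuous (sp w0 k0)}.
Proof. exact: subdiv_fun_continuous osc_bound_cvg sv_osc_cat. Qed.

Lemma vx_sp w : vx (sp w0 k0) w = s w.
Proof.
by apply/funext => i; exact: (subdiv_fun_vertex osc_bound_cvg sv_osc_cat).
Qed.

Lemma sp_mid w k : sp w0 k0 (mid w k) = Msp w0 k0 w (s w) k.
Proof.
have [i [j [ij <-]]] : exists i j, i != j /\ opp i j = k.
  by elim/ord3P: k; [exists o1, o2|exists o2, ord0|exists o1, ord0];
    rewrite oppE.
rewrite -mid_Fword // -[LHS]/(vx (sp w0 k0) (rcons w i) j) vx_sp sv_rcons.
by rewrite /child eq_sym (negbTE ij).
Qed.

Lemma vx_sp0 w : (size w <= size w0)%N || (take (size w0) w != w0) ->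
  vx (sp w0 k0) w = fun=> 0.
Proof. by move=> h; rewrite vx_sp sv_zero. Qed.

Lemma sp_bounds p : SG p -> 0 <= sp w0 k0 p <= 1.
Proof.
move=> hp; apply: (@cell_hull _ SG _ [::]) => //.
- exact: sp_continuous.
- by move=> _ [p' h <-].
- by move=> v i; have := sv_bounds v i; rewrite -vx_sp.
- by exists p.
Qed.

Lemma sp_out w p : size w = size w0 -> w != w0 -> cell w p -> sp w0 k0 p = 0.
Proof.
move=> hs ne wp; apply/esym/le_anti; apply: (@cell_hull _ SG _ w) => //.
- exact: sp_continuous.
- exact: cell_SG.
- move=> v i; have := @vx_sp0 (w ++ v); rewrite -hs take_size_cat // ne orbT.
  move=> /(_ isT) e; change (0 <= vx (sp w0 k0) (w ++ v) i <= 0).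
  by rewrite e lexx.
Qed.

End One.

(** The coordinates in the hierarchical basis of splines: by [dfct_sp] these functionals are dual to
    the splines. *)
Definition dfct u w k : R := u (mid w k) - Mx x w (vx u w) k.

Lemma dfct_sp w0 k0 w k : valid x w0 k0 ->
  dfct (sp w0 k0) w k = ((w == w0) && (k == k0))%:R.
Proof.
move=> h; rewrite /dfct sp_mid // vx_sp // /Msp; case: eqP => [->|_] /=.
  by rewrite sv_zero ?leqnn // Mx0 subr0.
by rewrite subrr.
Qed.

Lemma sp_support n p : SG p -> exists w1, forall w k, valid x w k -> size w = n ->
  w != w1 -> sp w k p = 0.
Proof.
move=> /(SG_cell n) [w1 [s1 c1]]; exists w1 => w k v sw ne.
by apply: (@sp_out w k v w1); rewrite ?s1 ?sw // eq_sym.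
Qed.

End Splines.

(** * Traces of the energy at a finite level *)

Section CellForms.
Context {R : realType}.
Implicit Types (w : seq 'I_3) (u v : R * R -> R) (P : pred (seq 'I_3)) (n : nat).

Definition gform P n u v : R :=
  \sum_(w <- words n | P w) (5 / 3) ^+ n * tri (vx u w) (vx v w).

Lemma gform_sqr P n u v (c : R) :
  gform P n (fun p => u p + c * v p) (fun p => u p + c * v p) =
  gform P n u u + 2 * c * gform P n u v + c ^+ 2 * gform P n v v.
Proof.
rewrite /gform !mulr_sumr -!big_split /=; apply: eq_bigr => w _.
by rewrite /tri /vx; ring.
Qed.

Lemma gform_ge0 P n u : 0 <= gform P n u u.
Proof.
by apply: sumr_ge0 => w _; rewrite mulr_ge0 ?tri_ge0 // exprn_ge0 //; lra.
Qed.

Lemma gform_le_S P n u :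
  (forall w i, size w = n -> P w -> P (rcons w i)) ->
  gform P n u u <= gform P n.+1 u u.
Proof.
move=> hP; rewrite /gform [X in _ <= X]big_mkcond big_wordsS big_mkcond /=.
rewrite big_seq [X in _ <= X]big_seq; apply: ler_sum => w.
rewrite mem_words => /eqP sw; case: ifP => [iw|_].
  under eq_bigr do rewrite hP // vx_rcons.
  rewrite -mulr_sumr exprSr -[X in _ <= X]mulrA tri_children.
  apply: ler_wpM2l; first by apply: exprn_ge0; lra.
  by rewrite lerDl mulr_ge0 ?tri_mid_ge0 //; lra.
by apply: sumr_ge0 => i _; case: ifP => // _; rewrite mulr_ge0 ?tri_ge0 // exprn_ge0 //; lra.
Qed.

End CellForms.

Section LevelForms.
Context {R : realType}.
Variable x : R.
Implicit Types (w : seq 'I_3) (u v : R * R -> R) (i j k l : 'I_3) (n N : nat).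

Definition En n u v : R := gform (inside x) n u v.

Definition Bd n u v : R :=
  \sum_(w <- words n | crossing x w) gam x n * (vx u w ord0 * vx v w ord0).

(* The trace on the level n of the energy of [Omega x]: the part of a crossing
   cell above the line acts as a conductor from its top vertex to the line. *)
Definition Eh n u v : R := \sum_(w <- words n) eh x w (vx u w) (vx v w).

Lemma EhE n u v : Eh n u v = En n u v + Bd n u v.
Proof.
rewrite /Eh /En /gform /Bd [X in _ = X + _]big_mkcond [X in _ = _ + X]big_mkcond.
rewrite -big_split /=.
apply: eq_big_seq => w; rewrite mem_words => /eqP sw; rewrite /eh sw.
case: ifP => [iw|_]; first by rewrite inside_not_crossing // addr0.
by rewrite add0r.
Qed.

Lemma EnC n u v : En n u v = En n v u.
Proof. by apply: eq_bigr => w _; rewrite /tri; ring. Qed.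

Lemma En_ge0 n u : 0 <= En n u u.
Proof. exact: gform_ge0. Qed.

Lemma Eh_lin n u u' v (c : R) :
  Eh n (fun p => u p + c * u' p) v = Eh n u v + c * Eh n u' v.
Proof.
rewrite /Eh mulr_sumr -big_split /=; apply: eq_bigr => w _.
by rewrite /eh /tri /vx; case: ifP => _; [ring|case: ifP => _; ring].
Qed.

Lemma Eh0 n v : Eh n (fun=> 0) v = 0.
Proof.
rewrite /Eh big1 // => w _; rewrite /eh /tri /vx.
by case: ifP => _; [ring|case: ifP => _; ring].
Qed.

Lemma EhC n u v : Eh n u v = Eh n v u.
Proof.
by apply: eq_bigr => w _; rewrite /eh /tri; case: ifP => _; [ring|case: ifP => _; ring].
Qed.

Lemma Eh_sum n (I : Type) (s : seq I) (P : pred I) (c : I -> R)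
    (u : I -> R * R -> R) v :
  Eh n (fun p => \sum_(i <- s | P i) c i * u i p) v =
  \sum_(i <- s | P i) c i * Eh n (u i) v.
Proof.
elim: s => [|i s ih].
  by rewrite big_nil -[RHS](Eh0 n v); congr Eh; apply/funext => p; rewrite big_nil.
rewrite big_cons -ih; case: ifP => Pi; last first.
  by congr Eh; apply/funext => p; rewrite big_cons Pi.
rewrite addrC -Eh_lin; congr Eh; apply/funext => p.
by rewrite big_cons Pi addrC.
Qed.

Lemma En_polar n u v :
  En n (u \+ v) (u \+ v) - En n (u \- v) (u \- v) = 4 * En n u v.
Proof.
rewrite /En /gform mulr_sumr -sumrB; apply: eq_bigr => w _; rewrite /tri /vx /=; ring.
Qed.

Lemma Bd_polar n u v :
  Bd n (u \+ v) (u \+ v) - Bd n (u \- v) (u \- v) = 4 * Bd n u v.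
Proof.
rewrite /Bd mulr_sumr -sumrB; apply: eq_bigr => w _; rewrite /vx /=; ring.
Qed.

Lemma En_le_S n u : En n u u <= En n.+1 u u.
Proof. by apply: gform_le_S => w i _; exact: inside_rcons. Qed.

Lemma En_mono n N u : (n <= N)%N -> En n u u <= En N u u.
Proof.
move=> /subnK <-; elim: (N - n)%N => // d ih; apply: le_trans ih _.
by rewrite addSn; exact: En_le_S.
Qed.

Definition follows n u := forall w k, (n <= size w)%N -> dfct x u w k = 0.

Hypotheses (x_gt0 : 0 < x) (x_lt1 : x < 1).

Lemma Bd_ge0 n u : 0 <= Bd n u u.
Proof.
by apply: sumr_ge0 => w _; rewrite mulr_ge0 ?gam_ge0 // -expr2 sqr_ge0.
Qed.

Lemma EhS n u v : Eh n.+1 u v =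
  Eh n u v + \sum_(w <- words n) Qf x w (dfct x u w) (dfct x v w).
Proof.
rewrite /Eh big_wordsS -big_split /=; apply: eq_bigr => w _.
by under eq_bigr do rewrite !vx_rcons; rewrite eh_children.
Qed.

Lemma Eh_follows n N u v : (n <= N)%N -> follows n u -> Eh N u v = Eh n u v.
Proof.
move=> /subnK <- f; elim: (N - n)%N => // d ih; rewrite addSn EhS ih big1_seq ?addr0 //.
move=> w /andP[_]; rewrite mem_words => /eqP sw.
have z k : dfct x u w k = 0 by apply: f; rewrite sw leq_addl.
by rewrite /Qf /tri_mid /tri !z; do 2?case: ifP => _ //; ring.
Qed.

Lemma En_le_Eh n u : En n u u <= Eh n u u.
Proof. by rewrite EhE lerDl Bd_ge0. Qed.

(* The flux of [u] through the line, which the rule [Mx] conserves. *)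
Definition flux n u : R :=
  \sum_(w <- words n | crossing x w) gam x n * `|vx u w ord0|.

(** At a digit 1 the two new conductors together carry [2 * gam n.+1 * rho n] times the top value,
    which Kirchhoff's law turns into [gam n] times it. *)
Lemma flux_follows n N u : (n <= N)%N -> follows n u -> flux N u = flux n u.
Proof.
move=> /subnK <- f; elim: (N - n)%N => [|d <-]; first by rewrite add0n.
set m := (d + n)%N.
rewrite addSn -/m /flux big_mkcond big_wordsS [RHS]big_mkcond /=.
apply: eq_big_seq => w; rewrite mem_words => /eqP sw.
have fm k : k != ord0 -> crossing x w -> digit x m ->
    u (mid w k) = rho x m * vx u w ord0.
  move=> k0 c dg; have /eqP := f w k (leq_trans (leq_addl d n) (eq_leq (esym sw))).
  by rewrite subr_eq0 => /eqP ->; rewrite /Mx c sw dg k0.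
rewrite big_ord3 crossing_rcons0 !crossing_rcons // sw !vx_rcons /child /=.
have [cw|//] := boolP (crossing x w); last by rewrite /= !addr0.
have [dg|ndg] := boolP (digit x m) => /=; last by rewrite gam_digit0 // !addr0.
rewrite !oppE !fm // add0r normrM ger0_norm; last by have [] := rho_bounds x_gt0 x_lt1 m.
have := gam_digit1 dg; have := gam_digit1S x_gt0 x_lt1 dg.
move: (gam x m.+1) (gam x m) (rho x m) (_ ^+ _) `|_| => G G' r P V e ->.
by rewrite mulrA e; ring.
Qed.

Lemma flux_ge0 n u : 0 <= flux n u.
Proof. by apply: sumr_ge0 => w _; rewrite mulr_ge0 ?gam_ge0. Qed.

Lemma Bd_flux n u v (e : R) :
  (forall w, size w = n -> crossing x w -> `|vx v w ord0| <= e) ->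
  `|Bd n u v| <= e * flux n u.
Proof.
move=> h; rewrite /Bd /flux mulr_sumr; apply: le_trans (ler_norm_sum _ _ _) _.
rewrite big_seq_cond [X in _ <= X]big_seq_cond; apply: ler_sum => w.
rewrite mem_words => /andP[/eqP sw cw]; rewrite normrM.
rewrite (ger0_norm (gam_ge0 x_gt0 x_lt1 n)) normrM.
rewrite [X in _ <= X]mulrC mulrA; apply: ler_wpM2l; last exact: h.
by rewrite mulr_ge0 ?gam_ge0.
Qed.

End LevelForms.

(** * Position of the cells relative to the line, and the limit of the graph energies *)

Section Omega.
Context {R : realType}.
Variable x : R.
Implicit Types (w : seq 'I_3) (u v : R * R -> R) (i j k l : 'I_3) (n N : nat).

Lemma height_Fword w (p : R * R) :
  (Fword w p).2 = 1 - ((row w)%:R + 1 - p.2) / 2 ^+ size w.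
Proof.
elim/last_ind: w p => [|w i ih] p; first by rewrite /= expr0 divr1 add0r; lra.
rewrite Fword_rcons ih row_rcons size_rcons exprS natrD -mul2n natrM invfM.
have -> : (Fmap i p).2 = (p.2 + 1 - (i != ord0)%:R) / 2.
  by have := bary_F ord0 i p; rewrite /bary /= => ->; case: (i == ord0) => /=; lra.
by field; rewrite expf_neq0.
Qed.

Lemma height_bounds (p : R * R) : SG p -> 0 <= p.2 <= 1.
Proof.
by move=> h; have := SG_bary ord0 h; have := bary_le1 ord0 h; rewrite /bary /= => -> ->.
Qed.

Lemma Omega_barE : Omega_bar x = [set p | SG p /\ 1 - x <= p.2].
Proof.
apply/seteqP; split => [p [[h1 h2]|[h1 h2]]|p [h1]].
- by split => //; exact: ltW.
- by split => //; rewrite h2.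
by rewrite le_eqVlt => /orP[/eqP h|h]; [right|left].
Qed.

Lemma Omega_bar_SG : Omega_bar x `<=` SG.
Proof. by rewrite Omega_barE => p []. Qed.

Lemma Omega_sub_bar : Omega x `<=` Omega_bar x.
Proof. by move=> p; left. Qed.

Lemma Omega_bar_compact : compact (Omega_bar x).
Proof.
rewrite Omega_barE; apply: (@compact_closedI _ SG); first exact: SG_compact.
apply: (@preimage_closed _ _ (fun p : R * R => p.2) [set t | 1 - x <= t]).
  by move=> p _; exact: cvg_snd.
exact: closed_ge.
Qed.

Hypotheses (x_gt0 : 0 < x) (x_lt1 : x < 1) (x_nd : ~ dyadic x).

Lemma inside_height w : inside x w -> 1 - x < 1 - ((row w)%:R + 1) / 2 ^+ size w.
Proof.
rewrite /inside => h; rewrite ltrD2l ltrN2 ltr_pdivrMr ?exprn_gt0 // mulrC.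
have [h1 _] := flo_lt x_gt0 x_lt1 x_nd (size w).
by apply: le_lt_trans h1; rewrite natr1 ler_nat.
Qed.

Lemma crossing_height w : crossing x w ->
  1 - x < 1 - (row w)%:R / 2 ^+ size w /\
  1 - (row w)%:R / 2 ^+ size w < 1 - x + (2 ^+ size w)^-1.
Proof.
rewrite /crossing => /eqP ->; have [h1 h2] := flo_lt x_gt0 x_lt1 x_nd (size w).
have p : 0 < 2 ^+ size w :> R by rewrite exprn_gt0.
rewrite ltrD2l ltrN2 ltr_pdivrMr // [x * _]mulrC; split => //.
have : x < (flo x (size w)).+1%:R / 2 ^+ size w by rewrite ltr_pdivlMr // mulrC.
by rewrite -natr1 mulrDl mul1r; lra.
Qed.

Lemma outside_height w : ~~ inside x w -> ~~ crossing x w ->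
  1 - (row w)%:R / 2 ^+ size w < 1 - x.
Proof.
rewrite /crossing /inside => h1 h2.
have h : (flo x (size w) < row w)%N by lia.
have [_ h3] := flo_lt x_gt0 x_lt1 x_nd (size w).
rewrite ltrD2l ltrN2 ltr_pdivlMr ?exprn_gt0 // mulrC.
by apply: lt_le_trans h3 _; rewrite ler_nat.
Qed.

Lemma Fword_top w : (Fword w (q ord0) : R * R).2 = 1 - (row w)%:R / 2 ^+ size w.
Proof. by rewrite height_Fword /q /=; congr (1 - _ / _); lra. Qed.

Lemma Fword_bottom w i : i != ord0 ->
  (Fword w (q i) : R * R).2 = 1 - ((row w)%:R + 1) / 2 ^+ size w.
Proof.
move=> ni; rewrite height_Fword; congr (1 - _ / _).
by elim/ord3P: i ni => // _; rewrite /q /=; lra.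
Qed.

Lemma inside_cell w : inside x w -> cell w `<=` Omega x.
Proof.
move=> h p wp; split; first exact: cell_SG wp.
case: wp => p' hp' <-; apply: lt_le_trans (inside_height h) _.
rewrite height_Fword lerD2l lerN2 ler_pM2r ?invr_gt0 ?exprn_gt0 //.
by have /andP[] := height_bounds hp'; lra.
Qed.

Lemma cell_inside w : cell w `<=` Omega x -> inside x w.
Proof.
move=> h; have [_] := h _ (cell_q w o1); rewrite Fword_bottom // => hb.
rewrite /inside; have [_ h2] := flo_lt x_gt0 x_lt1 x_nd (size w).
move: hb; rewrite ltrD2l ltrN2 ltr_pdivrMr ?exprn_gt0 // mulrC natr1 => hb.
by have := lt_trans hb h2; rewrite ltr_nat.
Qed.

Lemma inside_q w i : inside x w -> Omega x (Fword w (q i)).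
Proof. by move=> h; apply: (inside_cell h); exact: cell_q. Qed.

Lemma crossing_top w : crossing x w -> Omega x (Fword w (q ord0)).
Proof.
move=> h; split; first by apply: SG_Fword; exact: SG_q.
by rewrite Fword_top; have [] := crossing_height h.
Qed.

Lemma Omega_bar_cell w p : Omega_bar x p -> cell w p -> inside x w \/ crossing x w.
Proof.
rewrite Omega_barE => -[_ h] [p' hp' e].
have [|ni] := boolP (inside x w); first by left.
have [|nc] := boolP (crossing x w); first by right.
exfalso; have := outside_height ni nc; move: h.
rewrite -e height_Fword; have : 0 <= (1 - p'.2) / 2 ^+ size w.
  by rewrite divr_ge0 ?exprn_ge0 // subr_ge0; have /andP[] := height_bounds hp'.
by rewrite -addrA mulrDl; lra.
Qed.

(** A crossing cell of size n rises less than 2^-n above the line, and a continuous function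
    vanishing on the line is uniformly small on such strips. *)
Lemma top_near_line (v : R * R -> R) (e : R) : {within Omega_bar x, continuous v} ->
  (forall p, Sline x p -> v p = 0) -> 0 < e ->
  exists N, forall w p, (N <= size w)%N -> crossing x w -> cell w p ->
    Omega_bar x p -> `|v p| < e.
Proof.
move=> cv v0 e0.
have [||d d0 hd] := @near_zero_set _ (Omega_bar x) (Sline x) v e
  (fun p => p.2 - (1 - x)) Omega_bar_compact cv
  (fun p => cvgB cvg_snd (cvg_cst _)) _ _ v0 e0.
- by rewrite Omega_barE => p [h1 h2]; rewrite subr_ge0.
- by rewrite Omega_barE => p [h1 h2] h; split => //; lra.
have [N hN] := half_pow_lt d0; exists N => w p sw cw [p' hp' ep] op.
  apply: hd => //; have [_ h] := crossing_height cw.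
  have := hN _ sw; rewrite exprVn; have : 0 < (2 ^+ size w)^-1 :> R.
    by rewrite invr_gt0 exprn_gt0.
  have : 0 <= (1 - p'.2) / 2 ^+ size w.
    by rewrite divr_ge0 ?exprn_ge0 // subr_ge0; have /andP[] := height_bounds hp'.
  by rewrite -ep height_Fword -addrA mulrDl; lra.
Qed.

(** The flux of [u] through the line is constant from level [n] on, while the values of [v] at the
    tops of the crossing cells tend uniformly to 0. *)
Lemma Bd_cvg0 n u v : follows x n u -> {within Omega_bar x, continuous v} ->
  (forall p, Sline x p -> v p = 0) -> (fun N => Bd x N u v) @ \oo --> (0 : R).
Proof.
move=> f cv v0; apply/cvgrPdist_lt => e e0.
have F0 := flux_ge0 x_gt0 x_lt1 n u.
have e1 : 0 < e / (flux x n u + 1) by rewrite divr_gt0 //; lra.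
have [N hN] := top_near_line cv v0 e1.
exists (maxn N n) => // m /=; rewrite geq_max => /andP[Nm nm].
rewrite sub0r normrN.
have := @Bd_flux _ x x_gt0 x_lt1 m u v (e / (flux x n u + 1)) _.
rewrite (flux_follows x_gt0 x_lt1 nm f) => h; apply: le_lt_trans (h _) _.
  move=> w sw cw; apply/ltW/(hN w) => //; first by rewrite sw.
    exact: cell_q.
  by apply: Omega_sub_bar; exact: crossing_top.
by rewrite mulrAC ltr_pdivrMr; [rewrite ltr_pM2l //; lra|lra].
Qed.

Lemma En_cvg_follows n u v : follows x n u -> {within Omega_bar x, continuous v} ->
  (forall p, Sline x p -> v p = 0) -> (fun N => En x N u v) @ \oo --> Eh x n u v.
Proof.
move=> f cv v0; have h := Bd_cvg0 f cv v0.
have : (fun N => Eh x n u v - Bd x N u v) @ \oo --> (Eh x n u v - 0 : R).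
  by apply: cvgB => //; exact: cvg_cst.
rewrite subr0; apply: cvg_trans; apply: near_eq_cvg.
exists n => // N /= nN; rewrite -(Eh_follows x_gt0 x_lt1 v nN f) EhE; ring.
Qed.

End Omega.

(** * Harmonic functions *)

Section GraphForms.
Context {R : realType}.
Implicit Types (w : seq 'I_3) (u v : R * R -> R) (P : pred (seq 'I_3)) (n : nat).

Lemma big_words_tuple (V : nmodType) n (P : pred (seq 'I_3)) (F : seq 'I_3 -> V) :
  \sum_(w : n.-tuple 'I_3 | P w) F w = \sum_(w <- words n | P w) F w.
Proof.
rewrite -[LHS](big_map val P F) /index_enum -enumT; apply: perm_big.
apply: uniq_perm; rewrite ?words_uniq // ?(map_inj_uniq val_inj) ?enum_uniq //.
move=> w; rewrite mem_words; apply/mapP/eqP => [[t _ ->]|sw].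
  by rewrite size_tuple.
by exists (Tuple (introT eqP sw)) => //; rewrite mem_enum.
Qed.

Lemma graph_energyE (D : set (R * R)) n u :
  graph_energy D n u = gform (fun w => `[< cell w `<=` D >]) n u u.
Proof.
rewrite /graph_energy /gform -mulr_sumr; congr (_ * _).
rewrite (@big_words_tuple _ n (fun w => `[< cell w `<=` D >]) (fun w => \sum_(i : 'I_3)
  \sum_(j : 'I_3 | (i < j)%N) (u (Fword w (q i)) - u (Fword w (q j))) ^+ 2)).
apply: eq_bigr => w _; under eq_bigr do rewrite big_mkcond big_ord3.
by rewrite big_ord3 /= /tri /vx; ring.
Qed.

(** Graph energies increase with the level, so a limit 0 forces each of them to vanish, and with it
    every cell term. *)
Lemma gform_zero P n0 (lv : nat -> nat) u w i j :
  (forall w i, (n0 <= size w)%N -> P w -> P (rcons w i)) ->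
  (forall m, (m <= lv m)%N) ->
  (fun m => gform P (lv m) u u) @ \oo --> (0 : R) ->
  (n0 <= size w)%N -> P w -> vx u w i = vx u w j.
Proof.
move=> hP hlv h0 hw Pw; set n := size w.
have mono m : (n <= m)%N -> gform P n u u <= gform P m u u.
  move=> /subnK <-; elim: (m - n)%N => [|d ih]; first by rewrite add0n.
  apply: le_trans ih _; rewrite addSn; apply: gform_le_S => v k sv.
  by apply: hP; rewrite sv; apply: leq_trans hw (leq_addl _ _).
have z : gform P n u u <= 0.
  have cv : cvgn (fun m => gform P (lv m) u u) by apply/cvg_ex; exists 0.
  rewrite -[leRHS](cvg_lim _ h0) //; apply: limr_ge => //.
  by exists n => // m /= hm; apply: mono; exact: leq_trans hm (hlv _).
have p53 : 0 < (5 / 3) ^+ n :> R by apply: exprn_gt0; lra.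
have : (5 / 3) ^+ n * tri (vx u w) (vx u w) <= 0.
  apply: le_trans z; rewrite /gform big_mkcond (bigD1_seq w) ?words_uniq ?mem_words ?eqxx //=.
  rewrite Pw lerDl; apply: sumr_ge0 => v _; case: ifP => // _.
  by rewrite mulr_ge0 ?tri_ge0 // ltW.
rewrite pmulr_rle0 // /tri -!expr2 => h.
have := sqr_ge0 (vx u w ord0 - vx u w o1).
have := sqr_ge0 (vx u w ord0 - vx u w o2).
have := sqr_ge0 (vx u w o1 - vx u w o2) => a1 a2 a3.
have /eqP : (vx u w ord0 - vx u w o1) ^+ 2 = 0 by lra.
have /eqP : (vx u w ord0 - vx u w o2) ^+ 2 = 0 by lra.
rewrite !sqrf_eq0 !subr_eq0 => /eqP e1 /eqP e2.
by elim/ord3P: i; elim/ord3P: j; congruence.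
Qed.

End GraphForms.

Section Harmonic.
Context {R : realType}.
Variables (D : set (R * R)) (lv : nat -> nat) (Y B : set (R * R)).
Implicit Types (u v phi : R * R -> R).

Local Notation gf := (gform (fun w => `[< cell w `<=` D >])).

(** The mixed form is tested against every continuous [v], whose own energy may diverge. This is
    what subdivision gives directly, and it allows testing with a difference not yet known to have
    finite energy. *)
Definition strongly_harmonic phi := edom D lv Y phi /\
  forall v, {within Y, continuous v} -> (forall p, B p -> v p = 0) ->
  (fun m => gf (lv m) phi v) @ \oo --> (0 : R).

Lemma energy_ge u c (l : R) :
  (fun m => gf (lv m) u u) @ \oo --> l -> c = u -> energy D lv c = l.
Proof.
move=> h ->; apply: cvg_lim => //; apply: cvg_trans h.
by under eq_fun do rewrite graph_energyE.
Qed.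

Lemma finite_energyP u : finite_energy D lv u <->
  exists l : R, (fun m => gf (lv m) u u) @ \oo --> l.
Proof.
rewrite /finite_energy; under eq_fun do rewrite graph_energyE.
by split => /cvg_ex.
Qed.

Lemma within_lin (A : set (R * R)) u v (c : R) : {within A, continuous u} ->
  {within A, continuous v} -> {within A, continuous (fun p => u p + c * v p)}.
Proof.
move=> cu cv p; apply: cvgD; first exact: cu.
by apply: cvgM; [exact: cvg_cst|exact: cv].
Qed.

Let lin_cvg u v (c a b d : R) : (fun m => gf (lv m) u u) @ \oo --> a ->
  (fun m => gf (lv m) u v) @ \oo --> b -> (fun m => gf (lv m) v v) @ \oo --> d ->
  (fun m => gf (lv m) (fun p => u p + c * v p) (fun p => u p + c * v p)) @ \oo
    --> a + 2 * c * b + c ^+ 2 * d.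
Proof.
move=> ha hb hd; under eq_fun do rewrite gform_sqr.
by apply: cvgD; [apply: cvgD => //|]; apply: cvgM => //; exact: cvg_cst.
Qed.

Lemma strongly_harmonicP phi : strongly_harmonic phi -> harmonic_off D lv Y B phi.
Proof.
move=> [ephi h]; split => // v [[cv /finite_energyP[d hd]] v0].
have [_ /finite_energyP[a ha]] := ephi; have hb := h v cv v0.
rewrite /energy_form (energy_ge (@lin_cvg _ _ 1 _ _ _ ha hb hd)); last first.
  by apply/funext => p /=; rewrite mul1r.
rewrite (energy_ge (@lin_cvg _ _ (-1) _ _ _ ha hb hd)); last first.
  by apply/funext => p /=; rewrite mulN1r.
by rewrite !mulr0 sqrrN subrr mul0r.
Qed.

Lemma harmonic_difference phi phi' : strongly_harmonic phi ->
  harmonic_off D lv Y B phi' -> (forall p, B p -> phi' p = phi p) ->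
  (fun m => gf (lv m) (phi' \- phi) (phi' \- phi)) @ \oo --> (0 : R).
Proof.
move=> [[cphi /finite_energyP[a ha]] h] [[cphi' /finite_energyP[a' ha']] h'] eB.
pose d := phi' \- phi.
have cd : {within Y, continuous d}.
  have -> : d = fun p => phi' p + (-1) * phi p by apply/funext => p; rewrite mulN1r.
  exact: within_lin.
have d0 p : B p -> d p = 0 by move=> /eB; rewrite /d /= => ->; rewrite subrr.
have hb := h d cd d0.
(* The expansion of the energy of [phi + d] shows that the energies of [d] converge; only then is
   [d] an admissible test function for [phi']. *)
have hd : (fun m => gf (lv m) d d) @ \oo --> a' - a - 2 * 0.
  have -> : (fun m => gf (lv m) d d) =
      fun m => gf (lv m) phi' phi' - gf (lv m) phi phi - 2 * gf (lv m) phi d.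
    apply/funext => m; have -> : phi' = fun p => phi p + 1 * d p.
      by apply/funext => p; rewrite /d /=; ring.
    by rewrite gform_sqr; ring.
  by apply: cvgB; [exact: cvgB|apply: cvgM => //; exact: cvg_cst].
have ed : edom0 D lv Y B d by do 2!split => //; apply/finite_energyP; exists (a' - a - 2 * 0).
have := h' d ed.
(* Here [phi' + d] is [phi + 2 d] and [phi' - d] is [phi], so the tested form equals the energy of
   [d]. *)
rewrite /energy_form (energy_ge (@lin_cvg _ _ 2 _ _ _ ha hb hd)); last first.
  by apply/funext => p; rewrite /d /=; ring.
rewrite (energy_ge ha); last by apply/funext => p; rewrite /d /=; ring.
move=> e; have e2 : a' - a - 2 * 0 = 0 by lra.
by rewrite e2 in hd.
Qed.

End Harmonic.

Section MidpointUniqueness.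
Context {R : realType}.
Implicit Types (w : seq 'I_3) (i j k : 'I_3).

Lemma bary_mpt j k : bary j (mpt k : R * R) = (j != k)%:R / 2.
Proof.
elim/ord3P: k; rewrite /mpt /= bary_F bary_q; elim/ord3P: j => /=; lra.
Qed.

Lemma mpt_neq_q k i : mpt k <> q i :> R * R.
Proof.
move=> e; have := bary_mpt i k; rewrite e bary_q eqxx.
by case: (i != k) => /=; lra.
Qed.

(** Distinct cells of equal size meet only at corners, and a midpoint is not a corner of its own
    cell. *)
Lemma mid_cell w w' k : size w = size w' -> cell w' (mid w k : R * R) -> w = w'.
Proof.
move=> hs h; apply/eqP/negP => /negP ne.
have [i [j [e _]]] := cell_meet hs ne (@cell_mid R w k) h.
by move/Fword_inj: e; exact: mpt_neq_q.
Qed.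

Lemma mid_inj w w' k k' : size w = size w' -> mid w k = mid w' k' :> R * R ->
  w = w' /\ k = k'.
Proof.
move=> hs e; have ew : w = w'.
  by apply: (mid_cell (k := k) hs); rewrite e; exact: cell_mid.
split => //; move: e; rewrite ew => /Fword_inj e.
apply/eqP; have := bary_mpt k' k; rewrite e bary_mpt eqxx eq_sym /=.
by case: (k == k') => //=; lra.
Qed.

Lemma V_word n (t : R * R) : V n t <-> exists w i, size w = n /\ t = Fword w (q i).
Proof.
elim: n t => [|n ih] t /=.
  split => [[i _ <-]|[[|k w] [i [// _ ->]]]]; first by exists [::], i.
  by exists i.
split => [[i _ [t' /ih[w [j [sw ->]]] <-]]|[[|i w] [j [// [sw] ->]]]].
  by exists (i :: w), j; rewrite /= sw.
by exists i => //; exists (Fword w (q j)) => //; apply/ih; exists w, j.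
Qed.

End MidpointUniqueness.

(** * Identification of the splines *)

Section TPoints.
Context {R : realType}.
Variable x : R.
Hypotheses (x_gt0 : 0 < x) (x_lt1 : x < 1) (x_nd : ~ dyadic x).
Implicit Types (w : seq 'I_3) (i j k : 'I_3).

(** Crossing words are dictated by the digits: the letter [ord0] at a digit 0, one of the two others
    at a digit 1. At level [nexp x l] they are therefore the words [tword x om]. *)
Lemma crossing_nth w m : crossing x w -> (m < size w)%N ->
  (nth ord0 w m != ord0) = digit x m.
Proof.
move=> c hm; have st : size (take m w) = m by rewrite size_takel // ltnW.
have c1 : crossing x (rcons (take m w) (nth ord0 w m)).
  by rewrite -take_nth //; apply: (crossing_prefix (v := drop m.+1 w)); rewrite cat_take_drop.
have [e|ne] := eqVneq (nth ord0 w m) ord0.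
  by move: c1; rewrite e crossing_rcons0 st => /andP[_ /negbTE ->].
by move: c1; rewrite crossing_rcons // st => /andP[_ ->].
Qed.

Lemma digit_between l m : (nexp x l <= m)%N -> (m.+1 < nexp x l.+1)%N ->
  digit x m = false.
Proof.
move=> h1 h2; have e : lev x m = l by apply: lev_uniq => //; rewrite h1 ltnW.
by rewrite /digit e ltn_eqF.
Qed.

Lemma crossing_nseq w d : crossing x w ->
  (forall m, (size w <= m < size w + d)%N -> digit x m = false) ->
  crossing x (w ++ nseq d ord0).
Proof.
move=> c; elim: d => [|d ih] h; first by rewrite cats0.
rewrite -[X in nseq X _]addn1 nseqD catA cats1 crossing_rcons0 ih /=; last first.
  by move=> m /andP[h1 h2]; apply: h; rewrite h1 /= addnS ltnW.
by rewrite size_cat size_nseq h // leq_addr /= addnS.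
Qed.

Lemma tword_rcons om i : tword x (rcons om i) = tword x om ++
  rcons (nseq (nexp x (size om).+1 - nexp x (size om) - 1) ord0) i.
Proof.
rewrite /tword size_rcons -[X in iota 0 X]addn1 iotaD map_cat flatten_cat add0n /= cats0 nth_rcons.
rewrite ltnn eqxx; congr (flatten _ ++ _).
apply/eq_in_map => j; rewrite mem_iota add0n => /andP[_ hj].
by rewrite nth_rcons hj.
Qed.

Lemma tword_crossing om : all (fun i => i != ord0) om ->
  crossing x (tword x om) /\ size (tword x om) = nexp x (size om).
Proof.
elim/last_ind: om => [|om i ih]; first by rewrite /tword /= nexp0.
rewrite all_rcons => /andP[i0 /ih[c s]].
have hS := nexpS x_gt0 x_lt1 (size om).
have c' : crossing x (tword x om ++
    nseq (nexp x (size om).+1 - nexp x (size om) - 1) ord0).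
  apply: crossing_nseq => // m; rewrite s => /andP[h1 h2].
  by apply: (digit_between h1); lia.
rewrite tword_rcons -rcons_cat crossing_rcons // c' !(size_rcons, size_cat, size_nseq).
rewrite s; split; last by lia.
have -> : (nexp x (size om) + (nexp x (size om).+1 - nexp x (size om) - 1) =
  (nexp x (size om).+1).-1)%N by lia.
exact: digit_nexp.
Qed.

Lemma crossing_tword w l : crossing x w -> size w = nexp x l ->
  exists om, [/\ size om = l, all (fun i => i != ord0) om & tword x om = w].
Proof.
elim: l w => [|l ih] w c.
  by rewrite nexp0 // => /size0nil ->; exists [::].
have hS := nexpS x_gt0 x_lt1 l.
case/lastP: w c => [|w i] c; rewrite ?size_rcons => /= sw; first by lia.
have c1 : crossing x w by apply: (crossing_prefix (v := [:: i])); rewrite cats1.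
have i0 : i != ord0.
  have := crossing_nth c (m := size w); rewrite nth_rcons ltnn eqxx size_rcons leqnn.
  by move=> ->//; rewrite (_ : size w = (nexp x l.+1).-1) ?digit_nexp //; lia.
have st : size (take (nexp x l) w) = nexp x l by rewrite size_takel //; lia.
have [om [so ao to]] := ih (take (nexp x l) w)
  (crossing_prefix (eq_ind_r (crossing x) c1 (cat_take_drop _ w))) st.
exists (rcons om i); rewrite size_rcons so all_rcons i0 ao; split => //.
rewrite tword_rcons so to -rcons_cat; congr rcons.
rewrite -[RHS](cat_take_drop (nexp x l) w); congr (_ ++ _).
apply: (@eq_from_nth _ ord0); first by rewrite size_nseq size_drop; lia.
move=> m; rewrite size_nseq => hm; rewrite nth_nseq hm nth_drop.
have hml : (nexp x l + m < size w)%N by lia.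
have := crossing_nth c1 hml; rewrite (@digit_between l) ?leq_addr //; last by lia.
by move=> /negbFE /eqP ->.
Qed.

Lemma mid_top w k : k != ord0 -> mid w k = Fword (rcons w (opp k ord0)) (q ord0) :> R * R.
Proof.
move=> k0; rewrite mid_Fword; last by elim/ord3P: k k0 => //; rewrite oppE.
by congr mid; elim/ord3P: k k0 => //; rewrite !oppE.
Qed.

Lemma mid_T w k : crossing x w -> digit x (size w) -> k != ord0 ->
  T x (lev x (size w)).+1 (mid w k) /\ (size w).+1 = nexp x (lev x (size w)).+1.
Proof.
move=> c d k0; have e := eqP d; split => //.
have i0 : opp k ord0 != ord0 by elim/ord3P: k k0 => //; rewrite oppE.
have c1 : crossing x (rcons w (opp k ord0)) by rewrite crossing_rcons // c d.
have [|om [so ao to]] := @crossing_tword _ (lev x (size w)).+1 c1.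
  by rewrite size_rcons.
by exists om; split => //; rewrite to mid_top.
Qed.

Lemma T_level w k l : (0 < l)%N -> T x l (mid w k) -> (size w).+1 = nexp x l ->
  crossing x w.
Proof.
move=> l0 [om [so ao e]] sw; have [c s] := tword_crossing ao.
rewrite so -sw in s; have st : size (take (size w) (tword x om)) = size w.
  by rewrite size_takel // s.
have ce : cell (take (size w) (tword x om)) (mid w k : R * R).
  by rewrite e; apply: cell_take; exact: cell_q.
have := mid_cell (esym st) ce => ->.
by apply: (crossing_prefix (v := drop (size w) (tword x om))); rewrite cat_take_drop.
Qed.

(** This decides which of the two kinds of spline [is_spline] demands at a given midpoint. *)
Lemma is_T_levelP w k : valid x w k -> is_T_level x (size w).+1 (mid w k) <-> crossing x w.
Proof.
move=> v; split => [[l [l0 e h]]|c]; first exact: T_level h e.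
move: v; rewrite /valid crossing_inside // c /= => /andP[d k0].
by have [h e] := mid_T c d k0; exists (lev x (size w)).+1.
Qed.

End TPoints.

Section CellEnergy.
Context {R : realType}.
Implicit Types (w : seq 'I_3) (u v : R * R -> R) (n : nat).

Lemma gform_cell w u v n :
  (forall w' k, (size w <= size w')%N -> u (mid w' k) = harm (vx u w') k) ->
  (size w <= n)%N -> gform (fun w' => `[< cell w' `<=` (cell w : set (R * R)) >]) n u v =
  (5 / 3) ^+ size w * tri (vx u w) (vx v w).
Proof.
move=> hu /subnK <-; have cw w' : (size w <= size w')%N ->
    `[< cell w' `<=` (cell w : set (R * R)) >] = (take (size w) w' == w).
  move=> hs; apply/asboolP/eqP => [h|e].
    exact: (@cell_sub_prefix R).
  by rewrite -[X in _ `<=` cell X]e; exact: cell_take.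
elim: (n - size w)%N => [|d ih].
  rewrite add0n /gform big_mkcond (bigD1_seq w) ?words_uniq ?mem_words //=.
  rewrite cw // take_size eqxx big1_seq ?addr0 // => w' /andP[ne].
  rewrite mem_words => /eqP s'; rewrite cw ?s' // take_oversize ?s' //.
  by rewrite (negbTE ne).
rewrite addSn -ih /gform big_mkcond big_wordsS [RHS]big_mkcond /=.
apply: eq_big_seq => w'; rewrite mem_words => /eqP s'.
have hs : (size w <= size w')%N by rewrite s' leq_addl.
have e i : `[< cell (rcons w' i) `<=` (cell w : set (R * R)) >] = (take (size w) w' == w).
  rewrite cw ?size_rcons ?(leq_trans hs) // -cats1 take_cat.
  by case: ltngtP hs => // -> _; rewrite subnn take0 cats0 take_size.
under eq_bigr do rewrite e !vx_rcons; rewrite cw //; case: ifP => _; last by rewrite big1.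
rewrite -mulr_sumr exprSr -mulrA tri_children.
rewrite (_ : tri_mid _ _ = 0) ?mulr0 ?addr0 //.
by rewrite /tri_mid /tri !hu // !subrr; ring.
Qed.

Lemma strongly_harmonic_cell K w u : size w = K ->
  (forall w' k, (K <= size w')%N -> u (mid w' k) = harm (vx u w') k) ->
  {within SG, continuous u} ->
  strongly_harmonic (cell w) id (cell w) (Fword w @` V 0) u.
Proof.
move=> <- hu cu.
have lim v : (fun m => gform (fun w' => `[< cell w' `<=` (cell w : set (R * R)) >]) m u v)
    @ \oo --> (5 / 3) ^+ size w * tri (vx u w) (vx v w).
  apply: cvg_near_cst.
  by exists (size w) => // m /= hm; rewrite gform_cell.
split; first split.
- exact: continuous_subspaceW (@cell_SG _ w) cu.
- by apply/finite_energyP; eexists; exact: lim.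
move=> v cv v0; have := lim v.
have z i : vx v w i = 0 by apply: v0; exists (q i) => //; exists i.
by rewrite /tri !z !subrr !mulr0 !addr0 mulr0.
Qed.

End CellEnergy.

Section SplineIdentification.
Context {R : realType}.
Variable x : R.
Hypotheses (x_gt0 : 0 < x) (x_lt1 : x < 1) (x_nd : ~ dyadic x).
Implicit Types (w : seq 'I_3) (i j k : 'I_3).

Section One.
Variables (w0 : seq 'I_3) (k0 : 'I_3).
Hypothesis vwk : valid x w0 k0.
Local Notation phi := (sp x w0 k0).
Local Notation z := (mid w0 k0 : R * R).
Local Notation K := (size w0).+1.

Let phi_z : phi z = 1.
Proof. by rewrite sp_mid // /Msp !eqxx. Qed.

Lemma sp_V t : V K t -> phi t = (t == z)%:R.
Proof.
move=> /V_word[w [j [+ ->]]]; case/lastP: w => [//|w i]; rewrite size_rcons => -[sw].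
have w0z : vx phi w = fun=> 0 by rewrite vx_sp0 // sw leqnn.
have -> : phi (Fword (rcons w i) (q j)) = vx phi (rcons w i) j by [].
rewrite vx_rcons /child w0z; have [->|ne] := eqVneq j i.
  case: eqP => // e; have := congr1 phi e; rewrite phi_z Fword_rcons Fmap_q.
  have -> : phi (Fword w (q i)) = vx phi w i by [].
  by rewrite w0z => /eqP; rewrite eq_sym oner_eq0.
rewrite eq_sym in ne; rewrite mid_Fword // sp_mid //.
have sz : sval (Msp x w0 k0) (fun=> 0) w = fun=> 0 by rewrite -vx_sp.
rewrite sz /Msp; case: eqP => [ew|nw].
  congr (nat_of_bool _)%:R; apply/eqP/eqP => [->|]; first by rewrite ew.
  by move/(mid_inj sw) => [].
rewrite Mx0; case: eqP => // /(mid_inj sw)[ew _].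
by case: nw.
Qed.

(** A point of the line lies in crossing cells of every size, since inside cells are strictly above
    it; their bottom corners carry the value 0, and the oscillation bound tends to 0. *)
Lemma sp_line p : Sline x p -> phi p = 0.
Proof.
move=> lp; have op : Omega_bar x p by right.
apply/eqP; rewrite -normr_le0; apply/ler_addgt0Pr => e e0; rewrite add0r.
have h0 := cvg_2dlt (osc_bound_cvg x_gt0 x_lt1 w0).
move/cvgrPdist_le: h0 => /(_ e e0) [N _ /(_ N (leqnn N))].
rewrite /= sub0r normrN => /(le_trans (ler_norm _)); apply: le_trans.
have [w [sw wp]] := SG_cell N lp.1.
have := subdiv_fun_close (osc_bound_cvg x_gt0 x_lt1 w0)
  (sv_osc_cat x_gt0 x_lt1 vwk) o1 wp.
have [iw|cw] := Omega_bar_cell x_gt0 x_lt1 x_nd op wp.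
  have [_] := inside_cell x_gt0 x_lt1 x_nd iw wp.
  by rewrite lp.2 ltxx.
have [h _ _] := sv_osc x_gt0 x_lt1 vwk w; have [bot _] := h cw.
by rewrite bot // subr0 sw.
Qed.

Lemma sp_follows : follows x K phi.
Proof.
move=> w k hw; rewrite dfct_sp //; case: eqP => //= e.
by move: hw; rewrite e ltnn.
Qed.

Lemma sp_continuous_bar : {within Omega_bar x, continuous phi}.
Proof.
exact: continuous_subspaceW (@Omega_bar_SG _ x) (sp_continuous x_gt0 x_lt1 vwk).
Qed.

(** There is no crossing cell within an inside one, and on the crossing cells elsewhere the spline
    is zero, so the rule [Mx] acts as [harm] throughout. *)
Lemma sp_harm : inside x w0 -> forall w k, (K <= size w)%N ->
  phi (mid w k) = harm (vx phi w) k.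
Proof.
move=> iw w k hw; have := sp_follows k hw; rewrite /dfct /Mx => /eqP.
rewrite subr_eq0 => /eqP ->; case: ifP => // cw.
have ne : take (size w0) w != w0.
  apply/eqP => e; have c0 : crossing x w0.
    apply: (crossing_prefix (v := drop (size w0) w)).
    by rewrite -[X in X ++ _]e cat_take_drop.
  by move: iw; rewrite crossing_inside.
by rewrite vx_sp0 ?ne ?orbT //= mulr0 if_same /harm; lra.
Qed.

Lemma sp_gasket : inside x w0 -> is_gasket_spline K z phi.
Proof.
move=> iw; split; [exact: sp_continuous|exact: sp_V|move=> w sw].
apply: strongly_harmonicP; exact: (strongly_harmonic_cell sw (sp_harm iw)
  (sp_continuous x_gt0 x_lt1 vwk)).
Qed.

Lemma gasket_uniq phi' p : inside x w0 -> is_gasket_spline K z phi' -> SG p ->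
  phi' p = phi p.
Proof.
move=> iw [c' V' h'] hp; have [w [sw wp]] := SG_cell K hp.
have st := strongly_harmonic_cell sw (sp_harm iw) (sp_continuous x_gt0 x_lt1 vwk).
have eB t : (Fword w @` V 0) t -> phi' t = phi t.
  move=> [_ [i _ <-] <-]; have hV : V K (Fword w (q i) : R * R) by apply/V_word; exists w, i.
  by rewrite V' // sp_V.
have h0 := harmonic_difference st (h' w sw) eB.
have hcl u k : (size w <= size u)%N -> `[< cell u `<=` (cell w : set (R * R)) >] ->
    `[< cell (rcons u k) `<=` (cell w : set (R * R)) >].
  move=> hu /asboolP hs; apply/asboolP => t ht; apply: hs.
  by rewrite -cats1 in ht; exact: cell_catS ht.
have cst v i j := @gform_zero R (fun v => `[< cell v `<=` cell w >])
  (size w) id (phi' \- phi) v i j hcl (fun=> leqnn _) h0.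
have d0 v i : vx (phi' \- phi) (w ++ v) i = 0.
  elim/last_ind: v i => [|v k ih] i.
    rewrite cats0 /vx /= eB ?subrr //; exists (q i) => //; by exists i.
  rewrite -rcons_cat (cst _ i k).
  - by rewrite vx_rcons /child eqxx ih.
  - by rewrite size_rcons size_cat -addnS leq_addr.
  - by rewrite rcons_cat; apply/asboolP; exact: cell_catS.
apply/eqP; rewrite -subr_eq0; apply/eqP/esym/le_anti.
apply: (@cell_hull _ (cell w) (phi' \- phi) w) => //.
  have -> : phi' \- phi = fun p => phi' p + (-1) * phi p by apply/funext => t; rewrite mulN1r.
  apply: continuous_subspaceW (@cell_SG _ w) _; apply: within_lin => //.
  exact: sp_continuous.
by move=> v i; have := d0 v i; rewrite /vx => ->; rewrite lexx.
Qed.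

Lemma gformO n u v : gform (fun w => `[< cell w `<=` Omega x >]) n u v = En x n u v.
Proof.
apply: eq_bigl => w; apply/asboolP/idP; first exact: cell_inside.
exact: inside_cell.
Qed.

Lemma nexp_ge m : (m <= nexp x m)%N.
Proof. by elim: m => // m ih; apply: leq_ltn_trans ih (nexpS x_gt0 x_lt1 m). Qed.

Lemma cvg_nexp (f : nat -> R) (l : R) : f @ \oo --> l ->
  (fun m => f (nexp x m)) @ \oo --> l.
Proof.
apply: cvg_comp => A [N _ hN]; exists N => // m /= hm; apply: hN => /=.
exact: leq_trans hm (nexp_ge m).
Qed.

Lemma Eh_V0 n u v : (forall t, (V n `&` Omega x) t -> v t = 0) -> Eh x n u v = 0.
Proof.
move=> h; rewrite /Eh big1_seq // => w /andP[_]; rewrite mem_words => /eqP sw.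
have hV i : V n (Fword w (q i) : R * R) by apply/V_word; exists w, i.
rewrite /eh; case: ifP => [iw|_].
  have z i : vx v w i = 0 by apply: h; split => //; exact: inside_q.
  by rewrite /tri !z !subrr !mulr0 !addr0 mulr0.
case: ifP => // cw; rewrite (_ : vx v w ord0 = 0) ?mulr0 //.
by apply: h; split => //; exact: crossing_top.
Qed.

Lemma sp_strongly : strongly_harmonic (Omega x) (nexp x) (Omega_bar x)
  (bdOmega x `|` (V K `&` Omega x)) phi.
Proof.
have key v : {within Omega_bar x, continuous v} -> (forall p, Sline x p -> v p = 0) ->
    (fun m => gform (fun w => `[< cell w `<=` Omega x >]) (nexp x m) phi v) @ \oo
    --> Eh x K phi v.
  move=> cv v0; under eq_fun do rewrite gformO.
  apply: (@cvg_nexp (fun m => En x m phi v)).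
  exact: (En_cvg_follows x_gt0 x_lt1 x_nd sp_follows).
split; first split.
- exact: sp_continuous_bar.
- apply/finite_energyP; exists (Eh x K phi phi); apply: key.
    exact: sp_continuous_bar.
  exact: sp_line.
move=> v cv v0; rewrite -(@Eh_V0 K phi v); last by move=> t ht; apply: v0; right.
by apply: key => // p hp; apply: v0; left; right.
Qed.

Lemma sp_boundary : is_boundary_spline x K z phi.
Proof.
split => //.
- by move=> t [ht _] /eqP /negbTE ne; rewrite sp_V // ne.
- exact: sp_line.
- exact/strongly_harmonicP/sp_strongly.
Qed.

(** Zero energy makes [d] constant on each inside cell. The value 0 at [q ord0] then spreads
    downwards: a child keeps a corner of its parent, and the top of a new crossing cell is a corner
    of its inside sibling. *)
Lemma zero_energy_zero (d : R * R -> R) : {within Omega_bar x, continuous d} ->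
  d (q ord0) = 0 -> (forall p, Sline x p -> d p = 0) ->
  (fun m => En x (nexp x m) d d) @ \oo --> (0 : R) ->
  forall p, Omega_bar x p -> d p = 0.
Proof.
move=> cd dq dS h0.
have cst w i j : inside x w -> vx d w i = vx d w j.
  apply: (@gform_zero R (inside x) 0 (nexp x)) => //.
    by move=> v k _; exact: inside_rcons.
  exact: nexp_ge.
have zer w : (crossing x w -> vx d w ord0 = 0) /\ (inside x w -> forall i, vx d w i = 0).
  elim/last_ind: w => [|w i [ihc ihi]]; first by split.
  have [iw|ni] := boolP (inside x w).
    split; first by rewrite inside_not_crossing // inside_rcons.
    by move=> h j; rewrite (cst _ j i) // vx_rcons /child eqxx ihi.
  have [cw|nc] := boolP (crossing x w); last first.
    split.
      by move=> c; case/negP: nc; apply: (crossing_prefix (v := [:: i])); rewrite cats1.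
    have [->|i0] := eqVneq i ord0; first by rewrite inside_rcons0N // (negbTE ni).
    by rewrite inside_rconsN // (negbTE ni).
  have z0 : digit x (size w) -> forall j, vx d (rcons w ord0) j = 0.
    move=> dg j; rewrite (cst _ j ord0) ?inside_rcons0 //.
    by rewrite vx_rcons /child eqxx ihc.
  have [->|i0] := eqVneq i ord0.
    split=> [_|]; first by rewrite vx_rcons /child eqxx ihc.
    by rewrite inside_rcons0.
  split; last by rewrite inside_rconsN // (negbTE ni).
  rewrite crossing_rcons // cw /= => dg; have := z0 dg i.
  by rewrite !vx_rcons /child (negbTE i0) eq_sym (negbTE i0) oppC.
move=> p op; case: (op) => [[hp hh]|]; last exact: dS.
have [N hN] := half_pow_lt (ltac:(lra) : 0 < p.2 - (1 - x)).
have [w [sw wp]] := SG_cell N hp.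
have iw : inside x w.
  have [//|cw] := Omega_bar_cell x_gt0 x_lt1 x_nd op wp; exfalso.
  have [_ h] := crossing_height x_gt0 x_lt1 x_nd cw.
  have [p' hp' ep] := wp; have := hN N (leqnn N).
  have : 0 <= (1 - p'.2) / 2 ^+ size w.
    by rewrite divr_ge0 ?exprn_ge0 // subr_ge0; have /andP[] := height_bounds hp'.
  have : 0 < (2 ^+ size w)^-1 :> R by rewrite invr_gt0 exprn_gt0.
  by rewrite -ep height_Fword -addrA mulrDl exprVn -sw; lra.
apply/esym/le_anti; apply: (@cell_hull _ (Omega_bar x) d w) => //.
  by move=> t /(inside_cell x_gt0 x_lt1 x_nd iw); left.
move=> v i; have [_ h] := zer (w ++ v); have := h (inside_cat v iw) i.
by rewrite /vx => ->; rewrite lexx.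
Qed.

Lemma boundary_uniq phi' p : is_boundary_spline x K z phi' ->
  Omega_bar x p -> phi' p = phi p.
Proof.
move=> [z' V' S' h'] op.
have hO : forall t, (V K `&` Omega x) t -> phi' t = phi t.
  move=> t [Vt Ot]; have [->|/eqP ne] := eqVneq t z; first by rewrite z' phi_z.
  by rewrite V' // sp_V //; move/eqP/negbTE: ne => ->.
have hq : phi' (q ord0) = phi (q ord0).
  apply: hO; split.
    apply/V_word; exists (nseq K ord0), ord0; rewrite size_nseq; split => //.
    by rewrite -[nseq K _]cat0s Fword_nseq.
  by split; [exact: SG_q|rewrite /q /= gtrBl].
have := harmonic_difference sp_strongly h'.
have /[swap]/[apply] : forall t, (bdOmega x `|` (V K `&` Omega x)) t -> phi' t = phi t.
  by move=> t [[->|lt]|]; [|rewrite S' // sp_line|exact: hO].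
under eq_fun do rewrite gformO; move=> h0.
have := zero_energy_zero _ _ _ h0 op => h.
apply/eqP; rewrite -subr_eq0; apply/eqP/h.
- have -> : phi' \- phi = fun p => phi' p + (-1) * phi p by apply/funext => t; rewrite mulN1r.
  by apply: within_lin; [case: h' => -[]|exact: sp_continuous_bar].
- by rewrite /= hq subrr.
- by move=> t lt; rewrite /= S' // sp_line // subrr.
Qed.

Lemma spline_sp p : Omega_bar x p -> spline x K z p = phi p.
Proof.
move=> op; have T := is_T_levelP x_gt0 x_lt1 vwk.
have [cw|nc] := boolP (crossing x w0).
  have ex : is_spline x K z phi by split => [_|[]]; [exact: sp_boundary|exact/T].
  have [h _] : is_spline x K z (spline x K z) by exact: xgetPex (ex_intro _ _ ex).
  by apply: boundary_uniq => //; apply: h; exact/T.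
have iw : inside x w0 by move: vwk; rewrite /valid (negbTE nc) orbF.
have nT : ~ is_T_level x K z by move/T => c; rewrite c in nc.
have ex : is_spline x K z phi by split => // _; exact: sp_gasket.
have [_ h] : is_spline x K z (spline x K z) by exact: xgetPex (ex_intro _ _ ex).
exact: (gasket_uniq iw (h nT) (Omega_bar_SG op)).
Qed.

End One.
End SplineIdentification.

(** * Convergence of the Green function *)

Section NewVertices.
Context {R : realType}.
Variable x : R.
Hypotheses (x_gt0 : 0 < x) (x_lt1 : x < 1) (x_nd : ~ dyadic x).
Implicit Types (w v : seq 'I_3) (i j k l : 'I_3).

Lemma V_S n : V n `<=` (V n.+1 : set (R * R)).
Proof.
move=> t /V_word[w [i [sw ->]]]; apply/V_word; exists (w ++ [:: i]), i.
by rewrite size_cat sw addn1 Fword_q.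
Qed.

Lemma V_le m n : (m <= n)%N -> V m `<=` (V n : set (R * R)).
Proof.
move=> /subnK <-; elim: (n - m)%N => [//|d ih] t /ih; rewrite addSn; exact: V_S.
Qed.

Lemma mid_V w k : V (size w).+1 (mid w k : R * R).
Proof.
apply/V_word; rewrite /mid /mpt; elim/ord3P: k => /=.
- by exists (rcons w o1), o2; rewrite size_rcons Fword_rcons.
- by exists (rcons w o2), ord0; rewrite size_rcons Fword_rcons.
- by exists (rcons w o1), ord0; rewrite size_rcons Fword_rcons.
Qed.

Lemma mid_notV w k : ~ V (size w) (mid w k : R * R).
Proof.
move=> /V_word[v [i [sv e]]].
have ev : w = v by apply: (@mid_cell R w v k (esym sv)); rewrite e; exact: cell_q.
by move: e; rewrite ev => /Fword_inj; exact: mpt_neq_q.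
Qed.

Lemma mid_size w w' k k' : mid w k = mid w' k' :> R * R -> size w = size w'.
Proof.
move=> e; have [h|h|//] := ltngtP (size w) (size w'); exfalso.
  by apply: (@mid_notV w' k'); rewrite -e; exact: V_le h _ (mid_V w k).
by apply: (@mid_notV w k); rewrite e; exact: V_le h _ (mid_V w' k').
Qed.

Lemma bottom_inside w i : i != ord0 -> Omega x (Fword w (q i)) -> inside x w.
Proof.
move=> i0 [_]; rewrite Fword_bottom // => hb.
rewrite /inside; have [_ h2] := flo_lt x_gt0 x_lt1 x_nd (size w).
move: hb; rewrite ltrD2l ltrN2 ltr_pdivrMr ?exprn_gt0 // mulrC natr1 => hb.
by have := lt_trans hb h2; rewrite ltr_nat.
Qed.

(** In a crossing cell the midpoint [ord0] is on the bottom side, hence below the line; the other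
    two are tops of children, which cross exactly at a digit 1. *)
Lemma valid_Omega w k : valid x w k <-> Omega x (mid w k).
Proof.
split=> [/orP[iw|/and3P[cw dw k0]]|o].
- by apply: (inside_cell x_gt0 x_lt1 x_nd iw); exact: cell_mid.
- rewrite mid_top //; apply: crossing_top => //; rewrite crossing_rcons ?cw //.
  by elim/ord3P: k k0 => //; rewrite oppE.
have ob : Omega_bar x (mid w k) by left.
have [iw|cw] := Omega_bar_cell x_gt0 x_lt1 x_nd ob (cell_mid w k).
  by rewrite /valid iw.
have ni := crossing_inside cw.
have bot i : i != ord0 -> cell (rcons w i) (mid w k : R * R) -> digit x (size w).
  move=> i0 hc; have [|] := Omega_bar_cell x_gt0 x_lt1 x_nd ob hc.
    by rewrite inside_rconsN // ni.
  by rewrite crossing_rcons // => /andP[].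
rewrite /valid ni cw /=; have [k0|k0] := eqVneq k ord0; last first.
  rewrite andbT; apply: (@bot (opp k ord0)).
    by elim/ord3P: k k0 {o ob bot} => //; rewrite oppE.
  by rewrite mid_top //; exact: cell_q.
have e : mid w k = Fword (rcons w o1) (q o2) :> R * R by rewrite k0 Fword_rcons.
have := @bottom_inside (rcons w o1) o2 isT; rewrite -e inside_rconsN // ni.
by move=> /(_ o).
Qed.

Lemma newVP n t : newV x n.+1 t <-> exists w k, [/\ size w = n, valid x w k & t = mid w k].
Proof.
split=> [[[/V_word[v [j [+ e]]] nV] o]|[w [k [sw vw ->]]]]; last first.
  split; last exact/valid_Omega.
  by split; rewrite /= -sw; [exact: mid_V|exact: mid_notV].
case/lastP: v e => [//|w i] e; rewrite size_rcons => -[sw].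
have [eij|ne] := eqVneq i j.
  by exfalso; apply: nV; apply/V_word; exists w, i; rewrite e eij Fword_rcons Fmap_q.
have em : t = mid w (opp i j) by rewrite e mid_Fword.
by exists w, (opp i j); split => //; apply/valid_Omega; rewrite -em.
Qed.

Lemma newV_sum n (F : R * R -> R) : \sum_(z \in newV x n.+1) F z =
  \sum_(w <- words n) \sum_(k < 3 | valid x w k) F (mid w k).
Proof.
pose r := [seq mid w k | w <- words n, k <- [seq k <- enum 'I_3 | valid x w k]] : seq (R * R).
have -> : newV x n.+1 = [set` r].
  apply/seteqP; split => t /=.
    move=> /newVP[w [k [sw vw ->]]]; apply/allpairsPdep; exists w, k.
    by rewrite mem_words sw mem_filter vw mem_enum.
  move=> /allpairsPdep[w [k [hw hk ->]]]; apply/newVP; exists w, k.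
  by move: hw hk; rewrite mem_words mem_filter => /eqP -> /andP[].
have ur : uniq r.
  apply: allpairs_uniq_dep; first exact: words_uniq.
    by move=> w _; rewrite filter_uniq ?enum_uniq.
  move=> _ _ /allpairsPdep[w [k [hw hk ->]]] /allpairsPdep[w' [k' [hw' hk' ->]]] /= e.
  move: hw hw'; rewrite !mem_words => /eqP sw /eqP sw'.
  by have [-> ->] := mid_inj (etrans sw (esym sw')) e.
rewrite -fsbig_seq // big_allpairs_dep; apply: eq_bigr => w _.
by rewrite big_filter big_enum_cond.
Qed.

Lemma T_mid w k (l : nat) : (0 < l)%N -> T x l (mid w k) ->
  [/\ crossing x w, (size w).+1 = nexp x l & l = (lev x (size w)).+1].
Proof.
move=> l0 hT; have [om [so ao e]] := hT.
have [c s] := tword_crossing x_gt0 x_lt1 ao; rewrite so in s.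
have sw : (size w).+1 = nexp x l.
  case: l l0 hT so s => // l _ _ so s; case/lastP: om so ao e c s => // om i.
  rewrite size_rcons all_rcons => -[so] /andP[i0 _].
  rewrite tword_rcons -rcons_cat; set v := _ ++ _ => e c; rewrite size_rcons => <-.
  congr S; apply: (@mid_size _ _ k (opp i ord0)); rewrite e mid_Fword // .
case: l l0 hT so s sw => // l l0 hT so s sw.
split => //; first exact: (T_level x_gt0 x_lt1 l0 hT sw).
rewrite (@lev_uniq _ x x_gt0 x_lt1 _ l) //; have := nexpS x_gt0 x_lt1 l; lia.
Qed.

(** The point is that [gcoef] couples only midpoints of one n-cell, where it is the inverse Gram
    matrix; this makes the Green function block diagonal in the splines. *)
Lemma gcoef_mid m n w w' k k' : valid x w k -> valid x w' k' ->
  size w = n -> size w' = n -> (n.+1 <= nexp x m)%N ->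
  gcoef x m n.+1 (mid w k) (mid w' k') = if w == w' then gco x w k k' else 0.
Proof.
move=> vw vw' sw sw' hn.
have eqz : (mid w k == mid w' k' :> R * R) = (w == w') && (k == k').
  apply/eqP/andP => [/(mid_inj (etrans sw (esym sw')))[-> ->]//|[/eqP -> /eqP ->]//].
rewrite /gcoef eqz; case: pickP => [l /asboolP[l0 h1 h2 h3]|none].
  have [cw sl el] := T_mid l0 h1; have [cw' _ _] := T_mid l0 h2.
  have ew : w = w'.
    (* Neighbors at level [n.+1] are corners of one cell of that size; its parent contains both
       midpoints, hence is both [w] and [w']. *)
    case: h3 => [/(mid_inj (etrans sw (esym sw')))[]//|[v [i [j [sv ij e e']]]]].
    case/lastP: v sv e e' => [|v c]; first by rewrite -sl.
    rewrite size_rcons -sl sw => -[sv] e e'.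
    have hc p : SG p -> cell v (Fword (rcons v c) p : R * R).
      by move=> hp; rewrite Fword_rcons; exists (Fmap c p) => //; exact: SG_F.
    have -> : w = v by apply: (@mid_cell R _ _ k); rewrite ?sw ?sv ?e //; apply: hc; exact: SG_q.
    by apply/esym/(@mid_cell R _ _ k'); rewrite ?sw' ?sv ?e' //; apply: hc; exact: SG_q.
  rewrite ew eqxx /= /gco crossing_inside // -ew vw /= ew vw' -ew.
  have e1 : (l.-1 = lev x (size w))%N by rewrite el.
  by rewrite -sl e1 -/(rho x (size w)); case: ifP.
case: asboolP => [[v [/= sv hv c1 c2]]|nc].
  have e : w = v by apply: (@mid_cell R _ _ k); rewrite ?sw ?sv.
  have e' : w' = v by apply: (@mid_cell R _ _ k'); rewrite ?sw' ?sv.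
  rewrite e e' eqxx /= /gco (cell_inside x_gt0 x_lt1 x_nd hv) sv.
  by case: ifP.
case: (eqVneq w w') => // ew; rewrite -ew in vw' *.
have ni : inside x w = false.
  apply/negP => iw; apply: nc; exists w; split => //=.
  - exact: inside_cell.
  - exact: cell_mid.
  - by rewrite -ew; exact: cell_mid.
exfalso; move: vw vw'; rewrite /valid ni /= => /and3P[cw dw k0] /and3P[_ _ k0'].
have [T1 e1] := mid_T x_gt0 x_lt1 cw dw k0; have [T2 _] := mid_T x_gt0 x_lt1 cw dw k0'.
have hl : ((lev x (size w)).+1 < m.+1)%N.
  by rewrite ltnS -(nexp_le x_gt0 x_lt1) -e1 sw.
have /asboolP := none (Ordinal hl); apply; split => //=; first by rewrite -ew.
rewrite -ew; have [->|nk] := eqVneq k k'; first by left.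
have key c : c != ord0 -> mid w c = Fword (rcons w ord0) (q (opp c ord0)) :> R * R.
  move=> c0; rewrite mid_Fword; last by elim/ord3P: c c0 => //; rewrite oppE.
  by congr mid; elim/ord3P: c c0 => //; rewrite !oppE.
(* The two midpoints are the bottom corners of the top child. *)
right; exists (rcons w ord0), (opp k ord0), (opp k' ord0); rewrite size_rcons e1.
split => //; [|exact: key|exact: key].
clear -k0 k0' nk.
by elim/ord3P: k k0 nk => //; elim/ord3P: k' k0' => //; rewrite !oppE.
Qed.

Definition level_Green n (s t : R * R) : R :=
  \sum_(w <- words n) \sum_(k < 3) \sum_(l < 3)
    gco x w k l * sp x w k s * sp x w l t.

Definition partial_Green n (s t : R * R) : R := \sum_(0 <= j < n) level_Green j s t.

Lemma Gm_partial m s t : Omega_bar x s -> Omega_bar x t ->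
  Gm x m s t = partial_Green (nexp x m) s t.
Proof.
move=> os ot; rewrite /Gm big_add1 /=; apply: eq_big_nat => n /andP[_ hn].
rewrite newV_sum /level_Green; apply: eq_big_seq => w; rewrite mem_words => /eqP sw.
rewrite [RHS](bigID (valid x w)) /= [X in _ = _ + X]big1 ?addr0; last first.
  move=> k nv; apply: big1 => l _; have [->|/gco_valid[]] := eqVneq (gco x w k l) 0.
    by rewrite !mul0r.
  by rewrite (negbTE nv).
apply: eq_bigr => k vw; rewrite newV_sum (bigD1_seq w) ?words_uniq ?mem_words ?sw //=.
rewrite [X in _ + X]big1_seq ?addr0; last first.
  move=> w' /andP[ne]; rewrite mem_words => /eqP sw'; apply: big1 => l vl.
  by rewrite gcoef_mid // eq_sym (negbTE ne) !mul0r.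
rewrite [RHS](bigID (valid x w)) /= [X in _ = _ + X]big1 ?addr0; last first.
  move=> l nv; have [->|/gco_valid[]] := eqVneq (gco x w k l) 0.
    by rewrite !mul0r.
  by rewrite (negbTE nv).
apply: eq_bigr => l vl; rewrite gcoef_mid // eqxx -sw.
by rewrite !spline_sp.
Qed.

(** At a given [s] the splines of a single n-cell can be nonzero, which leaves nine terms, each at
    most (3/5)^n. *)
Lemma level_Green_bound n s t : SG s -> SG t -> `|level_Green n s t| <= 9 * (3 / 5) ^+ n.
Proof.
move=> hs ht; have [w1 h1] := sp_support x_gt0 x_lt1 n hs.
have p : 0 <= (3 / 5 : R) ^+ n by apply: exprn_ge0; lra.
have term w k l : size w = n -> `|gco x w k l * sp x w k s * sp x w l t| <= (3 / 5) ^+ n.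
  move=> sw; have [->|/gco_valid[vk vl]] := eqVneq (gco x w k l) 0.
    by rewrite !mul0r normr0.
  rewrite !normrM -sw; have := gco_bound x_gt0 x_lt1 w k l.
  have /andP[a0 a1] := sp_bounds x_gt0 x_lt1 vk hs.
  have /andP[b0 b1] := sp_bounds x_gt0 x_lt1 vl ht.
  rewrite (ger0_norm a0) (ger0_norm b0) => h; apply: le_trans h.
  by rewrite -mulrA ler_piMr // mulr_ile1.
have row w : size w = n -> `|\sum_(k < 3) \sum_(l < 3)
    gco x w k l * sp x w k s * sp x w l t| <= 9 * (3 / 5) ^+ n.
  move=> sw; apply: le_trans (ler_norm_sum _ _ _) _.
  apply: (le_trans (ler_sum _ (fun k _ => le_trans (ler_norm_sum _ _ _)
    (ler_sum _ (fun l _ => term w k l sw))))).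
  by rewrite !big_ord3; move: p; move: (_ ^+ _) => P p; lra.
have zero w : size w = n -> w != w1 -> \sum_(k < 3) \sum_(l < 3)
    gco x w k l * sp x w k s * sp x w l t = 0.
  move=> sw ne; apply: big1 => k _; apply: big1 => l _.
  have [->|/gco_valid[vk _]] := eqVneq (gco x w k l) 0; first by rewrite !mul0r.
  by rewrite (h1 w k) // mulr0 mul0r.
rewrite /level_Green; have [m1|nm] := boolP (w1 \in words n).
  rewrite (bigD1_seq w1) ?words_uniq //= [X in _ + X]big1_seq ?addr0.
    by apply: row; apply/eqP; rewrite -mem_words.
  by move=> w /andP[ne]; rewrite mem_words => /eqP sw; exact: zero.
rewrite big1_seq ?normr0 ?mulr_ge0 // => w /andP[_ hw].
apply: zero; first by apply/eqP; rewrite -mem_words.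
by apply: contraNneq nm => <-.
Qed.

Lemma partial_Green_bound N n s t : (N <= n)%N -> SG s -> SG t ->
  `|partial_Green n s t - partial_Green N s t| <= 45 / 2 * (3 / 5) ^+ N.
Proof.
(* The constant 45/2 is 9 / (1 - 3/5); the difference of two powers is the form in which the
   geometric sum passes through the induction. *)
move=> /subnK <- hs ht; apply: (@le_trans _ _
    (45 / 2 * ((3 / 5) ^+ N - (3 / 5) ^+ (n - N + N)))).
  elim: (n - N)%N => [|d ih]; first by rewrite add0n !subrr normr0 mulr0.
  rewrite addSn /partial_Green big_nat_recr //= -/(partial_Green _ s t) addrAC.
  apply: le_trans (ler_normD _ _) _.
  have := level_Green_bound (d + N) hs ht; move: ih; rewrite /partial_Green.
  rewrite [(3 / 5) ^+ (d + N).+1]exprS.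
  by move: ((3 / 5) ^+ (d + N)) `|level_Green _ _ _| => P L; lra.
have : 0 <= (3 / 5 : R) ^+ (n - N + N) by apply: exprn_ge0; lra.
by move: ((3 / 5) ^+ (n - N + N)) ((3 / 5) ^+ N) => P Q; lra.
Qed.

Lemma geom35_cvg : (fun n => 45 / 2 * (3 / 5) ^+ n : R) @ \oo --> (0 : R).
Proof.
rewrite -[X in _ --> X](mulr0 (45 / 2)); apply: cvgM; first exact: cvg_cst.
by apply: cvg_expr; rewrite ger0_norm; lra.
Qed.

Lemma partial_Green_cvg s t : SG s -> SG t ->
  cvgn (fun n => partial_Green n s t) /\
  forall N, `|limn (fun n => partial_Green n s t) - partial_Green N s t| <=
    45 / 2 * (3 / 5) ^+ N.
Proof.
move=> hs ht; apply: cvgn_of_close; first exact: geom35_cvg.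
by move=> N n h; exact: partial_Green_bound.
Qed.

Lemma GreenE s t : Omega_bar x s -> Omega_bar x t ->
  Green x s t = limn (fun n => partial_Green n s t).
Proof.
move=> os ot; rewrite /Green; apply: cvg_lim => //.
have [cv _] := partial_Green_cvg (Omega_bar_SG os) (Omega_bar_SG ot).
under eq_fun do rewrite Gm_partial //.
exact: (cvg_nexp x_gt0 x_lt1 cv).
Qed.

Lemma Green_close N s t : Omega_bar x s -> Omega_bar x t ->
  `|Green x s t - partial_Green N s t| <= 45 / 2 * (3 / 5) ^+ N.
Proof.
move=> os ot; rewrite GreenE //.
by have [_ ] := partial_Green_cvg (Omega_bar_SG os) (Omega_bar_SG ot).
Qed.

Lemma Gm_uniform : {uniform Omega_bar x `*` Omega_bar x,
  (fun (m : nat) (st : (R * R) * (R * R)) => Gm x m st.1 st.2) @ \oo -->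
  (fun st : (R * R) * (R * R) => Green x st.1 st.2)}.
Proof.
move=> U /uniform_nbhs [E [entE hE]].
move: entE => /=; rewrite -entourage_ballE => -[e /= e0 he].
move/cvgrPdist_lt: (cvg_nexp x_gt0 x_lt1 geom35_cvg) => /(_ e e0) [N _ hN].
exists N => // m /= hm; apply: hE => -[s t] [/= os ot]; apply: he => /=.
rewrite -ball_normE /= Gm_partial //; apply: le_lt_trans (Green_close _ os ot) _.
by have := hN m hm; rewrite /= sub0r normrN; apply: le_lt_trans; exact: ler_norm.
Qed.

End NewVertices.

(** * Interpolation *)

Section Interpolation.
Context {R : realType}.
Variable x : R.
Implicit Types (w : seq 'I_3) (u v : R * R -> R) (i j k l : 'I_3) (n N : nat).
Implicit Types (e : seq 'I_3 * 'I_3) (c : seq 'I_3 * 'I_3 -> R).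

Fixpoint idx n : seq (seq 'I_3 * 'I_3) :=
  if n is n'.+1 then
    idx n' ++ [seq (w, k) | w <- words n', k <- [seq k <- enum 'I_3 | valid x w k]]
  else [::].

Lemma idx_sum (V : nmodType) n (G : seq 'I_3 -> 'I_3 -> V) :
  \sum_(e <- idx n) G e.1 e.2 =
  \sum_(0 <= j < n) \sum_(w <- words j) \sum_(k < 3 | valid x w k) G w k.
Proof.
elim: n => [|n ih]; first by rewrite /= big_nil big_geq.
rewrite big_nat_recr //= big_cat /= ih; congr (_ + _).
rewrite big_allpairs_dep; apply: eq_bigr => w _.
by rewrite big_filter big_enum_cond.
Qed.

Lemma mem_idx n w k : ((w, k) \in idx n) = (size w < n)%N && valid x w k.
Proof.
elim: n => [//|n ih] /=; rewrite mem_cat ih.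
have -> : ((w, k) \in [seq (w, k) | w <- words n, k <- [seq k <- enum 'I_3 | valid x w k]])
    = (size w == n) && valid x w k.
  apply/allpairsPdep/andP => [[w' [k' [hw hk [-> ->]]]]|[sw vw]].
    by move: hw hk; rewrite mem_words mem_filter => -> /andP[].
  by exists w, k; rewrite mem_words sw mem_filter vw mem_enum.
by rewrite -andb_orl ltnS [in RHS]leq_eqVlt orbC.
Qed.

Lemma idx_uniq n : uniq (idx n).
Proof.
elim: n => [//|n ih] /=; rewrite cat_uniq ih /=; apply/andP; split.
  apply/hasPn => -[w k] /allpairsPdep[w' [k' [hw _ [-> ->]]]] /=.
  by rewrite mem_idx; move: hw; rewrite mem_words => /eqP ->; rewrite ltnn.
apply: allpairs_uniq_dep; first exact: words_uniq.
  by move=> w _; rewrite filter_uniq ?enum_uniq.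
by move=> [w k] [w' k'] _ _ [-> ->].
Qed.

Definition comb n c (p : R * R) : R := \sum_(e <- idx n) c e * sp x e.1 e.2 p.

(** The basis is hierarchical and dual to [dfct], so the coefficients of the interpolant are the
    defects of [v]. *)
Definition interp n v := comb n (fun e => dfct x v e.1 e.2).

Lemma gco_swap n (a b : seq 'I_3 -> 'I_3 -> R) :
  \sum_(e <- idx n) (\sum_(k < 3) gco x e.1 k e.2 * a e.1 k) * b e.1 e.2 =
  \sum_(e <- idx n) (\sum_(l < 3) gco x e.1 e.2 l * b e.1 l) * a e.1 e.2.
Proof.
rewrite (idx_sum _ (fun w l => (\sum_(k < 3) gco x w k l * a w k) * b w l)).
rewrite (idx_sum _ (fun w k => (\sum_(l < 3) gco x w k l * b w l) * a w k)).
apply: eq_bigr => j _; apply: eq_bigr => w _.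
have z k l : ~~ valid x w k -> gco x w k l = 0.
  by move=> nv; apply/eqP/negP => /negP /gco_valid[]; rewrite (negbTE nv).
transitivity (\sum_(l < 3) \sum_(k < 3) gco x w k l * a w k * b w l).
  rewrite [RHS](bigID (valid x w)) /= [X in _ = _ + X]big1 ?addr0.
    by apply: eq_bigr => l _; rewrite mulr_suml.
  by move=> l nv; apply: big1 => k _; rewrite gcoC z // !mul0r.
rewrite exchange_big /= [LHS](bigID (valid x w)) /= [X in _ + X]big1 ?addr0.
  by apply: eq_bigr => l _; rewrite mulr_suml; apply: eq_bigr => k _; rewrite mulrAC.
by move=> k nv; apply: big1 => l _; rewrite z // !mul0r.
Qed.

Lemma partial_GreenE n s t : partial_Green x n s t =
  comb n (fun e => \sum_(k < 3) gco x e.1 k e.2 * sp x e.1 k s) t.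
Proof.
rewrite /comb (idx_sum _ (fun w l => (\sum_(k < 3) gco x w k l * sp x w k s) * sp x w l t)).
apply: eq_bigr => j _; apply: eq_bigr => w _; rewrite exchange_big /=.
rewrite [LHS](bigID (valid x w)) /= [X in _ + X]big1 ?addr0.
  by apply: eq_bigr => l _; rewrite mulr_suml.
move=> l nv; apply: big1 => k _; have [->|/gco_valid[_]] := eqVneq (gco x w k l) 0.
  by rewrite !mul0r.
by rewrite (negbTE nv).
Qed.

Lemma dfct_lin u u' (a : R) w k :
  dfct x (fun p => u p + a * u' p) w k = dfct x u w k + a * dfct x u' w k.
Proof.
rewrite /dfct /Mx /harm /vx; case: ifP => _; last by ring.
by case: ifP => _; ring.
Qed.

Lemma dfct0 w k : dfct x (fun=> 0) w k = 0 :> R.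
Proof. by rewrite /dfct -[X in Mx x w X k]/(fun=> 0 : R) Mx0 subrr. Qed.

Lemma dfct_sum (I : Type) (s : seq I) (c : I -> R) (u : I -> R * R -> R) w k :
  dfct x (fun p => \sum_(i <- s) c i * u i p) w k = \sum_(i <- s) c i * dfct x (u i) w k.
Proof.
elim: s => [|i s ih].
  by rewrite big_nil -[RHS](dfct0 w k); congr dfct; apply/funext => p; rewrite big_nil.
rewrite big_cons -ih addrC -dfct_lin; congr dfct; apply/funext => p.
by rewrite big_cons addrC.
Qed.

Hypotheses (x_gt0 : 0 < x) (x_lt1 : x < 1) (x_nd : ~ dyadic x).

Lemma dfct_comb n c w k : dfct x (comb n c) w k =
  if (w, k) \in idx n then c (w, k) else 0.
Proof.
rewrite /comb dfct_sum.
transitivity (\sum_(e <- idx n) c e * ((w, k) == e)%:R).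
  apply: eq_big_seq => -[w' k']; rewrite mem_idx => /andP[_ v'].
  by rewrite dfct_sp // xpair_eqE.
case: ifP => [h|/negbT h].
  rewrite (bigD1_seq (w, k)) ?idx_uniq //= eqxx mulr1 big1 ?addr0 //.
  by move=> e /negbTE; rewrite eq_sym => ->; rewrite mulr0.
rewrite big1_seq // => -[w' k'] /andP[_ he] /=.
by rewrite (_ : _ == _ = false) ?mulr0 //; apply: contraNF h => /eqP ->.
Qed.

Lemma comb_follows n c : follows x n (comb n c).
Proof. by move=> w k h; rewrite dfct_comb mem_idx ltnNge h. Qed.

Lemma comb_vertex n N c w i : (size w <= n)%N -> (n <= N)%N ->
  vx (comb N c) w i = vx (comb n c) w i.
Proof.
move=> hw /subnK <-; elim: (N - n)%N => [//|d ih]; rewrite addSn -ih.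
rewrite /vx /comb /= big_cat /= [X in _ + X]big1_seq ?addr0 // => e /andP[_].
move=> /allpairsPdep[w' [k' [hw' hk ->]]] /=.
have vw : valid x w' k' by move: hk; rewrite mem_filter => /andP[].
move: hw'; rewrite mem_words => /eqP sw'.
have -> : sp x w' k' (Fword w (q i)) = vx (sp x w' k') w i by [].
by rewrite vx_sp0 // ?mulr0 // sw' (leq_trans hw) ?leq_addl.
Qed.

Lemma comb_nil n c i : vx (comb n c) [::] i = 0.
Proof. by rewrite (@comb_vertex 0) // /vx /comb /= big_nil. Qed.

Lemma within_sum (A : set (R * R)) (s : seq (seq 'I_3 * 'I_3)) c :
  (forall e, e \in s -> {within A, continuous (sp x e.1 e.2)}) ->
  {within A, continuous (fun p => \sum_(e <- s) c e * sp x e.1 e.2 p)}.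
Proof.
elim: s => [|e s ih] h.
  rewrite (_ : (fun p => _) = fun=> 0); last by apply/funext => p; rewrite big_nil.
  by move=> p; exact: cvg_cst.
rewrite (_ : (fun p => _) =
  fun p => \sum_(e <- s) c e * sp x e.1 e.2 p + c e * sp x e.1 e.2 p); last first.
  by apply/funext => p; rewrite big_cons addrC.
apply: within_lin; first by apply: ih => e' he'; apply: h; rewrite inE he' orbT.
by apply: h; rewrite inE eqxx.
Qed.

Lemma comb_continuous n c : {within SG, continuous (comb n c)}.
Proof.
apply: within_sum => -[w k]; rewrite mem_idx => /andP[_ v].
exact: sp_continuous.
Qed.

Lemma comb_continuous_bar n c : {within Omega_bar x, continuous (comb n c)}.
Proof. exact: continuous_subspaceW (@Omega_bar_SG _ x) (@comb_continuous n c). Qed.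

Lemma comb_line n c p : Sline x p -> comb n c p = 0.
Proof.
move=> lp; rewrite /comb big1_seq // => -[w k] /andP[_].
by rewrite mem_idx => /andP[_ v]; rewrite /= sp_line // mulr0.
Qed.

Lemma comb_q0 n c : comb n c (q ord0) = 0.
Proof. exact: (comb_nil n c ord0). Qed.

Lemma comb_bottom n c w i : crossing x w -> i != ord0 -> vx (comb n c) w i = 0.
Proof.
move=> cw i0; rewrite /vx /comb big1_seq // => -[w' k] /andP[_].
rewrite mem_idx => /andP[_ v] /=.
have -> : sp x w' k (Fword w (q i)) = vx (sp x w' k) w i by [].
rewrite vx_sp //; have [h _ _] := sv_osc x_gt0 x_lt1 v w.
by have [bot _] := h cw; rewrite bot // mulr0.
Qed.

Lemma follows_hull n u w (v : seq 'I_3) lo hi i : follows x n u -> (n <= size w)%N ->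
  (forall i, lo <= vx u w i <= hi) -> (crossing x w -> lo <= 0 <= hi) ->
  lo <= vx u (w ++ v) i <= hi.
Proof.
move=> f hw h h0; elim/last_ind: v i => [|v j ih] i; first by rewrite cats0.
rewrite -rcons_cat vx_rcons (_ : (fun k => u (mid (w ++ v) k)) = Mx x (w ++ v) (vx u (w ++ v))).
  apply: (child_hull x_gt0 x_lt1) => // cw; apply: h0; exact: crossing_prefix cw.
apply/funext => k; apply/eqP; rewrite -subr_eq0; apply/eqP/f.
by rewrite size_cat (leq_trans hw) ?leq_addr.
Qed.

Definition agree n u v := forall w, size w = n ->
  (crossing x w -> vx u w ord0 = vx v w ord0) /\
  (inside x w -> forall i, vx u w i = vx v w i).

Lemma Eh_agree n u u' v : agree n u u' -> Eh x n u v = Eh x n u' v.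
Proof.
move=> h; apply: eq_big_seq => w; rewrite mem_words => /eqP sw.
have [hc hi] := h w sw; rewrite /eh; case: ifP => [/hi e|_].
  by rewrite /tri !e.
by case: ifP => // /hc ->.
Qed.

Lemma agree_Omega n u v : (forall w i, size w = n -> Omega_bar x (Fword w (q i)) ->
  vx u w i = vx v w i) -> agree n u v.
Proof.
move=> h w sw; split => [cw|iw i]; apply: h => //; left.
  exact: crossing_top.
exact: inside_q.
Qed.

Lemma interp_agree n v : v (q ord0) = 0 -> agree n (interp n v) v.
Proof.
move=> v0; suff h w : (size w <= n)%N ->
    (crossing x w -> vx (interp n v) w ord0 = vx v w ord0) /\
    (inside x w -> forall i, vx (interp n v) w i = vx v w i).
  by move=> w sw; apply: h; rewrite sw.
elim/last_ind: w => [|w i ih].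
  by split => //; rewrite comb_nil /vx /= v0.
rewrite size_rcons => hw; have [ihc ihi] := ih (ltnW hw).
have hm k : valid x w k -> interp n v (mid w k) = v (mid w k).
  move=> vk; have := @dfct_comb n (fun e => dfct x v e.1 e.2) w k.
  rewrite mem_idx hw vk /= /dfct => /eqP.
  suff -> : Mx x w (vx (interp n v) w) k = Mx x w (vx v w) k.
    by rewrite -/(interp n v) subr_eq subrK => /eqP.
  rewrite /Mx; case: ifP => [/ihc ->//|nc]; rewrite /harm !ihi //;
    by move: vk; rewrite /valid nc orbF.
have hin : inside x w -> forall j, vx (interp n v) (rcons w i) j = vx v (rcons w i) j.
  move=> iw j; rewrite !vx_rcons /child; case: ifP => _; first exact: ihi.
  by apply: hm; rewrite /valid iw.
have [iw|ni] := boolP (inside x w).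
  by split; [move=> _; exact: hin|move=> _; exact: hin].
have [cw|nc] := boolP (crossing x w); last first.
  split.
    by move=> c; case/negP: nc; apply: (crossing_prefix (v := [:: i])); rewrite cats1.
  have [->|i0] := eqVneq i ord0; first by rewrite inside_rcons0N // (negbTE ni).
  by rewrite inside_rconsN // (negbTE ni).
have [->|i0] := eqVneq i ord0.
  split=> [_|]; first by rewrite !vx_rcons /child eqxx ihc.
  rewrite inside_rcons0 // => dw j; rewrite !vx_rcons /child; case: eqP => [_|/eqP j0].
    exact: ihc.
  by apply: hm; rewrite /valid cw dw (opp0_neq j0).2 orbT.
rewrite inside_rconsN // (negbTE ni); split => //.
rewrite crossing_rcons // cw /= => dw; rewrite !vx_rcons /child eq_sym (negbTE i0).
by apply: hm; rewrite /valid cw dw (opp0_neq i0).1 orbT.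
Qed.

(** The trace of the spline at level [size w] is zero, its only defect is in the cell [w], and it
    follows the harmonic rule afterwards; a single increment of [EhS] survives. *)
Lemma Eh_sp n w k v : valid x w k -> (size w < n)%N ->
  Eh x n (sp x w k) v = Qf x w (fun j => (j == k)%:R) (dfct x v w).
Proof.
move=> vk hn; rewrite (Eh_follows x_gt0 x_lt1 _ hn (sp_follows x_gt0 x_lt1 vk)).
rewrite EhS // [X in X + _](_ : _ = 0); last first.
  rewrite /Eh big1_seq // => w' /andP[_]; rewrite mem_words => /eqP sw'.
  rewrite /eh vx_sp0 ?sw' ?leqnn // /tri.
  by do 2?case: ifP => _ //; rewrite ?subrr ?mul0r ?addr0 ?mulr0.
rewrite add0r (bigD1_seq w) ?words_uniq ?mem_words //= big1_seq ?addr0.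
  congr Qf; apply/funext => j; rewrite dfct_sp // eqxx //.
move=> w' /andP[ne _]; rewrite (_ : dfct x (sp x w k) w' = fun=> 0); last first.
  by apply/funext => j; rewrite dfct_sp // (negbTE ne).
rewrite /Qf /tri_mid /tri; do 2?case: ifP => _ //; ring.
Qed.

Lemma Eh_comb n c v : Eh x n (comb n c) v =
  \sum_(e <- idx n) c e * Qf x e.1 (fun j => (j == e.2)%:R) (dfct x v e.1).
Proof.
rewrite /comb Eh_sum; apply: eq_big_seq => -[w k]; rewrite mem_idx => /andP[hw vk].
by rewrite /= Eh_sp.
Qed.

(** Pairing with [v] produces the Gram matrices [Qf]; moving [gco] across by symmetry lets it invert
    them and leaves the defects of [v]. *)
Lemma Eh_Green n (b : seq 'I_3 -> 'I_3 -> R) v :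
  Eh x n (comb n (fun e => \sum_(l < 3) gco x e.1 e.2 l * b e.1 l)) v =
  \sum_(e <- idx n) dfct x v e.1 e.2 * b e.1 e.2.
Proof.
rewrite Eh_comb -(gco_swap n (fun w k => Qf x w (fun j => (j == k)%:R) (dfct x v w)) b).
apply: eq_big_seq => -[w k]; rewrite mem_idx => /andP[hw vk] /=.
under eq_bigr do rewrite gcoC; by rewrite gco_inv // vk mul1r.
Qed.

(** On an inside cell the maximum principle keeps the interpolant between the corner values of [v],
    which oscillates little there; on a crossing cell both functions are close to 0. *)
Lemma interp_close v (e : R) : {within Omega_bar x, continuous v} -> v (q ord0) = 0 ->
  (forall p, Sline x p -> v p = 0) -> 0 < e ->
  exists N, forall n p, (N <= n)%N -> Omega_bar x p -> `|interp n v p - v p| <= e.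
Proof.
move=> cv v0 vS e0; have e2 : 0 < e / 2 by lra.
have [d d0 hd] := within_unif (@Omega_bar_compact _ x) cv e2.
have [N1 hN1] := half_pow_lt d0.
have [N2 hN2] := top_near_line x_gt0 x_lt1 x_nd cv vS e2.
exists (maxn N1 N2) => n p; rewrite geq_max => /andP[n1 n2] op.
have [w [sw wp]] := SG_cell n (Omega_bar_SG op).
have [hc hi] := interp_agree v0 sw.
have [iw|cw] := Omega_bar_cell x_gt0 x_lt1 x_nd op wp.
  have osc p' : cell w p' -> `|v p - v p'| < e / 2.
    move=> wp'; apply: hd => //.
      by apply: Omega_sub_bar; exact: (inside_cell x_gt0 x_lt1 x_nd iw).
    by apply: le_lt_trans (cell_norm wp wp') _; rewrite sw; exact: hN1.
  have : v p - e / 2 <= interp n v p <= v p + e / 2.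
    apply: (@cell_hull _ SG (interp n v) w) => //; first exact: comb_continuous.
      exact: cell_SG.
    move=> u i; rewrite -/(vx (interp n v) (w ++ u) i).
  apply: (@follows_hull n) => //; first exact: comb_follows.
    - by rewrite sw.
    - move=> j; rewrite hi //; have := osc _ (cell_q w j); rewrite ltr_norml -/(vx v w j).
      by move=> /andP[? ?]; apply/andP; split; lra.
    - by move=> c; rewrite crossing_inside in iw.
  by move=> /andP[? ?]; rewrite ler_norml; apply/andP; split; lra.
have t2 : `|vx v w ord0| < e / 2.
  apply: (hN2 w) => //; rewrite ?sw //; first exact: cell_q.
  by apply: Omega_sub_bar; exact: crossing_top.
have p2 : `|v p| < e / 2 by apply: (hN2 w) => //; rewrite sw.
have : - (e / 2) <= interp n v p <= e / 2.
  apply: (@cell_hull _ SG (interp n v) w) => //; first exact: comb_continuous.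
    exact: cell_SG.
  move=> u i; rewrite -/(vx (interp n v) (w ++ u) i).
  apply: (@follows_hull n) => //; first exact: comb_follows.
  - by rewrite sw.
  - move=> j; have [->|j0] := eqVneq j ord0.
      rewrite hc //; move: t2; rewrite ltr_norml => /andP[? ?].
      by apply/andP; split; lra.
    by rewrite comb_bottom //; apply/andP; split; lra.
  - by move=> _; apply/andP; split; lra.
move: p2; rewrite ltr_norml => /andP[? ?] /andP[? ?].
by rewrite ler_norml; apply/andP; split; lra.
Qed.

(* Comparing [v] with its interpolant: the conductors replacing the crossing
   cells in [Eh] carry no more energy than [v] does there. *)
Lemma Eh_le_energy n v (L : R) : {within Omega_bar x, continuous v} ->
  v (q ord0) = 0 -> (forall p, Sline x p -> v p = 0) ->
  (forall N, En x N v v <= L) -> Eh x n v v <= L.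
Proof.
move=> cv v0 vS hL; pose P := interp n v.
have ag : agree n P v := @interp_agree n v v0.
have eP : Eh x n P P = Eh x n v v by rewrite (Eh_agree _ ag) EhC (Eh_agree _ ag).
have ePv : Eh x n P v = Eh x n v v by rewrite (Eh_agree _ ag).
have fP : follows x n P := @comb_follows _ _.
have h := En_cvg_follows x_gt0 x_lt1 x_nd fP cv vS.
rewrite ePv in h.
(* Expand the nonnegative energy of [v - P] at level [N], bounding that of [P] by its trace; in the
   limit the mixed term becomes [Eh x n v v]. *)
have key N : (n <= N)%N -> 2 * En x N P v <= L + Eh x n v v.
  move=> nN; have := En_ge0 x N (fun p => v p + (-1) * P p).
  have -> : En x N (fun p => v p + (-1) * P p) (fun p => v p + (-1) * P p) =
      En x N v v + 2 * (-1) * En x N v P + (-1) ^+ 2 * En x N P P.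
    exact: gform_sqr.
  have := hL N; have := En_le_Eh x_gt0 x_lt1 N P.
  rewrite (Eh_follows x_gt0 x_lt1 P nN fP) eP (EnC _ _ v P); lra.
have : 2 * Eh x n v v <= L + Eh x n v v.
  have h2 : (fun N => 2 * En x N P v) @ \oo --> 2 * Eh x n v v.
    by apply: cvgM => //; exact: cvg_cst.
  rewrite -(cvg_lim _ h2) //; apply: limr_le; first by apply/cvg_ex; eexists; exact: h2.
  by exists n => // N /= /key.
lra.
Qed.

End Interpolation.

(** * The Dirichlet problem *)

Section PlaneMeasurability.
Context {R : realType}.

Lemma open_plane_measurable (U : set (R * R)) : open U -> measurable U.
Proof.
move=> oU; pose box (a b c d : rat) : set (R * R) :=
  [set` `]ratr a, ratr b[] `*` [set` `]ratr c, ratr d[].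
pose C a b c d := [set p | box a b c d p /\ box a b c d `<=` U].
(* [C a b c d] is the rational box when the box lies in [U], and is empty otherwise; this makes the
   union countable. *)
have -> : U = \bigcup_a \bigcup_b \bigcup_c \bigcup_d C a b c d.
  apply/seteqP; split => [p Up|p [a _ [b _ [c _ [d _ [hp hs]]]]]]; last exact: hs.
  have /nbhs_ballP [e /= e0 he] : nbhs p U by exact: open_nbhs_nbhs.
  have rat_lt (u v : R) : u < v -> exists r : rat, u < ratr r < v.
    by move=> /rat_in_itvoo[r]; rewrite in_itv /=; exists r.
  have [a /andP[a1 a2]] := rat_lt (p.1 - e) p.1 ltac:(lra).
  have [b /andP[b1 b2]] := rat_lt p.1 (p.1 + e) ltac:(lra).
  have [c /andP[c1 c2]] := rat_lt (p.2 - e) p.2 ltac:(lra).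
  have [d /andP[d1 d2]] := rat_lt p.2 (p.2 + e) ltac:(lra).
  exists a => //; exists b => //; exists c => //; exists d => //; split.
    by split; rewrite /= in_itv /=; apply/andP.
  move=> p' [/=]; rewrite !in_itv /= => /andP[h1 h2] /andP[h3 h4].
  by apply: he; split; rewrite /= -ball_normE /= ltr_norml; apply/andP; split; lra.
do 4!(apply: bigcupT_measurable_rat => ?).
rewrite /C; set A := box _ _ _ _; have [h|h] := pselect (A `<=` U).
  rewrite (_ : [set p | _] = A); last by apply/seteqP; split => [p []|p ?].
  by apply: measurableX; exact: measurable_itv.
by rewrite (_ : [set p | _] = set0) //; apply/seteqP; split => [p []|p].
Qed.

Lemma within_measurable (D : set (R * R)) (f : R * R -> R) :
  measurable D -> {within D, continuous f} -> measurable_fun D f.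
Proof.
move=> mD /continuousP cf; apply: (measurability _ (measurable_realfun.RGenOpens.measurableE R)).
move=> _ [_ [a [b ->] <-]].
have := cf _ (@interval_open _ (BRight a) (BLeft b) isT isT).
move=> /open_subspaceP [W oW WD]; rewrite setIC -WD.
by apply: measurableI => //; exact: open_plane_measurable.
Qed.

Lemma closed_plane_measurable (A : set (R * R)) : closed A -> measurable A.
Proof. by move/closed_openC/open_plane_measurable/measurableC; rewrite setCK. Qed.

Lemma Omega_measurable (x : R) : measurable (Omega x).
Proof.
have -> : Omega x = SG `&` ((fun p : R * R => p.2) @^-1` [set t | 1 - x < t]).
  by apply/seteqP; split => p [].
apply: measurableI; first exact: closed_plane_measurable (@SG_closed R).
apply: open_plane_measurable; apply: open_comp; last exact: open_gt.
by move=> p _; exact: cvg_snd.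
Qed.

Lemma within_bounded (A : set (R * R)) (f : R * R -> R) : compact A ->
  {within A, continuous f} -> exists2 M, 0 <= M & forall p, A p -> `|f p| <= M.
Proof.
move=> cA cf; have [/set0P ne|/negPn/eqP ->] := boolP (A != set0); last first.
  by exists 0.
have ca : {within A, continuous (fun p => `|f p|)}.
  by move=> p; apply: cvg_comp (cf p) _; exact: norm_continuous.
have [c _ hc] := compact_EVT_max ne cA ca.
by exists `|f c| => // p Ap; apply: hc; rewrite inE.
Qed.

End PlaneMeasurability.

(** * The Green potential and its weak equation *)

Section Dirichlet.
Context {R : realType}.
Variables (mu : probability (R * R)%type R) (x : R).
Hypotheses (x_gt0 : 0 < x) (x_lt1 : x < 1) (x_nd : ~ dyadic x).
Variable F : R * R -> R.
Hypothesis cF : {within Omega_bar x, continuous F}.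
Implicit Types (u v f g : R * R -> R) (n N : nat).

Local Notation cont f := ({within Omega_bar x, continuous f}).
Local Notation I f := (\int[mu]_(t in Omega x) (f t * F t)).

Lemma contM f g : cont f -> cont g -> cont (fun p => f p * g p).
Proof. by move=> cf cg p; apply: cvgM; [exact: cf|exact: cg]. Qed.

Lemma cont_integrable f : cont f -> mu.-integrable (Omega x) (EFin \o f).
Proof.
move=> cf; have [M M0 hM] := within_bounded (@Omega_bar_compact _ x) cf.
apply: measurable_bounded_integrable; first exact: Omega_measurable.
- by apply: le_lt_trans (ltry 1); apply: probability_le1; exact: Omega_measurable.
- apply: within_measurable; first exact: Omega_measurable.
  exact: continuous_subspaceW (@Omega_sub_bar _ x) cf.
- exists M; split => [|K MK p /= Op]; first exact: num_real.
  by apply: le_trans (ltW MK); apply: hM; exact: Omega_sub_bar.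
Qed.

Lemma I_lin f g (c : R) : cont f -> cont g -> I (fun t => f t + c * g t) = I f + c * I g.
Proof.
move=> cf cg; have if_ := cont_integrable (contM cf cF).
have ig := cont_integrable (contM cg cF); have mO := @Omega_measurable _ x.
rewrite -RintegralZl // -RintegralD //; last first.
  apply: (@cont_integrable (fun t => c * (g t * F t))).
  by apply: contM; [move=> ?; exact: cvg_cst|exact: contM].
by congr fine; apply: eq_integral => t _; congr EFin; ring.
Qed.

Lemma I_bound : exists2 C : R, 0 <= C & forall f e, cont f -> 0 <= e ->
  (forall p, Omega_bar x p -> `|f p| <= e) -> `|I f| <= e * C.
Proof.
have [C C0 hC] := within_bounded (@Omega_bar_compact _ x) cF; exists C => //.
move=> f e cf e0 hf; have mO := @Omega_measurable _ x.
have cfF := contM cf cF; have ifF := cont_integrable cfF.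
apply: le_trans (le_normr_Rintegral mO ifF) _.
have ce : cont (fun=> e * C) by move=> ?; exact: cvg_cst.
apply: (@le_trans _ _ (\int[mu]_(t in Omega x) (e * C))).
  apply: le_Rintegral => //.
  - apply: (@cont_integrable (fun p => `|f p * F p|)) => p.
    by apply: cvg_comp (cfF p) _; exact: norm_continuous.
  - exact: cont_integrable.
  - move=> p Op; rewrite normrM ler_pM //; first by apply: hf; left.
    by apply: hC; left.
rewrite Rintegral_cst // ler_piMr ?mulr_ge0 //.
have p1 := probability_le1 mu mO; rewrite -[leRHS]/(fine 1%:E).
by apply: fine_le => //; apply: fin_num_measure.
Qed.

Lemma I_comb n c : I (comb x n c) = \sum_(e <- idx x n) c e * I (sp x e.1 e.2).
Proof.
rewrite /comb; have : forall e, e \in idx x n -> cont (sp x e.1 e.2).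
  move=> [w k]; rewrite mem_idx => /andP[_ v]; exact: sp_continuous_bar.
elim: (idx x n) => [|e s ih] h.
  rewrite big_nil; transitivity (\int[mu]_(t in Omega x) (0 : R)).
    by congr fine; apply: eq_integral => t _; rewrite big_nil mul0r.
  by rewrite Rintegral_cst ?mul0r //; exact: Omega_measurable.
have hs e' : e' \in s -> cont (sp x e'.1 e'.2) by move=> he; apply: h; rewrite inE he orbT.
rewrite big_cons -(ih hs) addrC -I_lin; first last.
- by apply: h; rewrite inE eqxx.
- exact: within_sum.
by congr fine; apply: eq_integral => t _; rewrite big_cons [in LHS]addrC.
Qed.

Lemma cont_close f : (forall e, 0 < e -> exists2 g, cont g &
  forall p, Omega_bar x p -> `|f p - g p| <= e) -> cont f.
Proof.
move=> h; apply: eps_within => p op e e0.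
have e4 : 0 < e / 4 by lra.
have [g cg hg] := h _ e4; have [d d0 hd] := within_eps cg op e4.
exists d => // p' op' hp; have := hd p' op' hp; have := hg p op; have := hg p' op'.
rewrite !ler_norml !ltr_norml => /andP[? ?] /andP[? ?] /andP[? ?].
by apply/andP; split; lra.
Qed.

Definition solution (s : R * R) : R := I (Green x s).

Definition partial_solution n : R * R -> R :=
  comb x n (fun e => \sum_(l < 3) gco x e.1 e.2 l * I (sp x e.1 l)).

Lemma partial_solutionE n s : partial_solution n s = I (partial_Green x n s).
Proof.
have -> : partial_Green x n s =
    comb x n (fun e => \sum_(k < 3) gco x e.1 k e.2 * sp x e.1 k s).
  by apply/funext => t; exact: partial_GreenE.
rewrite I_comb (gco_swap x n (fun w k => sp x w k s) (fun w l => I (sp x w l))).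
by [].
Qed.

Lemma partial_Green_cont n s : cont (partial_Green x n s).
Proof.
have -> : partial_Green x n s =
    comb x n (fun e => \sum_(k < 3) gco x e.1 k e.2 * sp x e.1 k s).
  by apply/funext => t; exact: partial_GreenE.
exact: comb_continuous_bar.
Qed.

Lemma geom35_small (C e : R) : 0 < e -> 0 <= C ->
  exists N, forall n, (N <= n)%N -> 45 / 2 * (3 / 5) ^+ n * C <= e.
Proof.
move=> e0 C0; have e1 : 0 < e / (C + 1) by rewrite divr_gt0 //; lra.
move/cvgrPdist_lt: (@geom35_cvg R) => /(_ _ e1) [N _ hN].
exists N => n /hN /=; rewrite sub0r normrN => /(le_lt_trans (ler_norm _)).
rewrite ltr_pdivlMr; last by lra.
have : 0 <= 45 / 2 * (3 / 5) ^+ n :> R by rewrite mulr_ge0 ?exprn_ge0 //; lra.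
by move: (45 / 2 * _) => P; nra.
Qed.

Lemma Green_cont s : Omega_bar x s -> cont (Green x s).
Proof.
move=> os; apply: cont_close => e e0; have [N hN] := geom35_small e0 (@ler01 R).
exists (partial_Green x N s); first exact: partial_Green_cont.
move=> p op; apply: le_trans (Green_close x_gt0 x_lt1 x_nd N os op) _.
by have := hN N (leqnn N); rewrite mulr1.
Qed.

Lemma solution_close e : 0 < e -> exists N, forall n s, (N <= n)%N -> Omega_bar x s ->
  `|solution s - partial_solution n s| <= e.
Proof.
move=> e0; have [C C0 hC] := I_bound; have [N hN] := geom35_small e0 C0.
exists N => n s Nn os; rewrite partial_solutionE.
have -> : solution s - I (partial_Green x n s) =
    I (fun t => Green x s t + (-1) * partial_Green x n s t).
  rewrite I_lin ?mulN1r //; [exact: Green_cont|exact: partial_Green_cont].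
apply: le_trans (hN n Nn); apply: hC.
- by apply: within_lin; [exact: Green_cont|exact: partial_Green_cont].
- by rewrite mulr_ge0 ?exprn_ge0 //; lra.
- by move=> t ot; rewrite mulN1r; exact: Green_close.
Qed.

Lemma solution_eq s (a : R) : Omega_bar x s ->
  (exists N, forall n, (N <= n)%N -> partial_solution n s = a) -> solution s = a.
Proof.
move=> os [N hN]; apply/eqP; rewrite -subr_eq0 -normr_le0.
apply/ler_addgt0Pr => e e0; rewrite add0r; have [M hM] := solution_close e0.
have := hM (maxn N M) s (leq_maxr _ _) os; by rewrite hN // leq_maxl.
Qed.

Lemma solution_cont : cont solution.
Proof.
apply: cont_close => e e0; have [N hN] := solution_close e0.
exists (partial_solution N); first exact: comb_continuous_bar.
by move=> p op; exact: hN.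
Qed.

Lemma solution_line p : Sline x p -> solution p = 0.
Proof.
move=> lp; apply: solution_eq; first by right.
by exists 0%N => n _; exact: comb_line.
Qed.

Lemma q0_bar : Omega_bar x (q ord0).
Proof. by left; split; [exact: SG_q|rewrite /q /= gtrBl]. Qed.

Lemma solution_q0 : solution (q ord0) = 0.
Proof.
apply: solution_eq; first exact: q0_bar.
by exists 0%N => n _; exact: comb_q0.
Qed.

(** Splines of later levels vanish at the vertices of level [n], so the partial solutions are
    stationary there. *)
Lemma solution_agree n : agree x n solution (partial_solution n).
Proof.
apply: agree_Omega => // w i sw ow; apply: solution_eq => //.
exists n => m nm; rewrite -[LHS]/(vx (partial_solution m) w i).
by apply: comb_vertex => //; rewrite sw.
Qed.

(** The coefficients of the partial solution are [gco] applied to the integrals of the splines, so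
    [Eh_Green] leaves the defects of [v] against these integrals. *)
Lemma Eh_solution n v : Eh x n solution v = I (interp x n v).
Proof.
rewrite (Eh_agree _ (@solution_agree n)) /partial_solution.
rewrite (Eh_Green x_gt0 x_lt1 n (fun w l => I (sp x w l))).
by rewrite /interp I_comb.
Qed.

Lemma I_interp_cvg v : cont v -> v (q ord0) = 0 -> (forall p, Sline x p -> v p = 0) ->
  (fun n => I (interp x n v)) @ \oo --> I v.
Proof.
move=> cv v0 vS; have [C C0 hC] := I_bound.
apply/cvgrPdist_le => e e0; have e1 : 0 < e / (C + 1) by rewrite divr_gt0 //; lra.
have [N hN] := interp_close x_gt0 x_lt1 x_nd cv v0 vS e1.
exists N => // n /= Nn; have ci : cont (interp x n v).
  exact: comb_continuous_bar.
have -> : I v - I (interp x n v) = I (fun t => v t + (-1) * interp x n v t).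
  by rewrite I_lin // mulN1r.
apply: (@le_trans _ _ (e / (C + 1) * C)).
  apply: hC; [exact: within_lin|exact: ltW|].
  by move=> p op; rewrite mulN1r distrC; exact: hN.
by rewrite mulrAC ler_pdivrMr; [rewrite ler_pM2l //; lra|lra].
Qed.

Lemma En_cvg_bounded v (M : R) : (forall n, En x n v v <= M) ->
  cvgn (fun n => En x n v v).
Proof.
move=> h; apply: nondecreasing_is_cvgn; last by exists M => _ [n _ <-].
by move=> n m; exact: En_mono.
Qed.

(** By [Eh_solution] the trace energy of the solution is the integral against its own interpolant,
    which converges; this bounds the increasing graph energies. *)
Lemma solution_energy : cvgn (fun n => En x n solution solution).
Proof.
have hc := I_interp_cvg solution_cont solution_q0 solution_line.
move/cvgrPdist_lt: hc => /(_ 1 ltr01) [N _ hN].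
apply: (@En_cvg_bounded _ (I solution + 1)) => n.
apply: (le_trans (En_mono x solution (leq_maxl n N))).
apply: (le_trans (En_le_Eh x_gt0 x_lt1 _ _)); rewrite Eh_solution.
by have := hN (maxn n N) (leq_maxr _ _); rewrite /= ltr_norml => /andP[]; lra.
Qed.

(** Since the energies increase with the level, convergence along the levels [nexp x m] is
    convergence along all levels. *)
Lemma dom0P v : dom0 x v <-> [/\ cont v, v (q ord0) = 0,
  forall p, Sline x p -> v p = 0 & cvgn (fun n => En x n v v)].
Proof.
have gE : (fun m => graph_energy (Omega x) (nexp x m) v) =
    fun m => En x (nexp x m) v v.
  by apply/funext => m; rewrite graph_energyE gformO.
split=> [[[cv fv] v0]|[cv v0 vS ev]]; last first.
  split; first split => //.
    by rewrite /finite_energy gE; apply/cvg_ex; eexists; exact: (cvg_nexp x_gt0 x_lt1 ev).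
  by move=> p [->|/vS].
split => //; [by apply: v0; left|by move=> p lp; apply: v0; right|].
move: fv; rewrite /finite_energy gE => fv.
apply: (@En_cvg_bounded _ (limn (fun m => En x (nexp x m) v v))) => n.
apply: (le_trans (En_mono x v (nexp_ge x_gt0 x_lt1 n))).
apply: (@nondecreasing_cvgn_le _ (fun m => En x (nexp x m) v v)) => // a b ab.
by apply: En_mono; rewrite nexp_le.
Qed.

Lemma energyE v (l : R) : (fun n => En x n v v) @ \oo --> l ->
  energy (Omega x) (nexp x) v = l.
Proof.
move=> h; apply: cvg_lim => //.
rewrite (_ : (fun m => _) = fun m => En x (nexp x m) v v).
  exact: (cvg_nexp x_gt0 x_lt1 h).
by apply/funext => m; rewrite graph_energyE gformO.
Qed.

(** [Bd] is [Eh - En], and [Eh] never exceeds the limit of [En] by [Eh_le_energy], so [Bd] is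
    squeezed to 0. *)
Lemma dom0_Bd v : dom0 x v -> (fun n => Bd x n v v) @ \oo --> (0 : R).
Proof.
move=> /dom0P[cv v0 vS ev]; set L := limn (fun n => En x n v v) in ev.
have hL n : En x n v v <= L.
  by apply: (@nondecreasing_cvgn_le _ (fun n => En x n v v)) => // a b; exact: En_mono.
have h : (fun n => L - En x n v v) @ \oo --> (L - L : R).
  by apply: cvgB; [exact: cvg_cst|exact: ev].
rewrite subrr in h; apply: squeeze_cvgr (cvg_cst 0) h; apply: nearW => n.
rewrite Bd_ge0 //= lerBrDr addrC -EhE.
exact: (Eh_le_energy x_gt0 x_lt1 x_nd).
Qed.

(** Parallelogram law: the energy of [u - c v] is nonnegative, so that of [u + c v] is at most twice
    the sum of the two energies. *)
Lemma dom0_lin u v (c : R) : dom0 x u -> dom0 x v -> c ^+ 2 = 1 ->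
  dom0 x (fun p => u p + c * v p).
Proof.
move=> /dom0P[cu u0 uS eu] /dom0P[cv v0 vS ev] c1; apply/dom0P; split.
- exact: within_lin.
- by rewrite u0 v0 mulr0 addr0.
- by move=> p lp; rewrite uS ?vS // mulr0 addr0.
have bnd f : cvgn (fun n => En x n f f) -> forall n, En x n f f <= limn (fun n => En x n f f).
  move=> ef n; apply: (@nondecreasing_cvgn_le _ (fun n => En x n f f)) => // a b.
  exact: En_mono.
apply: (@En_cvg_bounded _ (2 * limn (fun n => En x n u u) + 2 * limn (fun n => En x n v v))).
move=> n; have := bnd u eu n; have := bnd v ev n.
have : 0 <= En x n (fun p => u p + (- c) * v p) (fun p => u p + (- c) * v p) by exact: En_ge0.
have e1 d : En x n (fun p => u p + d * v p) (fun p => u p + d * v p) =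
    En x n u u + 2 * d * En x n u v + d ^+ 2 * En x n v v by exact: gform_sqr.
rewrite !e1 sqrrN c1; move: (limn _) (limn _) (En _ _ _ _) (En _ _ _ _) (En _ _ _ _).
by move=> a b A B D; lra.
Qed.

Lemma solution_solves : dom0 x solution /\
  (forall v, dom0 x v -> energyOmega x solution v = I v).
Proof.
have du : dom0 x solution.
  apply/dom0P; split; [exact: solution_cont|exact: solution_q0|exact: solution_line|].
  exact: solution_energy.
split=> // v dv; have ep : solution \+ v = fun p => solution p + 1 * v p.
  by apply/funext => p; rewrite mul1r.
have em : solution \- v = fun p => solution p + (-1) * v p.
  by apply/funext => p; rewrite mulN1r.
have dp : dom0 x (solution \+ v) by rewrite ep; apply: dom0_lin => //; rewrite expr1n.
have dm : dom0 x (solution \- v) by rewrite em; apply: dom0_lin => //; rewrite sqrrN expr1n.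
have [cv v0 vS ev] := (dom0P v).1 dv.
have [_ _ _ Ep] := (dom0P _).1 dp; have [_ _ _ Em] := (dom0P _).1 dm.
rewrite /energyOmega /energy_form (energyE Ep) (energyE Em).
(* The mixed conductor term tends to 0 by polarization, the sum and the difference being in the
   Dirichlet domain. *)
have hB : (fun n => Bd x n solution v) @ \oo --> (0 : R).
  have h : (fun n => Bd x n (solution \+ v) (solution \+ v) -
      Bd x n (solution \- v) (solution \- v)) @ \oo --> (0 : R).
    by rewrite -[X in _ --> X](subrr 0); apply: cvgB; exact: dom0_Bd.
  have h4 : (fun n => (Bd x n (solution \+ v) (solution \+ v) -
      Bd x n (solution \- v) (solution \- v)) * 4^-1) @ \oo --> (0 * 4^-1 : R).
    by apply: cvgM => //; exact: cvg_cst.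
  rewrite mul0r in h4; apply: cvg_trans h4; apply: near_eq_cvg; apply: nearW => n.
  by rewrite Bd_polar; field.
have hE : (fun n => En x n solution v) @ \oo --> I v.
  have h : (fun n => I (interp x n v) - Bd x n solution v) @ \oo --> (I v : R).
    rewrite -[X in _ --> X]subr0; apply: cvgB => //; exact: I_interp_cvg.
  apply: cvg_trans h; apply: near_eq_cvg; apply: nearW => n /=.
  by rewrite -Eh_solution EhE addrK.
have h : (fun n => En x n (solution \+ v) (solution \+ v) -
    En x n (solution \- v) (solution \- v)) @ \oo -->
    limn (fun n => En x n (solution \+ v) (solution \+ v)) -
    limn (fun n => En x n (solution \- v) (solution \- v)) by exact: cvgB.
have h4 : (fun n => 4 * En x n solution v) @ \oo --> (4 * I v : R).
  by apply: cvgM => //; exact: cvg_cst.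
have e : limn (fun n => En x n (solution \+ v) (solution \+ v)) -
    limn (fun n => En x n (solution \- v) (solution \- v)) = 4 * I v.
  have hp : (fun n => En x n (solution \+ v) (solution \+ v) -
      En x n (solution \- v) (solution \- v)) = fun n => 4 * En x n solution v.
    by apply/funext => n; rewrite En_polar.
  by rewrite hp in h; rewrite -(cvg_lim _ h4) // -(cvg_lim _ h).
by rewrite e mulrC mulKf.
Qed.

End Dirichlet.

Theorem theorem5p3 (R : realType) (mu : probability (R * R)%type R)
    (hmu : self_similar mu) (x : R) (x_gt0 : 0 < x) (x_lt1 : x < 1)
    (x_ndyadic : ~ dyadic x) :
  {uniform Omega_bar x `*` Omega_bar x,
    (fun (m : nat) (st : (R * R) * (R * R)) => Gm x m st.1 st.2) @ \oo -->
    (fun st : (R * R) * (R * R) => Green x st.1 st.2)} /\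
  (forall F : R * R -> R, {within Omega_bar x, continuous F} ->
     solves_dirichlet mu x F
       (fun s => \int[mu]_(t in Omega x) (Green x s t * F t))).
Proof.
split; first exact: Gm_uniform.
move=> F cF; have [du h] := solution_solves mu x_gt0 x_lt1 x_ndyadic cF.
split => // v dv; rewrite h //.
by congr fine; apply: eq_integral => t _; rewrite mulrC.
Qed.
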